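(* Let $\phi\in\mathcal{B}$ be the Laplace exponent of a possibly killed subordinator and let $I_\phi(t)$ be its exponential functional up to time $t$. For every $t\in(0,\infty)$ and every $z\in\mathbb{C}$ with $\Re(z)>0$, $$\mathbb{E}[I_\phi^z(t)] = 1 \ast \frac{z t^{z-1}}{e^{\phi(1)t}}\ast \mathop{\ast}_{k=1}^{\infty}\Bigg[\delta_0(dt)+\sum_{m=1}^\infty \frac{(z)^{(m)}\big(-[\phi(k+1)-\phi(k)]\big)^m}{(m!)^2}\,\frac{m t^{m-1}}{e^{\phi(k)t}}+[\phi(z+k)-\phi(k)]\sum_{m=0}^\infty\frac{(z)^{(m)}\big(-[\phi(k+1)-\phi(k)]\big)^{m}}{(m!)^2}\,\frac{t^{m}}{e^{\phi(k)t}}\Bigg].$$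
   Context: $\phi\in\mathcal{B}$ (Bernstein function) means that for all $z$ with $\Re z\ge0$, $\phi(z)=\phi(0)+dz+\int_0^\infty(1-e^{-zy})\Pi(dy)$ with $\phi(0),d\in[0,\infty)$ and $\Pi$ a measure on $[0,\infty)$ with $\int_0^\infty\min\{y,1\}\Pi(dy)<\infty$. The associated possibly killed subordinator $X=(X_t)_{t\ge0}$ satisfies $\mathbb{E}[e^{-zX_t}]=e^{-\phi(z)t}$ for $\Re z\ge0$, $t\ge0$; if $\phi(0)>0$ it is killed (sent to $+\infty$) at an independent exponential time $e_{\phi(0)}$ of rate $\phi(0)$, with $e^{-\infty}=0$. Its exponential functional is $I_\phi(t)=\int_0^te^{-X_s}\,ds$. The symbol $\ast$ denotes convolution, $(f\ast g)(t)=\int_0^tf(s)g(t-s)\,ds$, extended to measures on $[0,\infty)$, with $\delta_0$ the Dirac mass at $0$ (so $\delta_0\ast f=f$). In the formula, functions of $t$ are convolved and the result is evaluated at $t$; $1$ is the constant function. The infinite convolution is the limit of truncated convolutions: the right-hand side at $t$ is $\lim_{n\to\infty}\big(1\ast g\ast h_1\ast\cdots\ast h_n\big)(t)$, where $g(t)=zt^{z-1}e^{-\phi(1)t}$ and $h_k$ is the $k$-th bracket. $(z)^{(m)}=z(z+1)\cdots(z+m-1)$ is the rising factorial, $(z)^{(0)}=1$. *)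

(* Defs.v *)
From HB Require Import structures.
From mathcomp Require Import all_boot all_order all_algebra.
From mathcomp Require Import complex.
From mathcomp Require Import all_classical all_reals all_analysis.
From mathcomp Require Import measurable_realfun.
Set Implicit Arguments.
Unset Strict Implicit.
Unset Printing Implicit Defensive.
Import Order.TTheory GRing.Theory Num.Theory.
Import numFieldNormedType.Exports.
Local Open Scope classical_set_scope.
Local Open Scope ring_scope.
Local Open Scope complex_scope.

Definition cexp (R : realType) (z : R[i]) : R[i] :=
  (expR (complex.Re z))%:C *
  (cos (complex.Im z) +i* sin (complex.Im z)).

(* Principal power of a real base; meant for [0 <= x], with 0 ^ z = 0 for
   z <> 0. *)
Definition cpow (R : realType) (x : R) (z : R[i]) : R[i] :=
  if x == 0 then (z == 0)%:R else cexp (z * (ln x)%:C).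

(* [exp (- z x)] for an extended real [x], with the convention e^{-oo} = 0,
   also at [z = 0]. *)
Definition cexpN (R : realType) (z : R[i]) (x : \bar R) : R[i] :=
  if x is r%:E then cexp (- (z * r%:C)) else 0.

Definition cintegral d (T : measurableType d) (R : realType)
    (mu : {measure set T -> \bar R}) (D : set T) (f : T -> R[i]) : R[i] :=
  (\int[mu]_(x in D) complex.Re (f x)) +i*
  (\int[mu]_(x in D) complex.Im (f x)).

Definition cexpectation d (T : measurableType d) (R : realType)
    (P : probability T R) (Z : T -> R[i]) : R[i] :=
  fine ('E_P[fun w => complex.Re (Z w)])%E +i*
  fine ('E_P[fun w => complex.Im (Z w)])%E.

(* In [R[i]], [0 <= a] says that [a] is real and nonnegative. The measure on
   [0, +oo) is the trace of a Borel measure [Pi] on the line. *)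
Definition bernstein (R : realType) (phi : R[i] -> R[i]) : Prop :=
  exists (d : R) (Pi : {measure set R -> \bar R}),
    [/\ 0 <= phi 0, 0 <= d,
        (\int[Pi]_(y in `[0%R, +oo[) (Num.min y 1)%R%:E < +oo)%E &
        forall z : R[i], 0 <= complex.Re z ->
          phi z = phi 0 + d%:C * z +
            cintegral Pi `[0, +oo[ (fun y => 1 - cexp (- (z * y%:C)))].

Definition independent_increments d (T : measurableType d) (R : realType)
    (P : probability T R) (Y : R -> {RV P >-> R}) : Prop :=
  forall (n : nat) (t : nat -> R) (B : nat -> set R),
    0 <= t 0%N -> (forall i, (i < n)%N -> t i <= t i.+1) ->
    (forall i, measurable (B i)) ->
    P (\bigcap_(i < n) [set w | B i (Y (t i.+1) w - Y (t i) w)]) =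
    (\prod_(i < n) P [set w | B i (Y (t i.+1) w - Y (t i) w)%R])%E.

Definition stationary_increments d (T : measurableType d) (R : realType)
    (P : probability T R) (Y : R -> {RV P >-> R}) : Prop :=
  forall (s t : R) (B : set R), 0 <= s -> 0 <= t -> measurable B ->
    P [set w | B (Y (s + t) w - Y s w)] = P [set w | B (Y t w)].

(* Only times [t >= 0] matter; left limits exist by monotonicity. *)
Definition subordinator d (T : measurableType d) (R : realType)
    (P : probability T R) (Y : R -> {RV P >-> R}) : Prop :=
  [/\ forall w, Y 0 w = 0,
      forall w s t, 0 <= s -> s <= t -> Y s w <= Y t w,
      forall w t, 0 <= t -> Y s w @[s --> t^'+] --> Y t w,
      independent_increments Y &
      stationary_increments Y].

Definition sigma_of_process d (T : measurableType d) (R : realType)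
    (P : probability T R) (Y : R -> {RV P >-> R}) : set (set T) :=
  <<s [set Y t @^-1` B | t in [set t : R | 0 <= t] & B in measurable] >>.

(* [X] is a subordinator [Y] sent to +oo at an independent exponential time
   [e] of rate [phi 0]; the tail formula makes [e = +oo] almost surely when
   [phi 0 = 0]. *)
Definition killed_subordinator d (T : measurableType d) (R : realType)
    (P : probability T R) (phi : R[i] -> R[i]) (X : R -> T -> \bar R) : Prop :=
  (exists (Y : R -> {RV P >-> R}) (e : {mfun T >-> \bar R}),
    [/\ subordinator Y,
        forall s : R, 0 <= s ->
          P [set w | (s%:E < e w)%E] = (expR (- (complex.Re (phi 0) * s)))%:E,
        forall (A : set T) (B : set (\bar R)),
          sigma_of_process Y A -> measurable B ->
          P (A `&` e @^-1` B) = (P A * P (e @^-1` B))%E &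
        forall t w, 0 <= t ->
          X t w = if (t%:E < e w)%E then (Y t w)%:E else +oo%E]) /\
  (forall (z : R[i]) (t : R), 0 <= complex.Re z -> 0 <= t ->
    cexpectation P (fun w => cexpN z (X t w)) = cexp (- (phi z * t%:C))).

(* [expeR -oo = 0], so the integrand vanishes after killing. *)
Definition exp_functional (R : realType) (T : Type) (X : R -> T -> \bar R)
    (t : R) (w : T) : R :=
  fine (\int[lebesgue_measure]_(s in `[0%R, t]) expeR (- X s w))%E.

Definition rising (R : realType) (z : R[i]) (m : nat) : R[i] :=
  \prod_(i < m) (z + i%:R).

Definition conv (R : realType) (u v : R -> R[i]) (t : R) : R[i] :=
  cintegral lebesgue_measure `[0, t] (fun s => u s * v (t - s)).

Definition conv_measure (R : realType) (u : R -> R[i])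
    (nu : {measure set R -> \bar R}) (t : R) : R[i] :=
  cintegral nu `[0, t] (fun s => u (t - s)).

(* Convolution of [u] with the complex measure [\d_0 + f(t) dt]. *)
Definition conv_dirac_density (R : realType) (u f : R -> R[i]) (t : R) : R[i] :=
  conv_measure u \d_(0 : R) t + conv u f t.

(* The infinite sums are limits in the normed space [R[i]^o]. *)
Definition bracket_density (R : realType) (phi : R[i] -> R[i]) (z : R[i])
    (k : nat) (t : R) : R[i] :=
  let c (m : nat) : R[i] :=
    rising z m * (- (phi k.+1%:R - phi k%:R)) ^+ m / (m`!%:R) ^+ 2 in
  let E : R[i] := cexp (phi k%:R * t%:C) in
  limn (fun n => (\sum_(1 <= m < n) c m * ((m%:R * t%:C ^+ m.-1) / E)) : R[i]^o)
  + (phi (z + k%:R) - phi k%:R) *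
  limn (fun n => (\sum_(0 <= m < n) c m * (t%:C ^+ m / E)) : R[i]^o).

Definition initial_density (R : realType) (phi : R[i] -> R[i]) (z : R[i])
    (t : R) : R[i] :=
  z * cpow t (z - 1) / cexp (phi 1 * t%:C).

(* 1 * g * h_1 * ... * h_n *)
Fixpoint truncated_convolution (R : realType) (phi : R[i] -> R[i]) (z : R[i])
    (n : nat) : R -> R[i] :=
  if n is n'.+1 then
    conv_dirac_density (truncated_convolution phi z n') (bracket_density phi z n)
  else conv (fun=> 1) (initial_density phi z).

(* Main.v *)
(* Write [X] as a subordinator [Y] killed at an independent exponential time of
   rate [kappa = phi 0], let [J t] be the integral of [e^{-Y}] over [0, t], and put
   [V_n t = e^{-kappa t} E[e^{-n Y_t} (J t)^{z-1}]], [S_n = V_n * 1],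
   [E_a = exp(-a t)].  The moment is [z S_1].  Splitting
   [e^{-n Y_t} (J t)^z] along the path at time [s], once through [J t - J s] and once
   through [J s], and using the independence and stationarity of increments gives
   [V_n * E_{phi(z+n)} = V_{n+1} * E_{phi n}], that is
   [S_n = S_{n+1} + (phi(z+n) - phi n) E_{phi n} * S_{n+1}].  Hence [z S_1] is the image
   of [z S_{n+1}] under [K_n], the product over [k <= n] of the operators
   [1 + (phi(z+k) - phi k) J_k] with [J_k u = E_{phi k} * u].

   A termwise beta integral shows that the n-th truncated convolution is [K_n] applied
   to [G_n t], the integral of [z s^{z-1} E_{phi(n+1)} s] over [0, t].  The difference
   [K_n (z S_{n+1} - G_n)] need not be small term by term, but convolving it with
   [E_{phi(z+1)}, ..., E_{phi(z+N)}] turns it, by the resolvent identity, into an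
   operator of the same kind for [z + N] applied to an [N]-fold smoothing of the error,
   and for large [N] the result tends to 0.  The brackets minus [delta_0] have weighted
   [L^1] norm [O(1/n^2)], so the truncated convolutions converge, and the limit is
   identified because convolution with an exponential is injective. *)
Require Import Defs.
From HB Require Import structures.
From mathcomp Require Import all_boot all_order all_algebra.
From mathcomp Require Import complex.
From mathcomp Require Import all_classical all_reals all_analysis.
From mathcomp Require Import measurable_realfun.
From mathcomp Require Import ring lra.
Set Implicit Arguments.
Unset Strict Implicit.
Unset Printing Implicit Defensive.
Import Order.TTheory GRing.Theory Num.Theory.
Import numFieldNormedType.Exports.
Local Open Scope classical_set_scope.
Local Open Scope ring_scope.
Local Open Scope complex_scope.
Local Notation conv := Defs.conv.

Local Notation Re := complex.Re.
Local Notation Im := complex.Im.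

(** In the Laplace variable [s], [E_a] is [1 / (s + a)] and [K_n] is the product of the fractions
    [(s + phi (z + k)) / (s + phi k)]; the algebra of the proof is that of these fractions. Let
    [P_k = 1 + phi k]. For the weight [exp (- s)] the error [z S_{n+1} - G_n] is bounded by a
    multiple of [n^-1 P_n^(- Re z)], while the bound for [K_n] is of order [P_n^|z|], and these
    powers balance only for real [z]. Smoothing [N] times cancels the [N] first numerators, gains
    [P_n^(- N)] and leaves an operator of order [P_n^|z + N|]. Since [|z + N| - N] tends to [Re z],
    some [N] brings the total exponent of [P_n] to at most [1 / 2]; as [P_n] grows at most linearly,
    the result is [O(n^(- 1 / 2))]. Summability of the brackets rests on a cancellation: the
    constant term [- z (phi (k + 1) - phi k)] of the first sum is, up to second order, the opposite
    of [phi (z + k) - phi k]. *)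

Definition cmod (R : realType) (z : R[i]) : R := Normc.normc z.
Arguments cmod : simpl never.

(** * Modulus and exponential of complex numbers *)

Section modulus.
Context {R : realType}.
Implicit Types (a b : R[i]) (r : R).

Lemma cmodE a : cmod a = Num.sqrt (Re a ^+ 2 + Im a ^+ 2).
Proof. by case: a. Qed.

Lemma cmod_ge0 a : 0 <= cmod a.
Proof. by rewrite cmodE sqrtr_ge0. Qed.

Lemma cmod0 : cmod (0 : R[i]) = 0.
Proof. exact: Normc.normc0. Qed.

Lemma cmod1 : cmod (1 : R[i]) = 1.
Proof. exact: Normc.normc1. Qed.

Lemma cmod_eq0 a : cmod a = 0 -> a = 0.
Proof. exact: Normc.eq0_normc. Qed.

Lemma cmodM a b : cmod (a * b) = cmod a * cmod b.
Proof. exact: Normc.normcM. Qed.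

Lemma cmodV a : cmod a^-1 = (cmod a)^-1.
Proof. exact: Normc.normcV. Qed.

Lemma cmodD a b : cmod (a + b) <= cmod a + cmod b.
Proof. exact: le_normcD. Qed.

Lemma cmodN a : cmod (- a) = cmod a.
Proof. exact: normcN. Qed.

Lemma cmodB a b : cmod (a - b) = cmod (b - a).
Proof. by rewrite -cmodN opprB. Qed.

Lemma cmodX a n : cmod (a ^+ n) = cmod a ^+ n.
Proof. by elim: n => [|n IH]; rewrite ?expr0 ?cmod1// !exprS cmodM IH. Qed.

Lemma cmodC r : cmod r%:C = `|r|.
Proof. by rewrite cmodE/= expr0n/= addr0 sqrtr_sqr. Qed.

Lemma cmod_nat n : cmod (n%:R : R[i]) = n%:R.
Proof. by rewrite -(rmorph_nat (real_complex R)) cmodC ger0_norm. Qed.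

Lemma Re_le_cmod a : `|Re a| <= cmod a.
Proof.
by rewrite cmodE -sqrtr_sqr ler_wsqrtr// lerDl sqr_ge0.
Qed.

Lemma Im_le_cmod a : `|Im a| <= cmod a.
Proof. by rewrite cmodE -sqrtr_sqr ler_wsqrtr// lerDr sqr_ge0. Qed.

Lemma cmod_le_ReIm a : cmod a <= `|Re a| + `|Im a|.
Proof.
rewrite cmodE -[leRHS]ger0_norm ?addr_ge0// -sqrtr_sqr ler_wsqrtr//.
by rewrite sqrrD !real_normK ?num_real// -addrA lerD2l lerDr mulrn_wge0// mulr_ge0.
Qed.

Lemma cmod_sum I (s : seq I) (Q : pred I) (F : I -> R[i]) :
  cmod (\sum_(i <- s | Q i) F i) <= \sum_(i <- s | Q i) cmod (F i).
Proof.
elim/big_ind2: _ => [|x1 x2 y1 y2 h1 h2|//]; first by rewrite cmod0.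
by rewrite (le_trans (cmodD _ _))// lerD.
Qed.

Lemma ReD a b : Re (a + b) = Re a + Re b. Proof. by case: a; case: b. Qed.
Lemma ImD a b : Im (a + b) = Im a + Im b. Proof. by case: a; case: b. Qed.
Lemma ReN a : Re (- a) = - Re a. Proof. by case: a. Qed.
Lemma ImN a : Im (- a) = - Im a. Proof. by case: a. Qed.
Lemma ReM a b : Re (a * b) = Re a * Re b - Im a * Im b.
Proof. by case: a; case: b. Qed.
Lemma ImM a b : Im (a * b) = Re a * Im b + Im a * Re b.
Proof. by case: a => ? ?; case: b. Qed.

Lemma complex_ext a b : Re a = Re b -> Im a = Im b -> a = b.
Proof. by case: a => ? ?; case: b => ? ? /= -> ->. Qed.

Lemma ReMc r a : Re (r%:C * a) = r * Re a.
Proof. by rewrite ReM/= mul0r subr0. Qed.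
Lemma ImMc r a : Im (r%:C * a) = r * Im a.
Proof. by rewrite ImM/= mul0r addr0. Qed.
Lemma ReMcr r a : Re (a * r%:C) = Re a * r.
Proof. by rewrite ReM/= mulr0 subr0. Qed.
Lemma ImMcr r a : Im (a * r%:C) = Im a * r.
Proof. by rewrite ImM/= mulr0 add0r. Qed.

(* Test against the rotation carrying [a] onto the positive half-line. *)
Lemma cmod_leP (a : R[i]) (C : R) : 0 <= C ->
  (forall c, cmod c = 1 -> Re (c * a) <= C) -> cmod a <= C.
Proof.
move=> C0 aC; have [a0|a0] := eqVneq (cmod a) 0; first by rewrite a0.
pose c := (Re a +i* (- Im a)) / (cmod a)%:C.
have ca : c * a = (cmod a)%:C.
  rewrite /c mulrAC (_ : _ * a = (cmod a ^+ 2)%:C).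
    by rewrite expr2 rmorphM/= mulfK// -(rmorph0 (real_complex R)) (inj_eq (@complexI R)).
  rewrite cmodE sqr_sqrtr ?addr_ge0 ?sqr_ge0//.
  by apply: complex_ext; rewrite !(ReM, ImM)/=; ring.
have c1 : cmod c = 1.
  rewrite /c cmodM cmodV cmodC (ger0_norm (cmod_ge0 _)) [cmod (_ +i* _)]cmodE/= sqrrN.
  by rewrite -[X in X / _ = _]/(Num.sqrt (Re a ^+ 2 + Im a ^+ 2)) -cmodE divff.
by have := aC c c1; rewrite ca.
Qed.

Lemma Re_nat n : Re (n%:R : R[i]) = n%:R.
Proof. by rewrite -(rmorph_nat (real_complex R)). Qed.
Lemma Im_nat n : Im (n%:R : R[i]) = 0.
Proof. by rewrite -(rmorph_nat (real_complex R)). Qed.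

Lemma cexpD a b : cexp (a + b) = cexp a * cexp b.
Proof.
rewrite /cexp ReD ImD expRD cosD sinD.
by apply: complex_ext; rewrite !(ReM, ImM)/=; ring.
Qed.

Lemma cexp0 : cexp (0 : R[i]) = 1.
Proof.
by rewrite /cexp/= expR0 cos0 sin0 mul1r.
Qed.

Lemma cmod_cexp a : cmod (cexp a) = expR (Re a).
Proof.
rewrite /cexp cmodM cmodC ger0_norm ?expR_ge0// [cmod (_ +i* _)]cmodE/=.
by rewrite cos2Dsin2 sqrtr1 mulr1.
Qed.

Lemma cexp_neq0 a : cexp a != 0.
Proof.
apply/eqP => h; have := cmod_cexp a; rewrite h cmod0 => /eqP.
by rewrite lt_eqF// expR_gt0.
Qed.

Lemma cexpN1 a : cexp (- a) = (cexp a)^-1.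
Proof.
apply: (mulIf (cexp_neq0 a)); rewrite -cexpD addNr cexp0 mulVf//.
exact: cexp_neq0.
Qed.

Lemma cexpC r : cexp r%:C = (expR r)%:C.
Proof. by rewrite /cexp/= cos0 sin0 mulr1. Qed.

End modulus.

(** * Measurable and integrable complex functions *)

Definition cmeas d (T : measurableType d) (R : realType) (D : set T)
    (f : T -> R[i]) :=
  measurable_fun D (fun x => Re (f x)) /\ measurable_fun D (fun x => Im (f x)).

Definition cintble d (T : measurableType d) (R : realType)
    (mu : {measure set T -> \bar R}) (D : set T) (f : T -> R[i]) :=
  mu.-integrable D (fun x => (Re (f x))%:E) /\
  mu.-integrable D (fun x => (Im (f x))%:E).

Section cmeas.
Context d (T : measurableType d) (R : realType).
Implicit Types (f g : T -> R[i]) (D : set T).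

Lemma eq_cmeas D f g : (forall x, D x -> f x = g x) -> cmeas D f -> cmeas D g.
Proof.
move=> fg [fr fi]; split.
- apply: eq_measurable_fun fr => x /set_mem Dx; by rewrite /= fg.
- apply: eq_measurable_fun fi => x /set_mem Dx; by rewrite /= fg.
Qed.

Lemma cmeas_cst D (c : R[i]) : cmeas D (fun=> c).
Proof. by split; exact: measurable_cst. Qed.

Lemma cmeas_real D (f : T -> R) : measurable_fun D f -> cmeas D (fun x => (f x)%:C).
Proof. by move=> mf; split => //=; exact: measurable_cst. Qed.

Lemma cmeasD D f g : cmeas D f -> cmeas D g -> cmeas D (fun x => f x + g x).
Proof.
move=> [fr fi] [gr gi]; split.
- under eq_fun do rewrite ReD; exact: measurable_funD.
- under eq_fun do rewrite ImD; exact: measurable_funD.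
Qed.

Lemma cmeasN D f : cmeas D f -> cmeas D (fun x => - f x).
Proof.
move=> [fr fi]; split.
- under eq_fun do rewrite ReN; exact: measurableT_comp.
- under eq_fun do rewrite ImN; exact: measurableT_comp.
Qed.

Lemma cmeasB D f g : cmeas D f -> cmeas D g -> cmeas D (fun x => f x - g x).
Proof. by move=> mf mg; apply: cmeasD => //; exact: cmeasN. Qed.

Lemma cmeasM D f g : cmeas D f -> cmeas D g -> cmeas D (fun x => f x * g x).
Proof.
move=> [fr fi] [gr gi]; split.
- under eq_fun do rewrite ReM.
  by apply: measurable_funB; exact: measurable_funM.
- under eq_fun do rewrite ImM.
  by apply: measurable_funD; exact: measurable_funM.
Qed.

Lemma cmeas_sum D I (s : seq I) (F : I -> T -> R[i]) :
  (forall i, cmeas D (F i)) -> cmeas D (fun x => \sum_(i <- s) F i x).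
Proof.
move=> mF; elim: s => [|i s IH].
  by under eq_fun do rewrite big_nil; exact: cmeas_cst.
by under eq_fun do rewrite big_cons; exact: cmeasD.
Qed.

Lemma measurable_cmod D f : measurable D -> cmeas D f ->
  measurable_fun D (fun x => cmod (f x)).
Proof.
move=> mD [fr fi]; under eq_fun do rewrite cmodE.
apply: (measurableT_comp (continuous_measurable_fun (@sqrt_continuous R))).
by apply: measurable_funD; exact: measurable_funX.
Qed.

Lemma cmeas_cexp D f : measurable D -> cmeas D f -> cmeas D (fun x => cexp (f x)).
Proof.
move=> mD [fr fi]; apply: cmeasM.
  by apply: cmeas_real; exact: measurableT_comp.
split => /=.
  apply: (measurableT_comp _ fi); apply: continuous_measurable_fun; exact: continuous_cos.
apply: (measurableT_comp _ fi); apply: continuous_measurable_fun; exact: continuous_sin.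
Qed.

Lemma cmeasS (A D : set T) f : measurable D -> A `<=` D -> cmeas D f -> cmeas A f.
Proof. by move=> mD AD [fr fi]; split; apply: (measurable_funS mD AD). Qed.

Lemma cmeas_if D (b : T -> bool) f g : measurable D -> measurable_fun D b ->
  cmeas D f -> cmeas D g -> cmeas D (fun x => if b x then f x else g x).
Proof.
move=> mD mb [fr fi] [gr gi]; split.
- rewrite (_ : (fun x => Re _) = (fun x => if b x then Re (f x) else Re (g x))).
    by apply: measurable_fun_if => //; apply: (measurable_funS mD) => //; exact: subIsetl.
  by apply/funext => x; case: (b x).
- rewrite (_ : (fun x => Im _) = (fun x => if b x then Im (f x) else Im (g x))).
    by apply: measurable_fun_if => //; apply: (measurable_funS mD) => //; exact: subIsetl.
  by apply/funext => x; case: (b x).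
Qed.

Lemma cmeas_cpow D (f : T -> R) (z : R[i]) : measurable D -> measurable_fun D f ->
  cmeas D (fun x => cpow (f x) z).
Proof.
move=> mD mf; apply: cmeas_if => //.
- by apply: measurable_fun_eqr => //; exact: measurable_cst.
- apply: cmeas_cexp => //; apply: cmeasM; first exact: cmeas_cst.
  by apply: cmeas_real; exact: measurableT_comp.
Qed.
End cmeas.

Lemma cmeas_comp d d' (T : measurableType d) (U : measurableType d') (R : realType)
   (D : set T) (g : T -> U) (f : U -> R[i]) :
  cmeas setT f -> measurable_fun D g -> cmeas D (fun x => f (g x)).
Proof. by move=> [fr fi] mg; split; [apply: (measurableT_comp fr)|apply: (measurableT_comp fi)]. Qed.

Section cintegral.
Context d (T : measurableType d) (R : realType) (mu : {measure set T -> \bar R}).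
Context (D : set T) (mD : measurable D).
Implicit Types (f g : T -> R[i]).

Lemma cintble_cmeas f : cintble mu D f -> cmeas D f.
Proof.
by move=> [/measurable_int fr /measurable_int fi]; split; apply/measurable_EFinP.
Qed.

Lemma eq_cintble f g : (forall x, D x -> f x = g x) -> cintble mu D f -> cintble mu D g.
Proof.
move=> fg [fr fi]; split.
- by apply: eq_integrable fr => // x /set_mem Dx; rewrite fg.
- by apply: eq_integrable fi => // x /set_mem Dx; rewrite fg.
Qed.

Lemma eq_cintegral f g : (forall x, D x -> f x = g x) ->
  cintegral mu D f = cintegral mu D g.
Proof.
move=> fg; rewrite /cintegral; congr (_ +i* _);
  by apply: eq_Rintegral => x /set_mem Dx; rewrite fg.
Qed.

Lemma cintble_dom f (g : T -> R) : cmeas D f -> mu.-integrable D (EFin \o g) ->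
  (forall x, D x -> cmod (f x) <= g x) -> cintble mu D f.
Proof.
move=> [fr fi] ig fg; split.
- apply: (le_integrable mD _ _ ig); first exact/measurable_EFinP.
  move=> x Dx /=; rewrite lee_fin (le_trans (Re_le_cmod _))//.
  by rewrite (le_trans (fg _ Dx))// ler_norm.
- apply: (le_integrable mD _ _ ig); first exact/measurable_EFinP.
  move=> x Dx /=; rewrite lee_fin (le_trans (Im_le_cmod _))//.
  by rewrite (le_trans (fg _ Dx))// ler_norm.
Qed.

Lemma integrable_cmod f : cintble mu D f ->
  mu.-integrable D (fun x => (cmod (f x))%:E).
Proof.
move=> fi; have [ir ii] := fi.
apply: (le_integrable mD _ _ (integrableD mD (integrable_abse ir) (integrable_abse ii))).
  by apply/measurable_EFinP; apply: measurable_cmod => //; exact: cintble_cmeas.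
move=> x Dx /=; rewrite lee_fin ger0_norm ?cmod_ge0// ger0_norm ?addr_ge0//.
exact: cmod_le_ReIm.
Qed.

Lemma cintbleZ (c : R[i]) f : cintble mu D f -> cintble mu D (fun x => c * f x).
Proof.
move=> fi; apply: (@cintble_dom _ (fun x => cmod c * cmod (f x))).
- by apply: cmeasM; [exact: cmeas_cst|exact: cintble_cmeas].
- exact: (integrableZl mD (cmod c) (integrable_cmod fi)).
- by move=> x _; rewrite cmodM.
Qed.

Lemma cintbleD f g : cintble mu D f -> cintble mu D g ->
  cintble mu D (fun x => f x + g x).
Proof.
move=> fi gi; apply: (@cintble_dom _ (fun x => cmod (f x) + cmod (g x))).
- by apply: cmeasD; exact: cintble_cmeas.
- exact: (integrableD mD (integrable_cmod fi) (integrable_cmod gi)).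
- by move=> x _; exact: cmodD.
Qed.

Lemma cintbleB f g : cintble mu D f -> cintble mu D g ->
  cintble mu D (fun x => f x - g x).
Proof.
move=> fi gi; apply: cintbleD => //.
by apply: eq_cintble (cintbleZ (-1) gi) => x _; rewrite mulN1r.
Qed.

Lemma cintbleM_bounded f g (C : R) : cintble mu D f -> cmeas D g ->
  (forall x, D x -> cmod (g x) <= C) -> cintble mu D (fun x => f x * g x).
Proof.
move=> fi mg gC; apply: (@cintble_dom _ (fun x => C * cmod (f x))).
- by apply: cmeasM => //; exact: cintble_cmeas.
- exact: (integrableZl mD C (integrable_cmod fi)).
- by move=> x Dx; rewrite cmodM mulrC ler_wpM2r ?cmod_ge0// gC.
Qed.

Lemma cintegralD f g : cintble mu D f -> cintble mu D g ->
  cintegral mu D (fun x => f x + g x) = cintegral mu D f + cintegral mu D g.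
Proof.
move=> [fr fi] [gr gi]; rewrite /cintegral; apply: complex_ext; rewrite ?ReD ?ImD/=.
- by under eq_Rintegral do rewrite ReD; rewrite RintegralD.
- by under eq_Rintegral do rewrite ImD; rewrite RintegralD.
Qed.

Lemma cintegralZ c f : cintble mu D f ->
  cintegral mu D (fun x => c * f x) = c * cintegral mu D f.
Proof.
move=> [fr fi]; rewrite /cintegral; apply: complex_ext; rewrite ?ReM ?ImM/=.
- under eq_Rintegral do rewrite ReM.
  rewrite RintegralB; [|by []|exact: (integrableZl mD _ fr)|exact: (integrableZl mD _ fi)].
  by rewrite !RintegralZl.
- under eq_Rintegral do rewrite ImM.
  rewrite RintegralD; [|by []|exact: (integrableZl mD _ fi)|exact: (integrableZl mD _ fr)].
  by rewrite !RintegralZl.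
Qed.

Lemma cintegralB f g : cintble mu D f -> cintble mu D g ->
  cintegral mu D (fun x => f x - g x) = cintegral mu D f - cintegral mu D g.
Proof.
move=> fi gi; rewrite -(mulN1r (cintegral mu D g)) -cintegralZ// -cintegralD//; last exact: cintbleZ.
by apply: eq_cintegral => x _; rewrite mulN1r.
Qed.

Lemma cintegral_real (f : T -> R) :
  cintegral mu D (fun x => (f x)%:C) = (\int[mu]_(x in D) f x)%:C.
Proof.
by apply: complex_ext => //=; rewrite /Rintegral integral0_eq.
Qed.

(** Linearity moves the rotation of [cmod_leP] inside the integral, where only a real part remains
    to be bounded. *)
Lemma cmod_cintegral f : cintble mu D f ->
  cmod (cintegral mu D f) <= \int[mu]_(x in D) cmod (f x).
Proof.
move=> fi; apply: cmod_leP => [|c c1]; first by apply: Rintegral_ge0 => x _; exact: cmod_ge0.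
rewrite -cintegralZ//; apply: le_Rintegral => //; first by have [] := cintbleZ c fi.
  exact: integrable_cmod.
by move=> x _; rewrite (le_trans (ler_norm _))// (le_trans (Re_le_cmod _))// cmodM c1 mul1r.
Qed.

Lemma cmod_cintegral_le f (g : T -> R) : cmeas D f -> mu.-integrable D (EFin \o g) ->
  (forall x, D x -> cmod (f x) <= g x) ->
  cmod (cintegral mu D f) <= \int[mu]_(x in D) g x.
Proof.
move=> mf ig fg; have fi := cintble_dom mf ig fg.
rewrite (le_trans (cmod_cintegral fi))// le_Rintegral//.
exact: integrable_cmod.
Qed.

(** Convergence of complex numbers is expressed, here and below, by the real sequence
    [cmod (u n - f)] tending to 0. Real dominated convergence is run once for a map [h] that is
    1-Lipschitz for [cmod], then used for [Re] and [Im]. *)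
Lemma cintegral_dct (u : nat -> T -> R[i]) f (g : T -> R) :
  (forall n, cmeas D (u n)) -> cmeas D f ->
  (forall x, D x -> cmod (u n x - f x) @[n --> \oo] --> (0:R)) ->
  mu.-integrable D (EFin \o g) ->
  (forall n x, D x -> cmod (u n x) <= g x) ->
  cmod (cintegral mu D (u n) - cintegral mu D f) @[n --> \oo] --> (0:R).
Proof.
move=> mu_ mf uf ig ug.
have cvgr (h : R[i] -> R) (hB : forall a b, `|h a - h b| <= cmod (a - b)) x :
    D x -> h (u n x) @[n --> \oo] --> h (f x).
  move=> Dx; apply/cvgrPdist_le => e e0.
  have /cvgrPdist_le /(_ e e0) := uf x Dx; apply: filterS => n.
  rewrite sub0r normrN ger0_norm ?cmod_ge0// => h1.
  by rewrite distrC (le_trans (hB _ _)).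
have ReB (a b : R[i]) : `|Re a - Re b| <= cmod (a - b) by rewrite -ReN -ReD Re_le_cmod.
have ImB (a b : R[i]) : `|Im a - Im b| <= cmod (a - b) by rewrite -ImN -ImD Im_le_cmod.
have key (h : R[i] -> R) : (forall a, `|h a| <= cmod a) ->
    (forall a b, `|h a - h b| <= cmod (a - b)) ->
    (forall n, measurable_fun D (fun x => h (u n x))) ->
    measurable_fun D (fun x => h (f x)) ->
    \int[mu]_(x in D) h (u n x) @[n --> \oo] --> \int[mu]_(x in D) h (f x).
  move=> hle hB mh mhf.
  have [ihf _ H] : [/\ mu.-integrable D (fun x => (h (f x))%:E),
      (fun n => \int[mu]_(x in D) `|(h (u n x))%:E - (h (f x))%:E|)%E @ \oo --> 0%E &
      (fun n => \int[mu]_(x in D) (h (u n x))%:E)%E @ \oo -->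
        (\int[mu]_(x in D) (h (f x))%:E)%E].
    apply: (@dominated_convergence _ _ _ mu D mD (fun n x => (h (u n x))%:E)
      (fun x => (h (f x))%:E) (EFin \o g)) => //.
    - by move=> n; apply/measurable_EFinP.
    - exact/measurable_EFinP.
    - apply: aeW => x Dx; apply: cvg_EFin; first exact: nearW.
      exact: cvgr.
    - apply: aeW => x n Dx /=; rewrite lee_fin.
      by rewrite (le_trans (hle _))// ug.
  by apply: fine_cvg; rewrite fineK//; exact: integrable_fin_num.
have rr := key _ (@Re_le_cmod R) ReB (fun n => (mu_ n).1) mf.1.
have ii := key _ (@Im_le_cmod R) ImB (fun n => (mu_ n).2) mf.2.
apply: (@squeeze_cvgr _ _ _ _ (cst 0)
  (fun n => `|Re (cintegral mu D (u n)) - Re (cintegral mu D f)| +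
     `|Im (cintegral mu D (u n)) - Im (cintegral mu D f)|)).
- apply: nearW => n; rewrite cmod_ge0/=.
  by rewrite (le_trans (cmod_le_ReIm _))// !ReD !ImD !ReN !ImN.
- exact: cvg_cst.
- rewrite -[X in _ --> X](addr0 0).
  apply: cvgD; rewrite -(@normr0 _ R^o); apply: cvg_norm.
  + by apply/subr_cvg0.
  + by apply/subr_cvg0.
Qed.

End cintegral.

(** Extension by 0: it carries integrals over [D] to the whole space, where Fubini and
    measure-preserving maps are applied. *)
Definition cres d (T : measurableType d) (R : realType) (D : set T) (f : T -> R[i]) :=
  fun x => if x \in D then f x else 0.

Section cres.
Context d (T : measurableType d) (R : realType) (mu : {measure set T -> \bar R}).
Implicit Types (D : set T) (f : T -> R[i]).

Lemma cmeas_cres D f : measurable D -> cmeas D f -> cmeas setT (cres D f).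
Proof.
move=> mD [/(measurable_restrictT _ mD).1 fr /(measurable_restrictT _ mD).1 fi].
split.
- rewrite (_ : (fun _ => _) = (fun x => Re (f x)) \_ D)//.
  by apply/funext => x; rewrite /cres /patch; case: ifP.
- rewrite (_ : (fun _ => _) = (fun x => Im (f x)) \_ D)//.
  by apply/funext => x; rewrite /cres /patch; case: ifP.
Qed.

Lemma cintegral_cres D f : cintegral mu D f = cintegral mu setT (cres D f).
Proof.
rewrite /cintegral 2!(Rintegral_mkcond _ D); congr (_ +i* _);
  by apply: eq_Rintegral => x _; rewrite /cres /patch; case: ifP.
Qed.

Lemma cintble_cres D f : measurable D -> cintble mu D f -> cintble mu setT (cres D f).
Proof.
move=> mD [/(integrable_mkcond _ mD).1 fr /(integrable_mkcond _ mD).1 fi].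
split.
- by apply: eq_integrable fr => // x _; rewrite /cres /patch; case: ifP.
- by apply: eq_integrable fi => // x _; rewrite /cres /patch; case: ifP.
Qed.

Lemma cintbleS (A D : set T) f : measurable D -> measurable A -> A `<=` D ->
  cintble mu D f -> cintble mu A f.
Proof.
by move=> mD mA AD [fr fi]; split; apply: (integrableS mD mA AD).
Qed.

Lemma cintble_bounded D f (C : R) : measurable D -> (mu D < +oo)%E -> cmeas D f ->
  (forall x, D x -> cmod (f x) <= C) -> cintble mu D f.
Proof.
move=> mD Doo mf fC; apply: (cintble_dom mD mf _ fC).
have [D0 | D0] := pselect (D !=set0); last first.
  rewrite (_ : D = set0); first exact: integrable_set0.
  by apply/seteqP; split => // x Dx; exfalso; apply: D0; exists x.
apply: measurable_bounded_integrable => //.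
by exists `|C|; split; [exact: num_real|move=> y Cy x _ /=; exact: ltW].
Qed.
End cres.

(** * Fubini's theorem and measure-preserving maps *)

Section cfubini.
Context d1 d2 (T1 : measurableType d1) (T2 : measurableType d2) (R : realType).
Variable m1 : {sigma_finite_measure set T1 -> \bar R}.
Variable m2 : {sigma_finite_measure set T2 -> \bar R}.
Variable f : T1 * T2 -> R[i].
Hypothesis mf : cmeas setT f.
Hypothesis intf : (m1 \x m2)%E.-integrable setT (fun p => (cmod (f p))%:E).
Hypothesis int1 : forall x, cintble m2 setT (fun y => f (x, y)).
Hypothesis int2 : forall y, cintble m1 setT (fun x => f (x, y)).

Let ci : cintble (m1 \x m2)%E setT f.
Proof. by apply: (cintble_dom _ mf intf). Qed.

Lemma cintble_fubini1 :
  cintble m1 setT (fun x => cintegral m2 setT (fun y => f (x, y))).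
Proof.
have [cr cI] := ci; split.
- apply: eq_integrable (integrable_fubini_F cr) => //= x _.
  rewrite /fubini_F /cintegral/= fineK//.
  exact: (integrable_fin_num _ (int1 x).1).
- apply: eq_integrable (integrable_fubini_F cI) => //= x _.
  rewrite /fubini_F /cintegral/= fineK//.
  exact: (integrable_fin_num _ (int1 x).2).
Qed.

(** Integrability is asked of every section, not of almost every one, because [cintegral] takes
    [fine] of each inner integral. *)
Lemma cfubini :
  cintegral m1 setT (fun x => cintegral m2 setT (fun y => f (x, y))) =
  cintegral m2 setT (fun y => cintegral m1 setT (fun x => f (x, y))).
Proof.
have [cr cI] := ci; rewrite {1 3}/cintegral; apply: complex_ext => /=.
- rewrite /Rintegral; congr fine.
  under eq_integral.
    move=> x _; rewrite fineK; last exact: (integrable_fin_num _ (int1 x).1).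
    over.
  under [RHS]eq_integral.
    move=> y _; rewrite fineK; last exact: (integrable_fin_num _ (int2 y).1).
    over.
  exact: (Fubini cr).
- rewrite /Rintegral; congr fine.
  under eq_integral.
    move=> x _; rewrite fineK; last exact: (integrable_fin_num _ (int1 x).2).
    over.
  under [RHS]eq_integral.
    move=> y _; rewrite fineK; last exact: (integrable_fin_num _ (int2 y).2).
    over.
  exact: (Fubini cI).
Qed.

End cfubini.

Section change_of_variables.
Context d1 d2 (T1 : measurableType d1) (T2 : measurableType d2) (R : realType).
Variables (m1 : {measure set T1 -> \bar R}) (m2 : {measure set T2 -> \bar R}).
Variable h : T1 -> T2.
Hypothesis mh : measurable_fun setT h.
Hypothesis m12 : forall A, measurable A -> m1 (h @^-1` A) = m2 A.

Let hm : {mfun T1 >-> T2} := HB.pack h (isMeasurableFun.Build _ _ _ _ h mh).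

Let pushforward_eq (f : T2 -> \bar R) :
  (\int[pushforward m1 hm]_y f y = \int[m2]_y f y)%E.
Proof.
by apply: eq_measure_integral => A mA _ /=; rewrite /pushforward m12.
Qed.

Lemma ge0_integral_preserving (f : T2 -> \bar R) :
  measurable_fun setT f -> (forall x, 0 <= f x)%E ->
  (\int[m1]_x f (h x) = \int[m2]_y f y)%E.
Proof.
move=> mf f0; rewrite -pushforward_eq; symmetry.
exact: (ge0_integral_pushforward mh m1 measurableT mf).
Qed.

Lemma integrable_preserving (f : T2 -> \bar R) : measurable_fun setT f ->
  m2.-integrable setT f <-> m1.-integrable setT (f \o h).
Proof.
move=> mf; have e : (\int[m1]_x `|f (h x)| = \int[m2]_y `|f y|)%E.
  by apply: (ge0_integral_preserving (f := fun x => `|f x|%E)) => //; exact: measurableT_comp.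
split => /integrableP[_ ioo]; apply/integrableP; split => //.
- exact: measurableT_comp.
- by rewrite /= e.
- by rewrite -e.
Qed.

Lemma cintble_preserving (f : T2 -> R[i]) : cmeas setT f ->
  cintble m2 setT f <-> cintble m1 setT (fun x => f (h x)).
Proof.
move=> [/measurable_EFinP fr /measurable_EFinP fi]; split => -[ir ii].
  by split; [apply/(integrable_preserving fr).1|apply/(integrable_preserving fi).1].
by split; [apply/(integrable_preserving fr).2|apply/(integrable_preserving fi).2].
Qed.

Lemma integral_preserving (f : T2 -> \bar R) : measurable_fun setT f ->
  m2.-integrable setT f -> (\int[m1]_x f (h x) = \int[m2]_y f y)%E.
Proof.
move=> mf fi; rewrite -pushforward_eq; symmetry.
exact: (integral_pushforward mh mf ((integrable_preserving mf).1 fi) measurableT).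
Qed.

(** Serves twice: for translations and reflections of Lebesgue measure, and for the passage from [P]
    to the law of a random variable. *)
Lemma cintegral_preserving (f : T2 -> R[i]) : cintble m2 setT f ->
  cintegral m1 setT (fun x => f (h x)) = cintegral m2 setT f.
Proof.
move=> fi; have [/measurable_EFinP fr /measurable_EFinP fI] := cintble_cmeas fi.
rewrite /cintegral /Rintegral; congr (fine _ +i* fine _).
- exact: (integral_preserving fr fi.1).
- exact: (integral_preserving fI fi.2).
Qed.

End change_of_variables.

Section lebesgue_invariance.
Context {R : realType}.
Notation leb := (@lebesgue_measure R).

Lemma lebesgue_measure_shift (c : R) (A : set R) : measurable A ->
  leb ((fun s => s + c) @^-1` A) = leb A.
Proof.
move=> mA; have ms : measurable_fun setT
    ((fun s => s + c) : measurableTypeR R -> measurableTypeR R).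
  by apply: measurable_funD => //; exact: measurable_cst.
pose sm : {mfun measurableTypeR R >-> measurableTypeR R} :=
  HB.pack (fun s : R => s + c) (isMeasurableFun.Build _ _ _ _ _ ms).
symmetry; apply: (@lebesgue_measure_unique R (pushforward leb sm)) => //.
move=> X [[a b] /= ab <-]; rewrite /pushforward.
rewrite (_ : _ @^-1` _ = `]a - c, b - c]%classic).
  rewrite !lebesgue_measure_itv/= !lte_fin ltrD2r.
  by case: ifPn => // _; rewrite -!EFinB; congr EFin; ring.
by apply/seteqP; split => x /=; rewrite !in_itv/= ltrBlDr lerBrDr.
Qed.

Lemma lebesgue_measure_reflect (c : R) (A : set R) : measurable A ->
  leb ((fun s => c - s) @^-1` A) = leb A.
Proof.
move=> mA; have ms : measurable_fun setT (fun s : R => s + c).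
  by apply: measurable_funD => //; exact: measurable_cst.
have mB : measurable ((fun s => s + c) @^-1` A : set R).
  by rewrite -[X in measurable X]setTI; exact: ms.
rewrite -(lebesgue_measure_shift c mA) -(lebesgue_measureN mB) /pushforward.
by congr leb; apply/seteqP; split => x /=; rewrite addrC.
Qed.
End lebesgue_invariance.

Section product_integrable.
Context d1 d2 (T1 : measurableType d1) (T2 : measurableType d2) (R : realType).
Variable m1 : {sigma_finite_measure set T1 -> \bar R}.
Variable m2 : {sigma_finite_measure set T2 -> \bar R}.

Lemma integrable_prod_dom (F : T1 * T2 -> R[i]) (a : T1 -> R) (b : T2 -> R) :
  cmeas setT F -> m1.-integrable setT (EFin \o a) -> m2.-integrable setT (EFin \o b) ->
  (forall x y, cmod (F (x, y)) <= a x * b y) ->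
  (m1 \x m2)%E.-integrable setT (fun p => (cmod (F p))%:E).
Proof.
move=> mF ia ib Fab.
have mcF : measurable_fun setT (fun p => (cmod (F p))%:E).
  by apply/measurable_EFinP; exact: measurable_cmod.
apply/integrable12ltyP => //=.
pose B := \int[m2]_y `|b y|.
have iab := integrable_norm ia; have ibb := integrable_norm ib.
apply: (@le_lt_trans _ _ (\int[m1]_x (`|a x| * B)%:E)%E); last first.
  have := integrableZr measurableT B iab.
  by move=> /integrableP[_]; under eq_integral => x _ do
    rewrite /= ger0_norm ?mulr_ge0// ?Rintegral_ge0//.
apply: ge0_le_integral => //.
- by move=> x _; apply: integral_ge0.
- apply: (measurable_fun_fubini_tonelli_F (fun p => `|(cmod (F p))%:E|%E)) => //.
  exact: measurableT_comp.
- by apply/measurable_EFinP; apply: measurable_funM => //; exact/measurable_EFinP/(measurable_int _ iab).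
- move=> x _.
  rewrite EFinM /B /Rintegral fineK; last exact: integrable_fin_num.
  rewrite -integralZl//.
  apply: ge0_le_integral => //=.
  + apply/measurable_EFinP; apply: measurableT_comp => //.
    apply: (measurableT_comp (f := fun p => cmod (F p))) => //.
    exact: measurable_cmod.
  + apply: measurable_funeM; exact: (measurable_int _ ibb).
  + move=> y _; rewrite -EFinM lee_fin ger0_norm ?cmod_ge0// -normrM.
    exact: le_trans (Fab _ _) (ler_norm _).
Qed.
End product_integrable.

(** * Convolution on the half-line *)

Section convolution.
Context {R : realType}.
Notation leb := (@lebesgue_measure R).
Implicit Types (u v f g : R -> R[i]) (t T : R).

(** Two classes are kept apart: the convolution of a locally integrable function with a locally
    bounded one is defined at every point and locally bounded, so the algebra of convolutions holds
    pointwise. The density [cpow s (z - 1)] is in general only of the first kind. *)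
Definition lint u := forall T, cintble leb `[0, T] u.
Definition lbd f := forall T, cmeas (`[0, T] : set (measurableTypeR R)) f /\
  exists C, forall s, 0 <= s <= T -> cmod (f s) <= C.

Lemma leb_itv_lty (a b : R) : (leb `[a, b] < +oo)%E.
Proof. by rewrite /= lebesgue_measure_itv/=; case: ifP => _; rewrite ?ltry. Qed.

Lemma lbd_lint f : lbd f -> lint f.
Proof.
move=> bf T; have [mf [C fC]] := bf T.
apply: (cintble_bounded (C := C)) => //; first exact: leb_itv_lty.
Qed.

Lemma lbd_bound f T : lbd f -> exists2 C, 0 <= C & forall s, 0 <= s <= T -> cmod (f s) <= C.
Proof.
move=> /(_ T)[_ [C h]]; exists `|C| => // s /h; move/le_trans; apply; exact: ler_norm.
Qed.

Lemma lbd_cst c : lbd (fun=> c).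
Proof. by move=> T; split; [exact: cmeas_cst|exists (cmod c)]. Qed.

Lemma lbdD f g : lbd f -> lbd g -> lbd (fun s => f s + g s).
Proof.
move=> bf bg T; have [mf [C fC]] := bf T; have [mg [C' gC]] := bg T; split.
  exact: cmeasD.
by exists (C + C') => s sT; rewrite (le_trans (cmodD _ _))// lerD// (fC, gC).
Qed.

Lemma lbdM f g : lbd f -> lbd g -> lbd (fun s => f s * g s).
Proof.
move=> bf bg T; have [C C0 fC] := lbd_bound T bf; have [C' C'0 gC] := lbd_bound T bg.
split; first by apply: cmeasM; [exact: (bf T).1|exact: (bg T).1].
by exists (C * C') => s sT; rewrite cmodM ler_pM ?cmod_ge0// (fC, gC).
Qed.

Lemma lbdZ c f : lbd f -> lbd (fun s => c * f s).
Proof. by move=> bf; apply: lbdM => //; exact: lbd_cst. Qed.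

Lemma lintZ c f : lint f -> lint (fun s => c * f s).
Proof. by move=> hf T; apply: cintbleZ. Qed.

Let cr T u := cres (`[0, T] : set R) u.

Let crE T u s : cr T u s = if 0 <= s <= T then u s else 0.
Proof. by rewrite /cr /cres mem_setE in_itv. Qed.

Lemma cmeas_crB T u : cmeas (`[0, T] : set (measurableTypeR R)) u ->
  forall d (X : measurableType d) (h : X -> R), measurable_fun setT h ->
  cmeas setT (fun x => cr T u (h x)).
Proof.
move=> mu d X h mh.
by apply: (cmeas_comp (g := h)) => //; apply: cmeas_cres.
Qed.

(** One cut-off [T] serves all [t <= T], which makes the integrand a function of the pair [(t, s)]
    to which Fubini applies. *)
Lemma convE T u f t : 0 <= t <= T ->
  conv u f t = cintegral leb setT (fun s => cr T u s * cr T f (t - s)).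
Proof.
move=> /andP[t0 tT]; rewrite /conv cintegral_cres; apply: eq_cintegral => s _.
rewrite /cres mem_setE in_itv/= !crE; case: ifPn => [/andP[s0 st]|].
  by rewrite s0 (le_trans st tT) subr_ge0 st lerBlDr (le_trans tT)// lerDl.
rewrite negb_and -!ltNge => /orP[s0|ts]; first by rewrite leNgt s0/= mul0r.
by rewrite subr_ge0 (leNgt s t) ts/= mulr0.
Qed.

Let cr_bound T f C : (forall s, 0 <= s <= T -> cmod (f s) <= C) -> 0 <= C ->
  forall s, cmod (cr T f s) <= C.
Proof. by move=> h C0 s; rewrite crE; case: ifP => [/h//|_]; rewrite cmod0. Qed.

Let cr_cintble T u : lint u -> cintble leb setT (cr T u).
Proof. by move=> hu; apply: cintble_cres => //; exact: hu. Qed.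

Let mB (c : R) : measurable_fun (setT : set (measurableTypeR R)) (fun s => c - s).
Proof. by apply: measurable_funB => //; exact: measurable_cst. Qed.

Let mS (c : R) : measurable_fun (setT : set (measurableTypeR R)) (fun s => s - c).
Proof. by apply: measurable_funB => //; exact: measurable_cst. Qed.

Lemma conv_cintble T u f t : lint u -> lbd f ->
  cintble leb setT (fun s => cr T u s * cr T f (t - s)).
Proof.
move=> hu hf; have [C C0 fC] := lbd_bound T hf.
apply: (@cintbleM_bounded _ _ _ _ _ _ _ _ C) => //; first exact: cr_cintble.
  by apply: cmeas_crB; [exact: (hf T).1|exact: mB].
by move=> x _; apply: cr_bound.
Qed.

Lemma conv_cintble0 u f t : lint u -> lbd f ->
  cintble leb `[0, t] (fun s => u s * f (t - s)).
Proof.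
move=> hu hf.
have mI : measurable (`[0, t]%classic : set (measurableTypeR R)) by [].
apply: (eq_cintble mI _ (cintbleS measurableT mI (@subsetT _ _) (conv_cintble t t hu hf))).
  move=> s /=; rewrite in_itv/= => /andP[s0 st].
  by rewrite !crE s0 st subr_ge0 st lerBlDr lerDl s0.
Qed.

Lemma conv_neg u f t : t < 0 -> conv u f t = 0.
Proof.
move=> t0; rewrite /conv set_itv_ge ?bnd_simp -?ltNge//.
by rewrite /cintegral !Rintegral_set0.
Qed.

Lemma convC u f t : lint u -> lbd f -> conv u f t = conv f u t.
Proof.
move=> hu hf; have [t0|t0] := ltP t 0; first by rewrite !conv_neg.
rewrite !(convE (T := t)) ?t0 ?lexx//.
rewrite -(@cintegral_preserving _ _ _ _ _ leb leb (fun s => t - s) (mB t) _ _); last 2 first.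
- by move=> A mA; exact: lebesgue_measure_reflect.
- exact: conv_cintble.
by apply: eq_cintegral => s _; rewrite subKr mulrC.
Qed.

Let cr_bd T c : cintble leb setT (cr T (fun=> c)).
Proof. by apply: cr_cintble; apply: lbd_lint; exact: lbd_cst. Qed.

Let Rintegral_cr T u :
  \int[leb]_s cmod (cr T u s) = \int[leb]_(s in `[0, T]) cmod (u s).
Proof.
rewrite [RHS]Rintegral_mkcond; apply: eq_Rintegral => s _.
by rewrite /patch /cr /cres; case: ifP => // _; rewrite cmod0.
Qed.

Lemma cmod_conv_le T u f C t : lint u -> lbd f -> 0 <= C ->
  (forall s, 0 <= s <= T -> cmod (f s) <= C) -> 0 <= t <= T ->
  cmod (conv u f t) <= C * \int[leb]_(s in `[0, T]) cmod (u s).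
Proof.
move=> hu hf C0 fC tT; rewrite (convE _ _ tT) -Rintegral_cr.
have iu := integrable_cmod measurableT (cr_cintble T hu).
rewrite -RintegralZl//; apply: cmod_cintegral_le => //.
- exact: cintble_cmeas (conv_cintble T t hu hf).
- exact: (integrableZl measurableT C iu).
- by move=> s _; rewrite cmodM mulrC ler_wpM2r ?cmod_ge0// cr_bound.
Qed.

Lemma cmod_conv_le2 T u f C t : lbd u -> lint f -> 0 <= C ->
  (forall s, 0 <= s <= T -> cmod (u s) <= C) -> 0 <= t <= T ->
  cmod (conv u f t) <= C * \int[leb]_(s in `[0, T]) cmod (f s).
Proof. by move=> hu hf C0 uC tT; rewrite -convC//; exact: cmod_conv_le. Qed.

Lemma lbd_conv u f : lint u -> lbd f -> lbd (conv u f).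
Proof.
move=> hu hf T; have [C C0 fC] := lbd_bound T hf; split; last first.
  by exists (C * \int[leb]_(s in `[0, T]) cmod (u s)) => t; exact: cmod_conv_le.
(* The factor [cr T (fun=> 1)] confines [t] to [0, T] and makes [F] integrable on the plane;
   measurability of the convolution in [t] is then part of Fubini's theorem. *)
pose F (p : measurableTypeR R * measurableTypeR R) := cr T (fun=> 1) p.1 * (cr T u p.2 * cr T f (p.1 - p.2)).
have mF : cmeas setT F.
  apply: cmeasM; first by apply: cmeas_crB => //; exact: cmeas_cst.
  apply: cmeasM; first by apply: cmeas_crB => //; exact: cintble_cmeas (hu T).
  by apply: cmeas_crB; [exact: (hf T).1|exact: measurable_funB].
have iu := integrable_cmod measurableT (cr_cintble T hu).
have H : cintble leb setT (fun t => cintegral leb setT (fun s => F (t, s))).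
  apply: cintble_fubini1 => //.
  - apply: (integrable_prod_dom mF (integrable_cmod measurableT (cr_bd T C%:C)) iu) => x y.
    rewrite /F/= !crE; case: ifP => _; rewrite ?mul0r ?cmod0 ?mul0r// mul1r cmodM mulrC.
    by rewrite ler_wpM2r ?cmod_ge0// cmodC ger0_norm// -crE cr_bound.
  - move=> t; rewrite /F/=; exact: (cintbleZ measurableT _ (conv_cintble T t hu hf)).
apply: eq_cmeas (cmeasS measurableT (@subsetT _ _) (cintble_cmeas H)) => t /=.
rewrite in_itv/= => tT; rewrite (convE _ _ tT); apply: eq_cintegral => s _.
by rewrite /F/= {1}crE tT mul1r.
Qed.

(** The two sides are the iterated integrals of [g (t - s) * u r * f (s - r)] over
    [0 <= r <= s <= t]; the shift by [r] turns the inner integral on the right into a convolution at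
    [t - r]. *)
Lemma convA u f g t : lint u -> lbd f -> lbd g ->
  conv (conv u f) g t = conv u (conv f g) t.
Proof.
move=> hu hf hg; have [t0|t0] := ltP t 0; first by rewrite !conv_neg.
have tt : 0 <= t <= t by rewrite t0/=.
have [Cf Cf0 fC] := lbd_bound t hf; have [Cg Cg0 gC] := lbd_bound t hg.
pose k (p : measurableTypeR R * measurableTypeR R) := cr t g (t - p.1) * (cr t u p.2 * cr t f (p.1 - p.2)).
have mk : cmeas setT k.
  apply: cmeasM; first by apply: cmeas_crB; [exact: (hg t).1|exact: measurable_funB].
  apply: cmeasM; first by apply: cmeas_crB => //; exact: cintble_cmeas (hu t).
  by apply: cmeas_crB; [exact: (hf t).1|exact: measurable_funB].
have iu := integrable_cmod measurableT (cr_cintble t hu).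
have dom x y : cmod (k (x, y)) <= cmod (cr t (fun=> (Cf * Cg)%:C) x) * cmod (cr t u y).
  rewrite /k !cmodM [cr t (fun=> _) x]crE [cr t g _]crE.
  rewrite (_ : (0 <= t - x <= t) = (0 <= x <= t)); last by apply/andP/andP => -[? ?]; split; lra.
  case: ifP => xt; last by rewrite !cmod0 !mul0r.
  rewrite cmodC ger0_norm ?mulr_ge0// [X in _ * X]mulrC mulrA ler_wpM2r ?cmod_ge0//.
  rewrite mulrC ler_pM ?cmod_ge0//; first exact: cr_bound.
  by apply: gC => /=; lra.
have ik := integrable_prod_dom mk (integrable_cmod measurableT (cr_bd t _)) iu dom.
have i1 s : cintble leb setT (fun r => k (s, r)).
  rewrite /k/=; exact: (cintbleZ measurableT _ (conv_cintble t s hu hf)).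
have i2 r : cintble leb setT (fun s => k (s, r)).
  apply: (@cintble_dom _ _ _ leb setT measurableT (fun s => k (s, r))
      (fun s : measurableTypeR R => cmod (cr t u r) * cmod (cr t (fun=> (Cf * Cg)%:C) s))).
  - by apply: (cmeas_comp mk); exact: measurable_fun_pair.
  - exact: (integrableZl measurableT _ (integrable_cmod measurableT (cr_bd t _))).
  - by move=> s _; rewrite mulrC.
have -> : conv (conv u f) g t =
   cintegral leb setT (fun s => cintegral leb setT (fun r => k (s, r))).
  rewrite (convE _ _ tt); apply: eq_cintegral => s _.
  rewrite /k/= cintegralZ//; last exact: conv_cintble.
  rewrite mulrC [cr t (conv _ _) _]crE; case: ifPn => st; first by rewrite (convE u f st).
  by rewrite [cr t g _]crE ifF ?mul0r ?mulr0//; apply/negbTE; apply: contra st => /andP[? ?]; lra.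
rewrite cfubini// (convE _ _ tt); apply: eq_cintegral => r _.
transitivity (cr t u r * cintegral leb setT (fun s => cr t f (s - r) * cr t g (t - s))).
  rewrite -cintegralZ//; last first.
    apply: (@cintbleM_bounded _ _ _ _ _ measurableT _ _ Cg).
    - have hf' := lbd_lint hf.
      have [H _] := @cintble_preserving _ _ (measurableTypeR R) (measurableTypeR R) R
        leb leb (fun s : R => s - r) (mS r) (fun A mA => lebesgue_measure_shift (- r) mA)
        (cr t f) (cintble_cmeas (cr_cintble t hf')).
      by apply: H; exact: cr_cintble.
    - by apply: cmeas_crB; [exact: (hg t).1|exact: mB].
    - by move=> s _; exact: cr_bound.
  by apply: eq_cintegral => s _; rewrite /k/=; ring.
rewrite [cr t u r]crE; case: ifPn => rt; last by rewrite !mul0r.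
congr (_ * _); rewrite crE ifT; last by lra.
rewrite (@convE t f g (t - r)); last by lra.
rewrite -[RHS](@cintegral_preserving _ _ _ _ _ leb leb (fun s : R => s - r)).
- by apply: eq_cintegral => s _; congr (_ * cr _ _ _); ring.
- exact: mS.
- by move=> A mA; exact: lebesgue_measure_shift.
- apply: conv_cintble => //; exact: lbd_lint.
Qed.
End convolution.

(** * Powers of a primitive *)

Section chain_rule.
Context {R : realType}.
Notation leb := (@lebesgue_measure R).

(* A bound [C (b - a)^2] for every subinterval telescopes to [C (t - s)^2 / n] for every n. *)
Lemma quadratic_increment_constant (D : R -> R) (s t C : R) : s <= t ->
  (forall a b, s <= a -> a <= b -> b <= t -> `|D b - D a| <= C * (b - a) ^+ 2) ->
  D t = D s.
Proof.
move=> st H; apply/eqP; rewrite -subr_eq0 -normr_le0; apply/ler_addgt0Pl => e e0.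
rewrite addr0.
have [n nP] : exists n : nat, C * (t - s) ^+ 2 <= e * n.+1%:R.
  have /ltW h := archi_boundP (normr_ge0 (C * (t - s) ^+ 2 / e)).
   exists (Num.bound `|C * (t - s) ^+ 2 / e|).
  rewrite -ler_pdivrMl// mulrC (le_trans (ler_norm _))// (le_trans h)//.
  by rewrite ler_nat.
pose x (k : nat) : R := s + (t - s) * k%:R / n.+1%:R.
have n0 : 0 < n.+1%:R :> R by rewrite ltr0n.
have step (k : nat) : (k <= n.+1)%N -> `|D (x k) - D s| <= k%:R * (C * ((t - s) / n.+1%:R) ^+ 2).
  elim: k => [_|k IH kn].
    by rewrite /x mulr0 mul0r addr0 subrr normr0 mul0r.
  have e1 : x k.+1 - x k = (t - s) / n.+1%:R.
    by rewrite /x -natr1; field.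
  rewrite -(subrKA (D (x k))) (le_trans (ler_normD _ _))// -natr1 mulrDl addrC lerD//.
    exact/IH/ltnW.
  have xk0 : s <= x k by rewrite /x lerDl !mulr_ge0// subr_ge0.
  have xk1 : x k.+1 <= t.
    rewrite /x -lerBrDl -mulrA ler_piMr ?subr_ge0// ler_pdivrMr// mul1r ler_nat//.
  rewrite mul1r -e1 H//; rewrite -subr_ge0 e1 divr_ge0// subr_ge0//.
have := step n.+1 (leqnn _).
rewrite (_ : x n.+1 = t); last by rewrite /x; field.
move/le_trans; apply; rewrite exprMn exprVn.
rewrite (_ : _ * _ = C * (t - s) ^+ 2 / n.+1%:R); last by field.
by rewrite ler_pdivrMr.
Qed.

(** The mean value theorem used twice. The constant is not the sharp [L / 2]; only the order
    [(b - a) ^+ 2] matters for [quadratic_increment_constant]. *)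
Lemma quadratic_taylor (P P' P'' : R -> R) (a b L : R) : a <= b -> 0 <= L ->
  (forall u, a <= u <= b -> is_derive u 1 P (P' u)) ->
  (forall u, a <= u <= b -> is_derive u 1 P' (P'' u)) ->
  (forall u, a <= u <= b -> `|P'' u| <= L) ->
  `|P' b - P' a| <= L * (b - a) /\
  `|P b - P a - P' a * (b - a)| <= L * (b - a) ^+ 2.
Proof.
move=> ab L0 h1 h2 hL.
have mvt (Q Q' : R -> R) c : (forall u, a <= u <= b -> is_derive u 1 Q (Q' u)) ->
    a <= c <= b -> exists2 x, a <= x <= c & Q c - Q a = Q' x * (c - a).
  move=> h /andP[ac cb].
  have [||x] := @MVT_segment R Q Q' a c ac.
  - move=> x; rewrite in_itv/= => /andP[ax xc]; apply: h; lra.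
  - apply: derivable_within_continuous => x; rewrite in_itv/= => /andP[ax xc].
    by have [] := h x; [lra|].
  by rewrite in_itv/= => xac e; exists x.
have lip c : a <= c <= b -> `|P' c - P' a| <= L * (c - a).
  move=> acb; have [x xac ->] := mvt _ _ c h2 acb.
  by rewrite normrM [X in _ * X]ger0_norm ?ler_wpM2r ?hL//; lra.
have bb : a <= b <= b by lra.
split; first exact: lip.
have [x xab ->] := mvt _ _ b h1 bb.
rewrite -mulrBl normrM [X in _ * X]ger0_norm; last by lra.
rewrite expr2 mulrA ler_wpM2r//; first by lra.
have xx : a <= x <= b by lra.
by rewrite (le_trans (lip _ xx))// ler_wpM2l//; lra.
Qed.

Lemma measurable_itvR (i : interval R) :
  measurable ([set` i] : set (measurableTypeR R)).
Proof. by []. Qed.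

Variable f : R -> R.
Hypothesis mf : measurable_fun (setT : set (measurableTypeR R)) f.
Hypothesis f01 : forall s, 0 <= f s <= 1.
Let A s := \int[leb]_(r in `[0, s]) f r.

Lemma unit_integrable (i : interval R) : (leb [set` i] < +oo)%E ->
  leb.-integrable [set` i] (EFin \o f).
Proof.
move=> ioo; apply: measurable_bounded_integrable => //.
  exact: measurable_funTS.
exists 1; split; first exact: num_real.
by move=> x x1 y _ /=; have /andP[f0 f1] := f01 y; rewrite ger0_norm// (le_trans f1)// ltW.
Qed.

Lemma leb_itvoc_lty (a b : R) : (leb `]a, b] < +oo)%E.
Proof. by rewrite /= lebesgue_measure_itv/=; case: ifP => _; rewrite ?ltry. Qed.

Lemma integrable_cst_itv (i : interval R) (c : R) : (leb [set` i] < +oo)%E ->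
  leb.-integrable [set` i] (EFin \o (fun=> c)).
Proof.
move=> ioo; apply: measurable_bounded_integrable => //.
exists `|c|; split; first exact: num_real.
by move=> x x1 y _ /=; exact: ltW.
Qed.

Lemma primitiveB a b : 0 <= a -> a <= b -> A b - A a = \int[leb]_(r in `]a, b]) f r.
Proof.
move=> a0 ab; rewrite /A Rintegral_itvB ?bnd_simp//.
by apply: unit_integrable; exact: leb_itv_lty.
Qed.

Lemma Rintegral_itvoc_cst (a b c : R) : a <= b -> \int[leb]_(r in `]a, b]) c = c * (b - a).
Proof.
move=> ab; rewrite Rintegral_cst//= lebesgue_measure_itv/= lte_fin.
by move: ab; rewrite le_eqVlt => /orP[/eqP->|->]; rewrite ?ltxx ?subrr//= ?mulr0.
Qed.

Lemma primitive_increment a b : 0 <= a -> a <= b -> 0 <= A b - A a <= b - a.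
Proof.
move=> a0 ab; rewrite primitiveB//; apply/andP; split.
  by apply: Rintegral_ge0 => x _; have /andP[] := f01 x.
rewrite -[leRHS]mul1r -Rintegral_itvoc_cst//; apply: le_Rintegral => //.
- by apply: unit_integrable; exact: leb_itvoc_lty.
- by apply: integrable_cst_itv; exact: leb_itvoc_lty.
- by move=> x _; have /andP[] := f01 x.
Qed.

Lemma primitive_homo : {homo A : a b / a <= b}.
Proof.
move=> a b ab; have [a0|a0] := leP 0 a.
  by have := primitive_increment a0 ab; lra.
rewrite {1}/A set_itv_ge ?bnd_simp -?ltNge// Rintegral_set0.
by apply: Rintegral_ge0 => x _; have /andP[] := f01 x.
Qed.

(** Since [f] is merely measurable, [A] need not be differentiable at a given point. Instead, the
    difference of the two sides has increments of second order in the length of the interval, hence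
    is constant. *)
Lemma chain_rule (P P' P'' : R -> R) (s t L : R) : 0 <= s -> s <= t ->
  (forall u, A s <= u <= A t -> is_derive u 1 P (P' u)) ->
  (forall u, A s <= u <= A t -> is_derive u 1 P' (P'' u)) ->
  (forall u, A s <= u <= A t -> `|P'' u| <= L) ->
  measurable_fun (`]s, t] : set (measurableTypeR R)) (P' \o A) ->
  \int[leb]_(r in `]s, t]) (P' (A r) * f r) = P (A t) - P (A s).
Proof.
move=> s0 st h1 h2 hL mP'.
have L0 : 0 <= L by apply: le_trans (normr_ge0 _) (hL (A s) _); rewrite lexx primitive_homo.
have sub a b u : s <= a -> b <= t -> A a <= u <= A b -> A s <= u <= A t.
  by move=> /primitive_homo h /primitive_homo h'; lra.
have lip a b : s <= a -> a <= b -> b <= t -> `|P' (A b) - P' (A a)| <= L * (b - a).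
  move=> sa ab bt.
  have [H _] := @quadratic_taylor P P' P'' (A a) (A b) L (primitive_homo ab) L0
    (fun u hu => h1 u (sub _ _ _ sa bt hu)) (fun u hu => h2 u (sub _ _ _ sa bt hu))
    (fun u hu => hL u (sub _ _ _ sa bt hu)).
  have := primitive_increment (le_trans s0 sa) ab; move=> /andP[_ h].
  by rewrite (le_trans H)// ler_wpM2l.
have bP' r : s <= r <= t -> `|P' (A r)| <= `|P' (A s)| + L * (t - s).
  move=> /andP[sr rt]; have := lip _ _ (lexx s) sr rt.
  have : L * (r - s) <= L * (t - s) by rewrite ler_wpM2l// lerD2r.
  have := ler_normD (P' (A r) - P' (A s)) (P' (A s)); rewrite subrK; lra.
have ig a b : s <= a -> b <= t -> leb.-integrable `]a, b] (fun r => (P' (A r) * f r)%:E).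
  move=> sa bt; have subi : `]a, b] `<=` `]s, t]%classic.
    by move=> r /=; rewrite !in_itv/=; lra.
  apply: measurable_bounded_integrable => //; first exact: leb_itvoc_lty.
    apply: measurable_funM; last exact: measurable_funTS.
    exact: measurable_funS mP'.
  exists (`|P' (A s)| + L * (t - s)); split; first exact: num_real.
  move=> x xB y /subi; rewrite /= in_itv/= => yst; rewrite normrM.
  have /andP[f0 f1] := f01 y; rewrite (ger0_norm f0).
  have := bP' y; have : `|P' (A y)| * f y <= `|P' (A y)| by rewrite ler_piMr.
  move=> h1' h2'; have := h2' _; lra.
pose D b := P (A b) - \int[leb]_(r in `]s, b]) (P' (A r) * f r).
suff : D t = D s.
  by rewrite /D set_itvoc0 Rintegral_set0 subr0 => <-; rewrite opprB addrC subrK.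
apply: (@quadratic_increment_constant D s t (L + L)) => // a b sa ab bt.
have a0 := le_trans s0 sa.
have -> : D b - D a = P (A b) - P (A a) - \int[leb]_(r in `]a, b]) (P' (A r) * f r).
  rewrite /D -(@Rintegral_itvB _ _ (BRight s) (BRight b) a) ?bnd_simp//; last exact: ig.
  ring.
have /andP[d0 d1] := primitive_increment a0 ab.
have e : P' (A a) * (A b - A a) = \int[leb]_(r in `]a, b]) (P' (A a) * f r).
  rewrite primitiveB// RintegralZl//.
  by apply: unit_integrable; exact: leb_itvoc_lty.
have ia : leb.-integrable `]a, b] (fun r => (P' (A a) * f r)%:E).
  exact: (integrableZl (measurable_itvR _) (P' (A a)) (unit_integrable (leb_itvoc_lty a b))).
have t1 : `|P (A b) - P (A a) - P' (A a) * (A b - A a)| <= L * (b - a) ^+ 2.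
  have [_ H] := @quadratic_taylor P P' P'' (A a) (A b) L (primitive_homo ab) L0
    (fun u hu => h1 u (sub _ _ _ sa bt hu)) (fun u hu => h2 u (sub _ _ _ sa bt hu))
    (fun u hu => hL u (sub _ _ _ sa bt hu)).
  rewrite (le_trans H)// ler_wpM2l// lerXn2r ?nnegrE//; lra.
have t2 : `|\int[leb]_(r in `]a, b]) (P' (A r) * f r) - P' (A a) * (A b - A a)| <= L * (b - a) ^+ 2.
  rewrite e -RintegralB//; last exact: ig.
  apply: (le_trans (le_normr_Rintegral _ _)) => //.
    exact: (integrableB (measurable_itvR _) (ig _ _ sa bt) ia).
  rewrite expr2 mulrA -Rintegral_itvoc_cst//; apply: le_Rintegral => //.
  - exact: (integrable_norm (integrableB (measurable_itvR _) (ig _ _ sa bt) ia)).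
  - by apply: integrable_cst_itv; exact: leb_itvoc_lty.
  - move=> r /=; rewrite in_itv/= => /andP[ar rb].
    rewrite -mulrBl normrM; have /andP[f0 f1] := f01 r; rewrite (ger0_norm f0).
    rewrite (@le_trans _ _ (L * (r - a) * 1))//.
      by rewrite ler_pM//; apply: lip => //; lra.
    by rewrite mulr1 ler_wpM2l// lerD2r.
rewrite mulrDl (_ : _ - _ - _ = (P (A b) - P (A a) - P' (A a) * (A b - A a)) -
  (\int[leb]_(r in `]a, b]) (P' (A r) * f r) - P' (A a) * (A b - A a))); last by ring.
by rewrite (le_trans (ler_normB _ _))// lerD.
Qed.

End chain_rule.

Section complex_power.
Context {R : realType}.
Implicit Types (z w : R[i]) (u : R).

Lemma subr_exchange (a b c d : R) : a - b = c - d -> a - c = b - d.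
Proof. lra. Qed.

(** The multiplier [w] treats both parts of a complex function in one real statement: [w = 1] gives
    the real part and [w = - 'i] the imaginary part. *)
Lemma is_derive_Re_cexp w z u :
  is_derive u 1 (fun u : R => Re (w * cexp (z * u%:C))) (Re (w * z * cexp (z * u%:C))).
Proof.
have h1 : is_derive u 1 (fun u : R => Re z * u) (Re z).
  by apply: is_derive_eq; rewrite /= ?scaler0 ?addr0 ?add0r; exact: mulr1.
have h2 : is_derive u 1 (fun u : R => Im z * u) (Im z).
  by apply: is_derive_eq; rewrite /= ?scaler0 ?addr0 ?add0r; exact: mulr1.
have he := @is_derive1_comp _ expR _ u _ _ (is_derive_expR _) h1.
have hc := @is_derive1_comp _ cos _ u _ _ (is_derive_cos _) h2.
have hs := @is_derive1_comp _ sin _ u _ _ (is_derive_sin _) h2.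
rewrite (_ : (fun u => _) = (fun u => (Re w * (expR (Re z * u) * cos (Im z * u)) -
    Im w * (expR (Re z * u) * sin (Im z * u))))); last first.
  apply/funext => v; rewrite /cexp ReM ReMc ImMc/= ReMcr ImMcr; ring.
apply: is_derive_eq.
rewrite /cexp !(ReM, ImM)/= !(mulr0, mul0r, addr0, add0r, subr0) /GRing.scale/=.
ring.
Qed.

Lemma cpowE u z : 0 < u -> cpow u z = cexp (z * (ln u)%:C).
Proof. by move=> u0; rewrite /cpow gt_eqF. Qed.

Lemma cpow0 z : z != 0 -> cpow 0 z = 0.
Proof. by move=> z0; rewrite /cpow eqxx (negbTE z0). Qed.

Lemma cpow_z0 u : 0 <= u -> cpow u 0 = 1.
Proof.
by rewrite /cpow; case: eqP => // _ _; rewrite ?eqxx// mul0r cexp0.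
Qed.

Lemma cmod_cpow u z : 0 < u -> cmod (cpow u z) = u `^ Re z.
Proof. by move=> u0; rewrite cpowE// cmod_cexp ReMcr /powR gt_eqF. Qed.

Lemma cpowD u z w : 0 < u -> cpow u (z + w) = cpow u z * cpow u w.
Proof. by move=> u0; rewrite !cpowE// mulrDl cexpD. Qed.

Lemma cpow1 u : 0 < u -> cpow u 1 = u%:C.
Proof. by move=> u0; rewrite cpowE// mul1r cexpC lnK. Qed.

Lemma cpowB1 u z : 0 < u -> cpow u (z - 1) = cpow u z / u%:C.
Proof.
move=> u0; have uC : u%:C != 0 :> R[i] by rewrite -(rmorph0 (real_complex R)) (inj_eq (@complexI R)) gt_eqF.
by apply: (mulIf uC); rewrite divfK// -[in LHS](cpow1 u0) -cpowD// subrK.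
Qed.

Lemma cpow_real u (r : R) : 0 < u -> cpow u r%:C = (u `^ r)%:C.
Proof. by move=> u0; rewrite cpowE// -rmorphM cexpC /powR gt_eqF. Qed.

Lemma is_derive_Re_cpow w z u : 0 < u ->
  is_derive u 1 (fun u : R => Re (w * cpow u z)) (Re (w * z * cpow u (z - 1))).
Proof.
move=> u0.
have h := @is_derive1_comp _ _ _ u _ _ (is_derive_Re_cexp w z (ln u)) (is_derive1_ln u0).
apply: (near_eq_is_derive (f := (fun u => Re (w * cexp (z * u%:C))) \o (@ln R))).
  near=> v; rewrite /= cpowE//; near: v; exact: lt_nbhsr.
apply: is_derive_eq h _; rewrite cpowB1// cpowE//.
rewrite -(ReMcr u^-1) fmorphV; congr (Re _); ring.
Unshelve. all: by end_near. Qed.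

(** The power is monotone in [u], in a direction that depends on the sign of [r]; the sum of the two
    end values covers both cases. *)
Lemma powR_le_sum u a b r : 0 < a -> a <= u <= b -> u `^ r <= a `^ r + b `^ r.
Proof.
move=> a0 /andP[au ub]; have u0 := lt_le_trans a0 au; have b0 := lt_le_trans u0 ub.
have [r0|r0] := leP 0 r.
  apply: (@le_trans _ _ (b `^ r)); last by rewrite lerDr powR_ge0.
  by apply: ge0_ler_powR => //; rewrite nnegrE ltW.
have [r' r'0 ->] : exists2 r', 0 <= r' & r = - r'.
  by exists (- r); rewrite ?opprK// oppr_ge0 ltW.
rewrite !powRN (@le_trans _ _ (a `^ r')^-1)// ?lerDl ?invr_ge0 ?powR_ge0//.
rewrite lef_pV2 ?posrE ?powR_gt0//; apply: ge0_ler_powR => //.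
- by rewrite nnegrE ltW.
- by rewrite nnegrE ltW.
Qed.
End complex_power.

Section power_chain.
Context {R : realType}.
Notation leb := (@lebesgue_measure R).
Variable f : R -> R.
Hypothesis mf : measurable_fun (setT : set (measurableTypeR R)) f.
Hypothesis f01 : forall s, 0 <= f s <= 1.
Let A s := \int[leb]_(r in `[0, s]) f r.
Hypothesis A0 : forall s, 0 < s -> 0 < A s.

Lemma primitive_le s : 0 <= s -> A s <= s.
Proof.
move=> s0; have := primitive_increment mf f01 (lexx 0) s0.
by rewrite [X in _ - X]/Rintegral set_itv1 integral_set1 subr0 subr0 => /andP[].
Qed.

Lemma measurable_primitive (D : set R) : measurable D ->
  measurable_fun (D : set (measurableTypeR R)) A.
Proof.
move=> mD; apply: (nondecreasing_measurable mD).
exact: (primitive_homo mf f01).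
Qed.

Lemma cmeas_power (D : set R) (z : R[i]) : measurable D ->
  cmeas (D : set (measurableTypeR R)) (fun r => cpow (A r) z * (f r)%:C).
Proof.
move=> mD; apply: cmeasM; last by apply: cmeas_real; exact: measurable_funTS.
by apply: cmeas_cpow => //; exact: measurable_primitive.
Qed.

Let mRe (w z : R[i]) (D : set R) : measurable D ->
  measurable_fun (D : set (measurableTypeR R)) (fun r => Re (w * cpow (A r) z)).
Proof.
move=> mD; apply: (cmeasM (cmeas_cst _ w) (cmeas_cpow z _ _)).1 => //.
exact: measurable_primitive.
Qed.

Lemma chain_rule_power (w z : R[i]) s t : 0 < s -> s <= t ->
  \int[leb]_(r in `]s, t]) (Re (w * z * cpow (A r) (z - 1)) * f r) =
  Re (w * cpow (A t) z) - Re (w * cpow (A s) z).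
Proof.
move=> s0 st.
pose L := cmod (w * z * (z - 1)) * (A s `^ (Re z - 2) + A t `^ (Re z - 2)).
apply: (@chain_rule _ f mf f01 (fun u => Re (w * cpow u z))
  (fun u => Re (w * z * cpow u (z - 1)))
  (fun u => Re (w * z * (z - 1) * cpow u (z - 1 - 1))) s t L) => //.
- exact: ltW.
- by move=> u /andP[su _]; apply: is_derive_Re_cpow; exact: lt_le_trans (A0 s0) su.
- by move=> u /andP[su _]; apply: is_derive_Re_cpow; exact: lt_le_trans (A0 s0) su.
- move=> u /andP[su ut]; rewrite (le_trans (Re_le_cmod _))// cmodM /L ler_wpM2l ?cmod_ge0//.
  rewrite cmod_cpow; last exact: lt_le_trans (A0 s0) su.
  rewrite (_ : Re (z - 1 - 1) = Re z - 2); last by rewrite !ReD !ReN/=; ring.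
  by apply: powR_le_sum; rewrite ?A0 ?su.
- exact: mRe.
Qed.

(** The integrand is nonnegative, so monotone convergence along the intervals []t / n.+1, t]]
    yields, up to the singular end 0, integrability together with the value. This is the majorant
    for complex exponents. *)
Lemma Rintegral_power x t : 0 < x -> 0 <= t ->
  leb.-integrable `]0, t] (fun r => (A r `^ (x - 1) * f r)%:E) /\
  \int[leb]_(r in `]0, t]) (A r `^ (x - 1) * f r) = A t `^ x / x.
Proof.
move=> x0; rewrite le_eqVlt => /orP[/eqP<-|t0].
  rewrite set_itvoc0 Rintegral_set0; split; first exact: integrable_set0.
  by rewrite [A 0]/Rintegral set_itv1 integral_set1 powR0 ?gt_eqF// mul0r.
pose g r := A r `^ (x - 1) * f r.
have g0 r : 0 <= g r by rewrite mulr_ge0 ?powR_ge0//; have /andP[] := f01 r.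
have mg (D : set R) : measurable D -> measurable_fun (D : set (measurableTypeR R)) g.
  move=> mD; apply: measurable_funM; last exact: measurable_funTS.
  by apply: (measurableT_comp (measurable_powR _)); exact: measurable_primitive.
have At0 := A0 t0.
pose e (n : nat) := t / n.+1%:R.
have e0 n : 0 < e n by rewrite divr_gt0.
have et n : e n <= t by rewrite ler_pdivrMr// -[leLHS]mulr1 ler_wpM2l ?ler1n// ltW.
have ge n : \int[leb]_(r in `]e n, t]) g r = (A t `^ x - A (e n) `^ x) / x.
  have ReA s : 0 < s -> Re (x^-1%:C * cpow (A s) x%:C) = x^-1 * A s `^ x.
    by move=> s0; rewrite cpow_real ?A0// -rmorphM.
  have h := etrans (chain_rule_power x^-1%:C x%:C (e0 n) (et n))
    (f_equal2 (fun a b => a - b) (ReA _ t0) (ReA _ (e0 n))).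
  rewrite mulrC mulrBr -h; apply: eq_Rintegral => r; rewrite inE/= in_itv/= => /andP[er _].
  have r0 := lt_trans (e0 n) er.
  rewrite /g (_ : x%:C - 1 = (x - 1)%:C); last by rewrite rmorphB.
  by rewrite cpow_real ?A0// -2!rmorphM/= mulVf ?gt_eqF// mul1r.
have U : `]0, t]%classic = \bigcup_n (`]e n, t]%classic : set R).
  apply/seteqP; split=> r /=.
    rewrite in_itv/= => /andP[r0 rt].
    have /ltW h := archi_boundP (ltW (divr_gt0 t0 r0)).
    exists (Num.bound (t / r)) => //=; rewrite in_itv/= rt andbT.
    rewrite /e ltr_pdivrMr// mulrC -ltr_pdivrMr// (le_lt_trans h)// ltr_nat//.
  by move=> [n _] /=; rewrite !in_itv/= => /andP[er ->]; rewrite (lt_trans (e0 n) er).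
have cv : (\int[leb]_(r in `]e n, t]) (g r)%:E)%E @[n --> \oo] -->
    (\int[leb]_(r in `]0%R, t]) (g r)%:E)%E.
  rewrite U; apply: ge0_nondecreasing_set_cvg_integral => //.
  - move=> n m nm; apply/subsetPset => r /=; rewrite !in_itv/= => /andP[h ->]; rewrite andbT.
    apply: le_lt_trans h; rewrite ler_pM2l// lef_pV2 ?posrE// ler_nat//.
  - by move=> n; apply/measurable_EFinP; exact: mg.
  - by move=> n r _; rewrite lee_fin.
have ig n : leb.-integrable `]e n, t] (fun r => (g r)%:E).
  apply: measurable_bounded_integrable => //; first exact: leb_itvoc_lty.
    exact: mg.
  exists (A (e n) `^ (x - 1) + A t `^ (x - 1)); split; first exact: num_real.
  move=> y hy r /=; rewrite in_itv/= => /andP[er rt].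
  rewrite ger0_norm// (le_trans _ (ltW hy))//.
  rewrite -[leRHS]mulr1 ler_pM ?powR_ge0//; [by have /andP[] := f01 r| |by have /andP[] := f01 r].
  apply: powR_le_sum; first exact: A0.
  by rewrite !(primitive_homo mf f01)// ltW.
have cv2 : (\int[leb]_(r in `]e n, t]) (g r)%:E)%E @[n --> \oo] --> (A t `^ x / x)%:E.
  rewrite (_ : (fun n => _) = EFin \o (fun n => (A t `^ x - A (e n) `^ x) / x)); last first.
    apply/funext => n /=; rewrite -ge /Rintegral fineK//.
    exact: (integrable_fin_num (measurable_itvR _) (ig n)).
  apply: cvg_EFin; first exact: nearW.
  apply: cvgMl; rewrite -[X in _ --> X]subr0; apply: cvgB; first exact: cvg_cst.
  apply: (@squeeze_cvgr _ _ _ _ (cst 0) (fun n => e n `^ x)).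
  - apply: nearW => n; rewrite powR_ge0/=; apply: ge0_ler_powR.
    + exact: ltW.
    + by rewrite nnegrE ltW// A0.
    + by rewrite nnegrE ltW.
    + by apply: primitive_le; exact: ltW.
  - exact: cvg_cst.
  - apply: ((cvg_at_rightP _ _ _).1 (powR_cvg0 x0) e); split => //.
    rewrite -[X in _ --> X](mulr0 t); apply: cvgMr.
    exact: (@cvg_harmonic R).
have E : (\int[leb]_(r in `]0%R, t]) (g r)%:E)%E = (A t `^ x / x)%:E.
  exact: (cvg_unique _ cv cv2).
split; last by rewrite /Rintegral E.
apply/integrableP; split; first by apply/measurable_EFinP; exact: mg.
rewrite (_ : integral _ _ _ = (A t `^ x / x)%:E) ?ltry// -E.
by apply: eq_integral => r _; rewrite gee0_abs// lee_fin; exact: g0.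
Qed.

Lemma integrable_power x t : 0 < x -> 0 <= t ->
  leb.-integrable `[0, t] (fun r => (A r `^ (x - 1) * f r)%:E).
Proof.
move=> x0 t0; have [/integrableP[mg ioo] _] := Rintegral_power x0 t0.
apply/integrableP; split; first exact/emeasurable_fun_itv_obnd_cbndP.
rewrite -integral_itv_obnd_cbnd//; exact: (measurableT_comp _ mg).
Qed.

Lemma cmod_cpow_le u (z : R[i]) : 0 <= u -> cmod (cpow u z) <= u `^ Re z.
Proof.
rewrite le_eqVlt => /orP[/eqP<-|u0]; last by rewrite cmod_cpow.
rewrite /cpow eqxx; case: (eqVneq z 0) => [->|z0]; last by rewrite cmod0 powR_ge0.
by rewrite (cmod_nat 1) (_ : Re 0 = 0)// powRr0.
Qed.

Lemma primitive_ge0 s : 0 <= A s.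
Proof. by apply: Rintegral_ge0 => r _; have /andP[] := f01 r. Qed.

Lemma cmod_power_le (z : R[i]) r :
  cmod (cpow (A r) (z - 1) * (f r)%:C) <= A r `^ (Re z - 1) * f r.
Proof.
have /andP[f0 _] := f01 r.
rewrite cmodM cmodC (ger0_norm f0) ler_wpM2r//.
by rewrite (le_trans (cmod_cpow_le _ (primitive_ge0 _)))// ReD ReN.
Qed.

Lemma cintble_power (z : R[i]) t : 0 < Re z -> 0 <= t ->
  cintble leb `[0, t] (fun r => cpow (A r) (z - 1) * (f r)%:C).
Proof.
move=> z0 t0; apply: (cintble_dom (measurable_itvR _) _ (integrable_power z0 t0)).
  exact: cmeas_power.
by move=> r _; exact: cmod_power_le.
Qed.

Lemma Rintegral_power_itv x t : 0 < x -> 0 <= t ->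
  \int[leb]_(r in `[0, t]) (A r `^ (x - 1) * f r) = A t `^ x / x.
Proof.
move=> x0 t0; have [i0 e] := Rintegral_power x0 t0.
exact: etrans (esym (Rintegral_itv_obnd_cbnd i0)) e.
Qed.

Lemma cintegral_power (z : R[i]) t : 0 < Re z -> 0 <= t ->
  z * cintegral leb `[0, t] (fun r => cpow (A r) (z - 1) * (f r)%:C) = cpow (A t) z.
Proof.
move=> z0 t0.
have zn0 : z != 0 by apply: contraTN z0 => /eqP->; rewrite ltxx.
have fi := cintble_power z0 t0.
move: t0; rewrite le_eqVlt => /orP[/eqP<-|t0].
  rewrite set_itv1 /cintegral !Rintegral_set1 /A set_itv1 Rintegral_set1 cpow0//.
  by rewrite (_ : 0 +i* 0 = 0) ?mulr0.
pose g r := cpow (A r) (z - 1) * (f r)%:C.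
have key (w : R[i]) : Re (w * (z * cintegral leb `[0, t] g)) = Re (w * cpow (A t) z).
  have fw : cintble leb `[0, t] (fun r => w * z * g r) by exact: (cintbleZ (measurable_itvR _)).
  rewrite mulrA -(cintegralZ (measurable_itvR _))//.
  have e (r : R) : Re (w * z * g r) = Re (w * z * cpow (A r) (z - 1)) * f r.
    by rewrite /g mulrA ReMcr.
  apply/eqP; rewrite -subr_eq0 -normr_le0; apply/ler_addgt0Pl => d d0; rewrite addr0.
  (* [C] times the power [Re z] of [A s] bounds what the cut at [s] leaves out, namely the integral
     over [0, s] and the boundary term at [s]. The choice of [s] makes this at most [d]; [C + 1]
     avoids a division by 0. *)
  pose C := cmod (w * z) / Re z + cmod w.
  have C0 : 0 <= C by rewrite addr_ge0 ?cmod_ge0// divr_ge0 ?cmod_ge0// ltW.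
  pose s := Num.min t ((d / (C + 1)) `^ (Re z)^-1).
  have s0 : 0 < s by rewrite lt_min t0 powR_gt0// divr_gt0// ltr_wpDl.
  have st : s <= t by rewrite ge_min lexx.
  have sd : s `^ Re z <= d / (C + 1).
    have dC : 0 <= d / (C + 1) by apply: divr_ge0; [exact: ltW|exact: addr_ge0].
    rewrite [leRHS](_ : _ = ((d / (C + 1)) `^ (Re z)^-1) `^ Re z); last first.
      by rewrite -powRrM mulVf ?gt_eqF// powRr1.
    apply: ge0_ler_powR; rewrite ?nnegrE ?powR_ge0//; [exact: ltW|exact: ltW|].
    by rewrite ge_min lexx orbT.
  have := chain_rule_power w z s0 st.
  under eq_Rintegral do rewrite -e.
  rewrite -(@Rintegral_itvB _ _ (BLeft 0) (BRight t) s) ?bnd_simp//; [|exact: fw.1|exact: ltW].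
  set I := \int[leb]_(r in `[0, t]) _; set Is := \int[leb]_(r in `[0, s]) _ => h.
  have hs : `|Is| <= cmod (w * z) * (A s `^ Re z / Re z).
    rewrite -Rintegral_power_itv ?(ltW s0)// -RintegralZl//; last exact: integrable_power (ltW s0).
    have fs : leb.-integrable `[0, s] (fun r => (Re (w * z * g r))%:E).
      by apply: integrableS fw.1 => //; apply: subset_itvl; rewrite bnd_simp.
    apply: (le_trans (le_normr_Rintegral (measurable_itvR _) fs)); apply: le_Rintegral => //.
    - exact: (integrable_norm fs).
    - exact: (integrableZl (measurable_itvR _) _ (integrable_power z0 (ltW s0))).
    - move=> r _; rewrite (le_trans (Re_le_cmod _))// cmodM ler_wpM2l ?cmod_ge0//.
      exact: cmod_power_le.
  have hA : A s `^ Re z <= s `^ Re z.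
    apply: ge0_ler_powR; rewrite ?nnegrE ?primitive_ge0//; [exact: ltW|exact: ltW|].
    by apply: primitive_le; exact: ltW.
  have hw : `|Re (w * cpow (A s) z)| <= cmod w * A s `^ Re z.
    by rewrite (le_trans (Re_le_cmod _))// cmodM ler_wpM2l ?cmod_ge0// cmod_cpow_le ?primitive_ge0.
  rewrite -[Re (cintegral _ _ _)]/I (subr_exchange h).
  rewrite (le_trans (ler_normB _ _))// (le_trans (lerD hs hw))//.
  rewrite (_ : _ + _ = C * A s `^ Re z); last by rewrite /C; ring.
  rewrite (@le_trans _ _ (C * (d / (C + 1))))//; first by rewrite ler_wpM2l// (le_trans hA).
  by rewrite mulrCA ger_pMr// ler_pdivrMr ?mul1r ?lerDl// ltr_wpDl.
apply: complex_ext; first by have := key 1; rewrite !mul1r.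
have := key (- 'i); rewrite !ReM/= !oppr0 !mul0r !sub0r !mulN1r !opprK//.
Qed.
End power_chain.

(** * Convolution with exponentials *)

(** [ce a] and [expo a] are [E_a] and the convolution with it. The latter inverts [u' + a u] with
    initial value 0, whence the resolvent identity. *)
Definition ce (R : realType) (a : R[i]) : R -> R[i] := fun s => cexp (- (a * s%:C)).
Definition expo (R : realType) (a : R[i]) (u : R -> R[i]) : R -> R[i] := conv u (ce a).

Section exponential_convolution.
Context {R : realType}.
Notation leb := (@lebesgue_measure R).
Implicit Types (a b c : R[i]) (u v f g : R -> R[i]) (s t : R).

Lemma ce0 a : ce a 0 = 1.
Proof. by rewrite /ce mulr0 oppr0 cexp0. Qed.

Lemma ce_0 s : ce 0 s = 1.
Proof. by rewrite /ce mul0r oppr0 cexp0. Qed.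

Lemma ceD a b s : ce (a + b) s = ce a s * ce b s.
Proof. by rewrite /ce mulrDl opprD cexpD. Qed.

Lemma ce_add a s t : ce a (s + t) = ce a s * ce a t.
Proof. by rewrite /ce rmorphD mulrDr opprD cexpD. Qed.

Lemma ceN a s : ce (- a) s * ce a s = 1.
Proof. by rewrite -ceD addNr ce_0. Qed.

Lemma cmod_ce a s : cmod (ce a s) = expR (- (Re a * s)).
Proof. by rewrite /ce cmod_cexp ReN ReMcr. Qed.

Lemma lbd_ce a : lbd (ce a).
Proof.
move=> T; split.
  apply: cmeas_cexp => //; apply: cmeasN; apply: cmeasM; first exact: cmeas_cst.
  by apply: cmeas_real; exact: measurable_id.
exists (expR (`|Re a| * `|T|)) => s /andP[s0 sT]; rewrite cmod_ce ler_expR.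
rewrite -mulNr (le_trans (ler_norm _))// normrM normrN ler_wpM2l//.
by rewrite !ger0_norm ?(le_trans s0).
Qed.

Lemma lintM f u : lbd f -> lint u -> lint (fun s => f s * u s).
Proof.
move=> hf hu T; have [C C0 fC] := lbd_bound T hf.
apply: (eq_cintble (measurable_itvR _) _
  (cintbleM_bounded (measurable_itvR _) (hu T) (hf T).1 (C := C) _)).
  by move=> s _; rewrite mulrC.
by move=> s /=; rewrite in_itv/= => /fC.
Qed.

Lemma eq_conv u v f g t : (forall s, 0 <= s <= t -> u s = v s) ->
  (forall s, 0 <= s <= t -> f s = g s) -> conv u f t = conv v g t.
Proof.
move=> uv fg; apply: eq_cintegral => s /=; rewrite in_itv/= => st.
by rewrite uv// fg//; lra.
Qed.

Lemma convDl u v f t : lint u -> lint v -> lbd f ->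
  conv (fun s => u s + v s) f t = conv u f t + conv v f t.
Proof.
move=> hu hv hf; rewrite /conv -cintegralD//; try exact: conv_cintble0.
by apply: eq_cintegral => s _; rewrite mulrDl.
Qed.

Lemma convZl k u f t : lint u -> lbd f ->
  conv (fun s => k * u s) f t = k * conv u f t.
Proof.
move=> hu hf; rewrite /conv -cintegralZ//; last exact: conv_cintble0.
by apply: eq_cintegral => s _; rewrite mulrA.
Qed.

Lemma convDr u f g t : lint u -> lbd f -> lbd g ->
  conv u (fun s => f s + g s) t = conv u f t + conv u g t.
Proof.
move=> hu hf hg; rewrite /conv -cintegralD//; try exact: conv_cintble0.
by apply: eq_cintegral => s _; rewrite mulrDr.
Qed.

Lemma convZr k u f t : lint u -> lbd f ->
  conv u (fun s => k * f s) t = k * conv u f t.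
Proof.
move=> hu hf; rewrite /conv -cintegralZ//; last exact: conv_cintble0.
by apply: eq_cintegral => s _; rewrite mulrCA.
Qed.

Lemma convAC u f g t : lint u -> lbd f -> lbd g ->
  conv (conv u f) g t = conv (conv u g) f t.
Proof.
move=> hu hf hg; rewrite (convA t hu hf hg) (convA t hu hg hf).
apply: eq_conv => // s _.
by apply: convC => //; exact: lbd_lint.
Qed.

Lemma conv_ce a u f t : lint u -> lbd f ->
  conv (fun s => ce a s * u s) (fun s => ce a s * f s) t = ce a t * conv u f t.
Proof.
move=> hu hf; rewrite /conv -cintegralZ//; last exact: conv_cintble0.
apply: eq_cintegral => s _; rewrite (_ : ce a t = ce a s * ce a (t - s)).
  by ring.
by rewrite -ce_add subrKC.
Qed.

(** Multiplication by an exponential commutes with convolution, so convolving with [ce a] amounts to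
    taking a primitive. Continuity and injectivity of [expo a] are obtained in this way. *)
Lemma conv_expo a u t : lint u -> conv u (ce a) t = ce a t * conv (fun s => ce (- a) s * u s) (fun=> 1) t.
Proof.
move=> hu; rewrite -conv_ce.
- apply: eq_conv => s _; last by rewrite mulr1.
  by rewrite mulrA [ce a s * _]mulrC ceN mul1r.
- by apply: lintM => //; exact: lbd_ce.
- exact: lbd_cst.
Qed.

Lemma primitive_id s : 0 <= s -> \int[leb]_(r in `[0, s]) 1 = s.
Proof.
move=> s0; rewrite Rintegral_cst//= lebesgue_measure_itv/= lte_fin.
by move: s0; rewrite le_eqVlt => /orP[/eqP<-|->]; rewrite ?ltxx ?mulr0//= subr0 mul1r.
Qed.

Lemma cintegral_ce a t : 0 <= t -> a * cintegral leb `[0, t] (ce a) = 1 - ce a t.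
Proof.
move=> t0.
have key w : Re (w * (a * cintegral leb `[0, t] (ce a))) = Re (w * (1 - ce a t)).
  have f01 (s : R) : (0 : R) <= (fun=> 1) s <= (1 : R) by rewrite ler01 lexx.
  have mf1 : measurable_fun (setT : set (measurableTypeR R)) (fun=> (1 : R)).
    exact: measurable_cst.
  pose L := cmod (- w * - a * - a) * expR (`|Re a| * t).
  have eC (u : R) : cexp (- a * u%:C) = ce a u by rewrite /ce mulNr.
  (* The chain rule for [f = 1], whose primitive is the identity on the half-line. *)
  have H := @chain_rule _ (fun=> 1) mf1 f01 (fun u : R => Re (- w * cexp (- a * u%:C)))
    (fun u : R => Re (- w * - a * cexp (- a * u%:C)))
    (fun u : R => Re (- w * - a * - a * cexp (- a * u%:C))) 0 t L (lexx 0) t0.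
  have {H} H := H (fun (u : R) _ => is_derive_Re_cexp (- w) (- a) u)
    (fun (u : R) _ => is_derive_Re_cexp (- w * - a) (- a) u).
  rewrite (primitive_id (lexx 0)) (primitive_id t0) in H.
  have iw := cintbleZ (measurable_itvR _) (w * a) (lbd_lint (lbd_ce a) t).
  rewrite mulrA -(cintegralZ (measurable_itvR _)); last exact: (lbd_lint (lbd_ce a) t).
  rewrite [LHS]/= -Rintegral_itv_obnd_cbnd; last first.
    by apply: integrableS iw.1 => //; apply: subset_itvr; rewrite bnd_simp.
  transitivity (\int[leb]_(r in `]0, t])
    (Re (- w * - a * cexp (- a * (\int[leb]_(q in `[0, r]) 1)%:C)) * 1)).
    apply: eq_Rintegral => r /set_mem/=; rewrite in_itv/= => /andP[r0 _].
    by rewrite (primitive_id (ltW r0)) mulr1 mulrNN eC.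
  rewrite {}H.
  - by rewrite !eC ce0 -ReN -ReD; congr Re; ring.
  - move=> u /andP[u0 ut]; rewrite (le_trans (Re_le_cmod _))// cmodM ler_wpM2l ?cmod_ge0//.
    rewrite eC cmod_ce ler_expR -mulNr (le_trans (ler_norm _))// normrM normrN.
    by rewrite (ger0_norm u0) ler_wpM2l.
  - apply: (cmeasM (cmeas_cst _ _) (cmeas_cexp _ (cmeasM (cmeas_cst _ _) (cmeas_real _)))).1 => //.
    exact: measurable_primitive.
apply: complex_ext; first by have := key 1; rewrite !mul1r.
by have := key (- 'i); rewrite !ReM/= !oppr0 !mul0r !sub0r !mulN1r !opprK.
Qed.

Lemma conv_ce_ce a b t : 0 <= t -> (b - a) * conv (ce a) (ce b) t = ce a t - ce b t.
Proof.
move=> t0; rewrite convC; [|exact: lbd_lint (lbd_ce a)|exact: lbd_ce].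
rewrite conv_expo; last exact: lbd_lint (lbd_ce b).
rewrite (_ : conv _ _ t = cintegral leb `[0, t] (ce (b - a))); last first.
  by apply: eq_cintegral => s _; rewrite mulr1 -ceD addrC.
by rewrite mulrCA cintegral_ce// mulrBr mulr1 -ceD subrKC.
Qed.

Lemma lbd_expo a u : lint u -> lbd (expo a u).
Proof. by move=> hu; apply: lbd_conv => //; exact: lbd_ce. Qed.

Lemma expoC a b u t : lint u -> expo a (expo b u) t = expo b (expo a u) t.
Proof. by move=> hu; apply: convAC => //; exact: lbd_ce. Qed.

(** The factor [b - a] is kept on the left instead of dividing, so that [a = b] is allowed. *)
Lemma expo_resolvent a b u t : lint u ->
  (b - a) * expo b (expo a u) t = expo a u t - expo b u t.
Proof.
move=> hu; rewrite /expo convA//; try exact: lbd_ce.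
have lc : lbd (conv (ce a) (ce b)).
  by apply: lbd_conv; [exact: lbd_lint (lbd_ce a)|exact: lbd_ce].
rewrite -convZr//.
rewrite (@eq_conv _ u _ (fun s => ce a s + (-1) * ce b s))//; last first.
  by move=> s /andP[s0 _]; rewrite conv_ce_ce// mulN1r.
rewrite convDr//; [|exact: lbd_ce|by apply: lbdZ; exact: lbd_ce].
by rewrite convZr ?mulN1r//; exact: lbd_ce.
Qed.
End exponential_convolution.

(* The composition of the operators [1 + (q k - p k) expo (p k)], [1 <= k <= n]. *)
Fixpoint Kop (R : realType) (p q : nat -> R[i]) (n : nat) (u : R -> R[i]) : R -> R[i] :=
  if n is n'.+1 then
    fun t => Kop p q n' u t + (q n - p n) * expo (p n) (Kop p q n' u) t
  else u.

(** The smoothings by [q 1, ..., q N]. The sequence is shifted at each step because cancelling one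
    numerator in [expo_Kop] shifts [q] as well. *)
Fixpoint expo_iter (R : realType) (q : nat -> R[i]) (N : nat) (u : R -> R[i]) : R -> R[i] :=
  if N is N'.+1 then expo_iter (q \o succn) N' (expo (q 1%N) u) else u.

(** The smoothings by [p (m + 1), ..., p (m + N)]: the denominators left over once [N] numerators of
    [Kop] have been cancelled. *)
Fixpoint expo_chain (R : realType) (p : nat -> R[i]) (m N : nat) (u : R -> R[i]) : R -> R[i] :=
  if N is N'.+1 then expo_chain p m N' (expo (p (m + N')%N.+1) u) else u.

(* The weight [e^s] makes [expo a] a contraction by exactly [1 / (1 + Re a)], which
   is what the product estimates for [Kop] need. *)
Definition wb (R : realType) (B : R) (u : R -> R[i]) :=
  forall s, 0 <= s -> cmod (u s) <= B * expR s.

(** * The operators K_n and their weighted bounds *)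

Section operators.
Context {R : realType}.
Notation leb := (@lebesgue_measure R).
Implicit Types (p q : nat -> R[i]) (u v f : R -> R[i]) (t : R).

Lemma eq_expo a u v t : (forall s, 0 <= s <= t -> u s = v s) -> expo a u t = expo a v t.
Proof. by move=> uv; apply: eq_conv. Qed.

Lemma lbd_Kop p q n u : lbd u -> lbd (Kop p q n u).
Proof.
move=> hu; elim: n => //= n IH; apply: lbdD => //; apply: lbdZ; apply: lbd_expo.
exact: lbd_lint.
Qed.

Lemma KopD p q n u v : lbd u -> lbd v ->
  Kop p q n (fun s => u s + v s) = (fun t => Kop p q n u t + Kop p q n v t).
Proof.
move=> hu hv; elim: n => //= n IH; apply/funext => t; rewrite IH /expo convDl.
- by ring.
- exact/lbd_lint/lbd_Kop.
- exact/lbd_lint/lbd_Kop.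
- exact: lbd_ce.
Qed.

Lemma KopZ p q n k u : lbd u -> Kop p q n (fun s => k * u s) = (fun t => k * Kop p q n u t).
Proof.
move=> hu; elim: n => //= n IH; apply/funext => t; rewrite IH /expo convZl.
- by ring.
- exact/lbd_lint/lbd_Kop.
- exact: lbd_ce.
Qed.

Lemma Kop_conv p q n u f : lbd u -> lbd f -> Kop p q n (conv u f) = conv (Kop p q n u) f.
Proof.
move=> hu hf; elim: n => //= n IH; apply/funext => t; rewrite IH.
have hK : lint (Kop p q n u) by exact/lbd_lint/lbd_Kop.
have hE : lint (expo (p n.+1) (Kop p q n u)) by exact/lbd_lint/lbd_expo.
rewrite convDl//; last exact: lintZ.
by rewrite convZl// /expo (convAC t hK hf (lbd_ce _)).
Qed.

Lemma Kop_expo p q n a u : lbd u -> Kop p q n (expo a u) = expo a (Kop p q n u).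
Proof. by move=> hu; rewrite /expo Kop_conv//; exact: lbd_ce. Qed.

Lemma expoDZ a c u v t : lint u -> lint v ->
  expo a (fun s => u s + c * v s) t = expo a u t + c * expo a v t.
Proof.
move=> hu hv; rewrite /expo convDl; [|exact: hu|exact: lintZ|exact: lbd_ce].
by rewrite convZl//; exact: lbd_ce.
Qed.

(** In the Laplace variable, [1 / (s + q 1)] cancels the first numerator of the product of
    [(s + q k) / (s + p k)]; the remaining numerators [s + q (k + 1)] are regrouped with the
    denominators [s + p k], and [1 / (s + p n.+1)] is left. The inductive step is the regrouping for
    two consecutive indices, an instance of the resolvent identity. *)
Lemma expo_Kop p q n u : lbd u ->
  expo (q 1%N) (Kop p q n.+1 u) = Kop p (q \o succn) n (expo (p n.+1) u).
Proof.
move=> hu; elim: n => [|n IH].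
  apply/funext => t /=; have lu := lbd_lint hu; rewrite (expoDZ _ _ _ lu (lbd_lint (lbd_expo (p 1%N) lu))).
  by rewrite expo_resolvent// addrC subrK.
apply/funext => t; rewrite [Kop p q n.+2 u]/=.
rewrite -[fun t => _]/(fun t => Kop p q n.+1 u t + (q n.+2 - p n.+2) * expo (p n.+2) (Kop p q n.+1 u) t).
have hK : lint (Kop p q n.+1 u) by exact/lbd_lint/lbd_Kop.
have hE : lint (expo (p n.+2) (Kop p q n.+1 u)) by exact/lbd_lint/lbd_expo.
rewrite (expoDZ _ _ _ hK hE) (expoC _ _ _ hK) IH Kop_expo// [RHS]/= Kop_expo//.
set y := Kop p (q \o succn) n u.
have hy : lint y by exact/lbd_lint/lbd_Kop.
have r1 := expo_resolvent (p n.+1) (p n.+2) t hy.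
have r2 := expoC (p n.+1) (p n.+2) t hy.
rewrite r2; have e : expo (p n.+1) y t = expo (p n.+2) y t + (p n.+2 - p n.+1) * expo (p n.+2) (expo (p n.+1) y) t.
  by rewrite r1; ring.
by rewrite e /=; ring.
Qed.

(** For [q k = phi (z + k)] the shifted sequence belongs to [z + N]: the smoothed operator for [z]
    is the operator for [z + N], preceded by [N] smoothings that will make its argument small. *)
Lemma expo_iter_Kop N p q m u : lbd u ->
  expo_iter q N (Kop p q (m + N)%N u) = Kop p (fun k => q (k + N)%N) m (expo_chain p m N u).
Proof.
elim: N q u => [|N IH] q u hu /=.
  by rewrite addn0; congr (Kop _ _ _ _); apply/funext => k; rewrite addn0.
rewrite addnS expo_Kop// IH; last by apply/lbd_expo/lbd_lint.
by congr (Kop _ _ _ _); apply/funext => k /=; rewrite addnS.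
Qed.

Lemma expo_iterD N q u v : lbd u -> lbd v ->
  expo_iter q N (fun s => u s + v s) = (fun t => expo_iter q N u t + expo_iter q N v t).
Proof.
elim: N q u v => //= N IH q u v hu hv.
rewrite -IH; [|exact/lbd_expo/lbd_lint|exact/lbd_expo/lbd_lint].
congr (expo_iter _ _ _); apply/funext => t.
by rewrite /expo convDl//; [exact: lbd_lint|exact: lbd_lint|exact: lbd_ce].
Qed.

(** Young's inequality for the weight [exp (- s)]; multiplication by [ce 1] reduces it to the
    unweighted inequality. *)
Lemma wb_conv B C u f : 0 <= B -> wb B u -> lbd u -> lbd f ->
  (forall T, 0 <= T -> \int[leb]_(s in `[0, T]) (expR (- s) * cmod (f s)) <= C) ->
  wb (B * C) (conv u f).
Proof.
move=> B0 Bu hu hf fC t t0.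
have e1 (s : R) : cmod (ce 1 s) = expR (- s) by rewrite cmod_ce mul1r.
have lu : lbd (fun s => ce 1 s * u s) by apply: lbdM => //; exact: lbd_ce.
have lf : lbd (fun s => ce 1 s * f s) by apply: lbdM => //; exact: lbd_ce.
have := @cmod_conv_le2 R t _ _ B t lu (lbd_lint lf) B0.
rewrite (conv_ce 1 t (lbd_lint hu) hf) cmodM e1 t0 lexx => h.
have {h} h := h _ isT.
rewrite -ler_pdivrMr ?expR_gt0// -expRN mulrC (le_trans (h _))//.
  move=> s /andP[s0 _]; rewrite cmodM e1 expRN -ler_pdivlMl ?invr_gt0 ?expR_gt0//.
  by rewrite invrK mulrC; exact: Bu.
rewrite ler_wpM2l//; apply: le_trans (fC _ t0).
by rewrite le_eqVlt; apply/orP; left; apply/eqP; apply: eq_Rintegral => s _; rewrite cmodM e1.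
Qed.

Lemma le_inv_expR (P T : R) : 0 < P -> 0 <= T ->
  \int[leb]_(s in `[0, T]) expR (- (P * s)) <= P^-1.
Proof.
move=> P0 T0.
have := cintegral_ce P%:C T0; move/(congr1 (@complex.Re R)); rewrite ReMc => h.
have e s : expR (- (P * s)) = Re (ce P%:C s) by rewrite /ce -rmorphM -rmorphN cexpC.
under eq_Rintegral do rewrite e.
rewrite -[leRHS]mul1r ler_pdivlMr// mulrC [leLHS]h ReD ReN (_ : Re 1 = 1)// gerDl oppr_le0.
by rewrite -e expR_ge0.
Qed.

Lemma ce_mass (r T : R) : 0 <= r -> 0 <= T ->
  \int[leb]_(s in `[0, T]) (expR (- s) * expR (- (r * s))) <= (1 + r)^-1.
Proof.
move=> r0 T0; rewrite (le_trans _ (le_inv_expR _ T0)) ?ltr_pwDl//.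
rewrite le_eqVlt; apply/orP; left; apply/eqP; apply: eq_Rintegral => s _.
by rewrite -expRD; congr expR; ring.
Qed.

Lemma wb_expo B a u : 0 <= B -> 0 <= Re a -> lbd u -> wb B u ->
  wb (B / (1 + Re a)) (expo a u).
Proof.
move=> B0 a0 hu Bu; apply: wb_conv => //; first exact: lbd_ce.
move=> T T0; under eq_Rintegral do rewrite cmod_ce.
exact: ce_mass.
Qed.

Lemma wbD B C u v : wb B u -> wb C v -> wb (B + C) (fun s => u s + v s).
Proof. by move=> h1 h2 s s0; rewrite (le_trans (cmodD _ _))// mulrDl lerD// (h1,h2). Qed.

Lemma wbZ B k u : wb B u -> wb (cmod k * B) (fun s => k * u s).
Proof. by move=> h s s0; rewrite cmodM -mulrA ler_wpM2l ?cmod_ge0// h. Qed.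

Lemma wb_le B C u : B <= C -> wb B u -> wb C u.
Proof. by move=> BC h s s0; rewrite (le_trans (h _ s0))// ler_wpM2r ?expR_ge0. Qed.

(** Follows from [1 + v <= expR v] and [1 - x / y <= ln (y / x)]. A power of a quotient is wanted
    because such bounds telescope in a product. *)
Lemma one_add_le_powR (w x y : R) : 0 <= w -> 0 < x -> x <= y ->
  1 + w * ((y - x) / y) <= (y / x) `^ w.
Proof.
move=> w0 x0 xy; have y0 := lt_le_trans x0 xy.
have xy0 : 0 < y / x by rewrite divr_gt0.
rewrite /powR gt_eqF//; apply: le_trans (expR_ge1Dx _); rewrite lerD2l ler_wpM2l//.
rewrite -[X in ln X]invrK lnV ?posrE ?invr_gt0// lerNr.
have := @le_ln1Dx _ ((y / x)^-1 - 1); rewrite subrKC (_ : _ - 1 = - ((y - x) / y)).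
  by apply; rewrite ltrNl opprK ltr_pdivrMr// mul1r gtrBl.
by rewrite invf_div; field; rewrite gt_eqF.
Qed.

(** As [P k = 1 + p k], the operator [expo (p k)] has weighted norm at most [1 / P k]. By
    [one_add_le_powR] each factor of [Kop] then costs at most the power [w] of a quotient of
    consecutive [P], and the quotients telescope. *)
Lemma wb_Kop p q (P : nat -> R) (w : R) n B u : 0 <= B -> 0 <= w ->
  (forall k, 1 <= P k) -> (forall k, p k = (P k - 1)%:C) ->
  (forall k, P k <= P k.+1) ->
  (forall k, cmod (q k.+1 - p k.+1) <= w * (P k.+1 - P k)) ->
  lbd u -> wb B u -> wb (B * (P n / P 0%N) `^ w) (Kop p q n u).
Proof.
move=> B0 w0 P1 pP Pi qP hu Bu.
have P0 k : 0 < P k by rewrite (lt_le_trans ltr01).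
have BB k : 0 <= B * (P k / P 0%N) `^ w by rewrite mulr_ge0 ?powR_ge0.
elim: n => [|n IH] /=; first by rewrite divff ?gt_eqF// powR1 mulr1.
have := wb_expo (BB n) _ (lbd_Kop p q n hu) IH.
move=> /(_ (p n.+1)); rewrite pP/= subr_ge0 P1 => /(_ isT) h.
apply: wb_le (wbD IH (wbZ _ h)).
rewrite -pP subrKC -[X in X + _]mulr1 mulrCA -mulrDr -mulrA ler_wpM2l//.
apply: (@le_trans _ _ ((P n / P 0%N) `^ w * (P n.+1 / P n) `^ w)); last first.
  have D a b : 0 <= P a / P b by apply: divr_ge0; exact: ltW.
  rewrite -powRM// (_ : _ * _ = P n.+1 / P 0%N)//.
  by field; rewrite !gt_eqF.
rewrite ler_wpM2l ?powR_ge0//; apply: le_trans (one_add_le_powR w0 (P0 n) (Pi n)).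
by rewrite lerD2l mulrA ler_wpM2r// invr_ge0 ltW.
Qed.

Lemma wb_expo_chain p (P : nat -> R) m N B u : 0 <= B ->
  (forall k, 1 <= P k) -> (forall k, p k = (P k - 1)%:C) ->
  (forall k, P k <= P k.+1) ->
  lbd u -> wb B u -> lbd (expo_chain p m N u) /\ wb (B / P m ^+ N) (expo_chain p m N u).
Proof.
move=> + P1 pP Pi; elim: N B u => [|N IH] B u B0 hu Bu /=; first by rewrite expr0 divr1.
have P0 k : 0 < P k by rewrite (lt_le_trans ltr01).
have lE : lbd (expo (p (m + N).+1) u) by apply/lbd_expo/lbd_lint.
have wE : wb (B / P m) (expo (p (m + N).+1) u).
  have := wb_expo (a := p (m + N).+1) B0 _ hu Bu.
  rewrite pP/= subr_ge0 P1 subrKC => /(_ isT); apply: wb_le.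
  rewrite ler_wpM2l// lef_pV2 ?posrE//.
  have h k : P m <= P (m + k)%N.
    by elim: k => [|k]; rewrite ?addn0// addnS => /le_trans; apply.
  by rewrite -addnS.
have B'0 : 0 <= B / P m by apply: divr_ge0 => //; exact: ltW.
have [l w] := IH _ _ B'0 lE wE; split => //.
by rewrite exprS invfM mulrA.
Qed.
End operators.

(* [cpow _ (z - 1)] is singular at 0 when [Re z < 1], hence [t > 0]. *)
Definition ccont (R : realType) (u : R -> R[i]) := forall t : R, 0 < t ->
  (Re (u s) @[s --> t] --> Re (u t)) /\ (Im (u s) @[s --> t] --> Im (u t)).

(** * Continuity on the open half-line and injectivity of the smoothings *)

Section continuity.
Context {R : realType}.
Notation leb := (@lebesgue_measure R).
Implicit Types (u v f : R -> R[i]) (t : R).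

Lemma ccontD u v : ccont u -> ccont v -> ccont (fun s => u s + v s).
Proof.
move=> hu hv t t0; have [ur ui] := hu t t0; have [vr vi] := hv t t0; split.
- by under eq_cvg do rewrite ReD; rewrite ReD; exact: cvgD.
- by under eq_cvg do rewrite ImD; rewrite ImD; exact: cvgD.
Qed.

Lemma ccontM u v : ccont u -> ccont v -> ccont (fun s => u s * v s).
Proof.
move=> hu hv t t0; have [ur ui] := hu t t0; have [vr vi] := hv t t0; split.
- by under eq_cvg do rewrite ReM; rewrite ReM; apply: cvgB; exact: cvgM.
- by under eq_cvg do rewrite ImM; rewrite ImM; apply: cvgD; exact: cvgM.
Qed.

Lemma ccont_cst c : ccont (fun=> c : R[i]).
Proof. by move=> t t0; split; exact: cvg_cst. Qed.

Lemma Im_ReNi (a : R[i]) : Im a = Re (- 'i * a).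
Proof. by case: a => x y; rewrite ReM/= oppr0 mul0r sub0r mulN1r opprK. Qed.

Lemma ccont_ce a : ccont (@ce R a).
Proof.
have h (w : R[i]) t : Re (w * cexp (- a * s%:C)) @[s --> t] --> Re (w * cexp (- a * t%:C)).
  apply: differentiable_continuous; apply/derivable1_diffP.
  by have [] := is_derive_Re_cexp w (- a) t.
have E (s : R) : ce a s = cexp (- a * s%:C) by rewrite /ce mulNr.
move=> t t0; split.
- by have := h 1 t; rewrite -E mul1r; under eq_cvg do rewrite -E mul1r.
- have I s : Im (ce a s) = Re (- 'i * cexp (- a * s%:C)) by rewrite E Im_ReNi.
  by rewrite I; under eq_cvg do rewrite I; exact: h.
Qed.

Lemma ccont_conv1 u : lint u -> ccont (conv u (fun=> 1)).
Proof.
move=> hu t t0; have tI : t \in `]0, t + 1[ by rewrite in_itv/= t0 ltrDl ltr01.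
have t1 : 0 < t + 1 by rewrite addr_gt0.
have key (g : R -> R) : leb.-integrable `[0, t + 1] (EFin \o g) ->
    \int[leb]_(r in `[0, s]) g r @[s --> t] --> \int[leb]_(r in `[0, t]) g r.
  move=> ig; have := parameterized_integral_continuous (ltW t1) ig.
  by move/(within_continuous_continuous t1); apply.
have [ir ii] := hu (t + 1).
have -> : conv u (fun=> 1) = fun s => cintegral leb `[0, s] u.
  by apply/funext => s; apply: eq_cintegral => r _; rewrite mulr1.
by split; exact: key.
Qed.

Lemma ccont_expo a u : lint u -> ccont (expo a u).
Proof.
move=> hu; have -> : expo a u = fun t => ce a t * conv (fun s => ce (- a) s * u s) (fun=> 1) t.
  by apply/funext => t; exact: conv_expo.
apply: ccontM; first exact: ccont_ce.
by apply: ccont_conv1; apply: lintM => //; exact: lbd_ce.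
Qed.

Lemma ccont_Kop p q n u : lbd u -> ccont u -> ccont (Kop p q n u).
Proof.
move=> hu cu; elim: n => //= n IH; apply: ccontD => //.
by apply: ccontM; [exact: ccont_cst|exact/ccont_expo/lbd_lint/lbd_Kop].
Qed.

(** The weight is bounded near [t], so the convergence is locally uniform. *)
Lemma ccont_limit (F : nat -> R -> R[i]) u (d : nat -> R) :
  (forall n, ccont (F n)) -> d n @[n --> \oo] --> (0:R) ->
  (forall n, wb (d n) (fun s => F n s - u s)) -> ccont u.
Proof.
move=> cF d0 dF t t0.
have key (h : R[i] -> R) : (forall a b, `|h a - h b| <= cmod (a - b)) ->
    (forall n, h (F n s) @[s --> t] --> h (F n t)) -> h (u s) @[s --> t] --> h (u t).
  move=> hh hF; apply/cvgrPdist_le => e e0.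
  have e3 : 0 < e / 3 / expR (t + 1) by rewrite !divr_gt0 ?expR_gt0.
  move/cvgrPdist_le : d0 => /(_ _ e3)[n _ /(_ _ (leqnn n))/=]; rewrite sub0r normrN => dn.
  have B s : 0 <= s <= t + 1 -> `|h (F n s) - h (u s)| <= e / 3.
    move=> /andP[s0 st]; rewrite (le_trans (hh _ _))// (le_trans (dF n s s0))//.
    rewrite (@le_trans _ _ (`|d n| * expR (t + 1)))//.
      apply: (@le_trans _ _ (`|d n| * expR s)).
        by rewrite ler_wpM2r ?expR_ge0 ?ler_norm.
      by rewrite ler_wpM2l ?ler_expR.
    by rewrite -ler_pdivlMr ?expR_gt0.
  have := hF n; move/cvgrPdist_le => /(_ (e / 3)); rewrite divr_gt0// => /(_ isT) H.
  have tI : t \in `]0, t + 1[ by rewrite in_itv/= t0 ltrDl ltr01.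
  apply: filterS2 H (near_in_itvoo tI) => s h3; rewrite in_itv/= => /andP[s0 st].
  have h1 := B s (introT andP (conj (ltW s0) (ltW st))).
  have h2 : `|h (F n t) - h (u t)| <= e / 3 by apply: B; rewrite (ltW t0)/= lerDl.
  have -> : h (u t) - h (u s) = (h (F n t) - h (F n s)) - (h (F n t) - h (u t)) + (h (F n s) - h (u s)) by ring.
  rewrite (le_trans (ler_normD _ _))// (le_trans (lerD (ler_normB _ _) (lexx _)))//.
  by rewrite [leRHS](_ : e = e / 3 + e / 3 + e / 3) ?lerD//; field.
split; apply: key.
- by move=> a b; rewrite -ReN -ReD Re_le_cmod.
- by move=> n; have [] := cF n t t0.
- by move=> a b; rewrite -ImN -ImD Im_le_cmod.
- by move=> n; have [] := cF n t t0.
Qed.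

(** After multiplication by an exponential the hypothesis says that a primitive vanishes on the open
    half-line; its derivative at a point of continuity is the integrand. *)
Lemma expo_inj a u : lint u -> ccont u -> (forall t, 0 < t -> expo a u t = 0) ->
  forall t, 0 < t -> u t = 0.
Proof.
move=> hu cu h t t0.
pose v s := ce (- a) s * u s.
have cv : ccont v by apply: ccontM => //; exact: ccont_ce.
have lv : lint v by apply: lintM => //; exact: lbd_ce.
have v0 s : 0 < s -> conv v (fun=> 1) s = 0.
  move=> s0; have := h s s0; rewrite /expo conv_expo// => /eqP.
  by rewrite mulf_eq0 (negbTE (cexp_neq0 _)) => /eqP.
suff : v t = 0.
  by rewrite /v => /eqP; rewrite mulf_eq0 (negbTE (cexp_neq0 _)) => /eqP.
have [ir ii] := lv (t + 1).
have tt : t < t + 1 by rewrite ltrDl.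
have key (g : R -> R) : leb.-integrable `[0, t + 1] (EFin \o g) -> {for t, continuous g} ->
    (forall s, 0 < s -> \int[leb]_(r in `[0, s]) g r = 0) -> g t = 0.
  move=> ig cg g0; have [d1 <-] := continuous_FTC1_closed tt ig t0 cg.
  have H : is_derive t 1 (fun x => \int[leb]_(r in `[0, x]) g r) 0.
    apply: (@near_eq_is_derive _ _ _ (cst 0)).
      near=> s; rewrite /= g0//; near: s; exact: lt_nbhsr.
  by rewrite derive1E; exact: derive_val.
have [cr ci] := cv t t0.
apply: complex_ext; [apply: (key (fun s => Re (v s))) => //|apply: (key (fun s => Im (v s))) => //].
- move=> s s0; have := congr1 (@complex.Re R) (v0 s s0); rewrite /conv/=.
  by under eq_Rintegral do rewrite mulr1.
- move=> s s0; have := congr1 (@complex.Im R) (v0 s s0); rewrite /conv/=.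
  by under eq_Rintegral do rewrite mulr1.
Unshelve. all: by end_near. Qed.

Lemma expo_iter_inj N q u : lbd u -> ccont u ->
  (forall t, 0 < t -> expo_iter q N u t = 0) -> forall t, 0 < t -> u t = 0.
Proof.
elim: N q u => [|N IH] q u hu cu; first exact.
move=> h; apply: (expo_inj (a := q 1%N)) => //; first exact: lbd_lint.
by apply: IH h; [exact/lbd_expo/lbd_lint|exact/ccont_expo/lbd_lint].
Qed.
End continuity.

(** * Bernstein functions *)

Section bernstein_function.
Context {R : realType}.
Variable phi : R[i] -> R[i].
Hypothesis hphi : bernstein phi.
Notation leb := (@lebesgue_measure R).
Notation pr k := (Re (phi k%:R)).

Lemma natC (n : nat) : (n%:R : R[i]) = (n%:R)%:C.
Proof. by rewrite rmorph_nat. Qed.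

Lemma ce_nat (n : nat) (y : R) : ce n%:R y = (expR (- (n%:R * y)))%:C.
Proof. by rewrite natC /ce -rmorphM -rmorphN cexpC. Qed.

Lemma cmod_oneB_ce (w : R[i]) (y : R) : 0 <= Re w -> 0 <= y ->
  cmod (1 - ce w y) <= cmod w * y.
Proof.
move=> w0 y0; rewrite -cintegral_ce// cmodM ler_wpM2l ?cmod_ge0//.
rewrite -[leRHS](primitive_id y0).
apply: cmod_cintegral_le => //.
- exact: (lbd_ce w y).1.
- by apply: integrable_cst_itv; exact: leb_itv_lty.
- move=> s /=; rewrite in_itv/= => /andP[s0 _].
  by rewrite cmod_ce -expR0 ler_expR oppr_le0 mulr_ge0.
Qed.

Lemma cmod_oneB_ce2 (w : R[i]) (y : R) : 0 <= Re w -> 0 <= y ->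
  cmod (1 - ce w y) <= 2.
Proof.
move=> w0 y0; rewrite (le_trans (cmodD _ _))// cmodN cmod1 (_ : 2 = 1 + 1)//.
by rewrite lerD2l cmod_ce -expR0 ler_expR oppr_le0 mulr_ge0.
Qed.

Lemma cmod_ce_taylor2 (w : R[i]) (y : R) : 0 <= Re w -> 0 <= y ->
  cmod (1 - ce w y - w * y%:C) <= cmod w ^+ 2 * y ^+ 2.
Proof.
move=> w0 y0; rewrite -cintegral_ce//.
have l1 := lbd_lint (lbd_cst (1 : R[i])).
have -> : y%:C = cintegral leb `[0, y] (fun=> 1).
  by rewrite -[in LHS](primitive_id y0) -cintegral_real.
rewrite -mulrBr -cintegralB//; last exact: (lbd_lint (lbd_ce w)).
rewrite cmodM expr2 -mulrA ler_wpM2l ?cmod_ge0//.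
rewrite [leRHS](_ : _ = cmod w * y * \int[leb]_(s in `[0, y]) 1); last first.
  by rewrite primitive_id//; ring.
rewrite -RintegralZl//; last by apply: integrable_cst_itv; exact: leb_itv_lty.
apply: cmod_cintegral_le => //.
- by apply: cmeasB; [exact: (lbd_ce w y).1|exact: cmeas_cst].
- apply: integrable_cst_itv; exact: leb_itv_lty.
- move=> s /=; rewrite in_itv/= => /andP[s0 sy].
  by rewrite cmodB (le_trans (cmod_oneB_ce w0 s0))// mulr1 ler_wpM2l ?cmod_ge0.
Qed.

Lemma expRN_mul_le (y : R) : expR (- y) * y <= 1 - expR (- y).
Proof.
rewrite lerBrDr -[X in _ + X]mulr1 -mulrDr -ler_pdivlMl ?expR_gt0// -expRN opprK mulr1.
by rewrite addrC expR_ge1Dx.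
Qed.

(** Since [(1 + u / 2) ^+ 2 <= expR u], one has [4 * (expR u - 1) >= u ^+ 2 + 4 * u]. With [u = k y]
    this trades a second-order remainder in [y] for the integrand of [phi k] divided by [k ^+ 2]. *)
Lemma expRN_sqr_le (u : R) : 0 <= u -> expR (- u) * u ^+ 2 <= 4 * (1 - expR (- u)).
Proof.
move=> u0; rewrite expRN -ler_pdivlMl ?invr_gt0 ?expR_gt0// invrK mulrCA.
rewrite mulrBr mulr1 divff ?gt_eqF ?expR_gt0//.
have h : (1 + u / 2) ^+ 2 <= expR u.
  rewrite (_ : expR u = expR (u / 2) ^+ 2); last by rewrite expr2 -expRD -splitr.
  by rewrite lerXn2r ?nnegrE ?expR_ge0 ?expR_ge1Dx// addr_ge0// divr_ge0.
rewrite (@le_trans _ _ (4 * ((1 + u / 2) ^+ 2 - 1)))//; last first.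
  by rewrite ler_wpM2l// lerD2r.
rewrite -subr_ge0 (_ : _ - _ = 4 * u); last by field.
by rewrite mulr_ge0.
Qed.

(** All that the proof draws from the integral representation: real, nonnegative, nondecreasing and
    concave values on the integers, positivity of the real part, and a first- and a second-order
    estimate of [phi (z + k) - phi k]. *)
Lemma bernstein_facts :
  [/\ forall k, phi k%:R = (pr k)%:C, forall k, 0 <= pr k, forall k, pr k <= pr k.+1,
      forall k, pr k.+2 - pr k.+1 <= pr k.+1 - pr k &
  [/\ forall w, 0 <= Re w -> Re (phi 0) <= Re (phi w),
      forall w k, 0 <= Re w ->
        cmod (phi (w + k.+1%:R) - phi k.+1%:R) <= cmod w * (pr k.+1 - pr k) &
      forall z k, 0 <= Re z -> (0 < k)%N ->
        cmod (phi (z + k%:R) - phi k%:R - z * (phi k.+1%:R - phi k%:R)) <=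
        4 * (cmod z ^+ 2 + cmod z) * pr k / k%:R ^+ 2]].
Proof.
have [d [Pi [phi00 d0 Pioo E]]] := hphi.
pose D := `[0%R, +oo[%classic : set R.
have mD : measurable (D : set R) by exact: measurable_itv.
pose h (w : R[i]) (y : R) : R[i] := 1 - ce w y.
have D0 (y : R) : D y -> 0 <= y by rewrite /D/= in_itv/= andbT.
have imin : Pi.-integrable D (EFin \o (fun y => Num.min y 1)).
  apply/integrableP; split.
    by apply/measurable_EFinP; apply: measurable_minr => //; exact: measurable_id.
  apply: le_lt_trans Pioo; apply: ge0_le_integral => //=.
  - by apply/measurable_EFinP; apply: measurableT_comp => //; apply: measurable_minr.
  - by apply/measurable_EFinP; apply: measurable_minr.
  - by move=> y /D0 y0; rewrite lee_fin ger0_norm// le_min y0 ler01.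
have mce w : cmeas (D : set R) (ce w).
  apply: cmeas_cexp => //; apply: cmeasN; apply: cmeasM; first exact: cmeas_cst.
  by apply: cmeas_real; exact: measurable_id.
have ih w : 0 <= Re w -> cintble Pi D (h w).
  move=> w0; apply: (cintble_dom mD _ (integrableZl mD (cmod w + 2) imin)).
    by apply: cmeasB => //; exact: cmeas_cst.
  move=> y /D0 y0; rewrite /h; have h1 := cmod_oneB_ce w0 y0; have h2 := cmod_oneB_ce2 w0 y0.
  have c0 := cmod_ge0 w; rewrite minEle; case: ifPn => y1.
    by rewrite (le_trans h1)// ler_wpM2r// lerDl.
  by rewrite mulr1 (le_trans h2)// lerDr.
have phiE w : 0 <= Re w -> phi w = phi 0 + d%:C * w + cintegral Pi D (h w) by exact: E.
have n0 k : 0 <= Re (k%:R : R[i]) by rewrite Re_nat.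
pose e (k : nat) (y : R) := expR (- (k%:R * y)).
have hk k y : h k%:R y = (1 - e k y)%:C by rewrite /h ce_nat rmorphB.
have ie k : Pi.-integrable D (EFin \o (fun y => 1 - e k y)).
  apply: eq_integrable (ih k%:R (n0 k)).1 => // y _.
  by rewrite hk.
have p0E : phi 0 = (Re (phi 0))%:C.
  by apply: complex_ext => //=; exact: ger0_Im.
have p00 : 0 <= Re (phi 0) by rewrite p0E ler0c in phi00.
have phik k : phi k%:R = (Re (phi 0) + d * k%:R + \int[Pi]_(y in D) (1 - e k y))%:C.
  rewrite phiE// (@eq_cintegral _ _ _ Pi D (h k%:R) (fun y => (1 - e k y)%:C)); last by move=> y _; rewrite hk.
  by rewrite cintegral_real natC !rmorphD/= rmorphM/= -p0E.
have prk k : pr k = Re (phi 0) + d * k%:R + \int[Pi]_(y in D) (1 - e k y) by rewrite phik.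
have dpr k : pr k.+1 - pr k = d + \int[Pi]_(y in D) (e k y - e k.+1 y).
  transitivity (d + \int[Pi]_(y in D) ((1 - e k.+1 y) - (1 - e k y))).
    rewrite (prk k) (prk k.+1) (RintegralB mD (ie k.+1) (ie k)) mulrSr.
    by move: (\int[Pi]_(_ in D) _) (\int[Pi]_(_ in D) _) => I J; ring.
  by congr (_ + _); apply: eq_Rintegral => y _; ring.
have ide k : Pi.-integrable D (EFin \o (fun y => e k y - e k.+1 y)).
  apply: eq_integrable (integrableB mD (ie k.+1) (ie k)) => // y _ /=.
  by rewrite -EFinB; congr EFin; ring.
have eS k y : e k.+1 y = e k y * expR (- y).
  by rewrite /e -expRD -natr1; congr expR; ring.
have ePos k y : 0 < e k y by exact: expR_gt0.
have eGe k y : 0 <= e k y by exact: expR_ge0.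
have e1 (y : R) : 0 <= y -> expR (- y) <= 1 by move=> y0; rewrite -expR0 ler_expR oppr_le0.
split.
- by move=> k; rewrite phik.
- move=> k; rewrite prk !addr_ge0// ?mulr_ge0//; apply: Rintegral_ge0 => y /D0 y0.
  by rewrite subr_ge0 /e -expR0 ler_expR oppr_le0 mulr_ge0.
- move=> k; rewrite -subr_ge0 dpr addr_ge0//; apply: Rintegral_ge0 => y /D0 y0.
  by rewrite eS subr_ge0 ler_piMr// e1.
- move=> k; rewrite !dpr lerD2l; apply: le_Rintegral => //.
  move=> y /D0 y0; rewrite [e k.+2 y]eS [in leLHS](eS k) [leRHS](_ : _ = e k y * (1 - expR (- y))); last by rewrite eS; ring.
  rewrite (_ : _ - _ = e k y * (1 - expR (- y)) * expR (- y)); last by ring.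
  by rewrite ler_piMr ?e1// mulr_ge0// subr_ge0 e1.
split.
- move=> w w0; rewrite (phiE w w0) ReD ReD ReMc -addrA lerDl addr_ge0 ?mulr_ge0//.
  apply: Rintegral_ge0 => y /D0 y0; rewrite /h ReD ReN (_ : Re 1 = 1)// subr_ge0.
  rewrite (le_trans (ler_norm _))// (le_trans (Re_le_cmod _))// cmod_ce -expR0.
  by rewrite ler_expR oppr_le0 mulr_ge0.
- move=> w k w0.
  have wk : 0 <= Re (w + k.+1%:R) by rewrite ReD addr_ge0.
  rewrite dpr mulrDr (phiE _ wk) (phiE k.+1%:R)//.
  rewrite (_ : _ - _ = d%:C * w + (cintegral Pi D (h (w + k.+1%:R)) - cintegral Pi D (h k.+1%:R))); last by ring.
  rewrite -cintegralB; [|by []|exact: ih|exact: ih].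
  rewrite (le_trans (cmodD _ _))// lerD//.
    by rewrite cmodM cmodC ger0_norm// mulrC.
  rewrite -RintegralZl//.
  apply: cmod_cintegral_le => //.
  + apply: cmeasB; exact: cintble_cmeas (ih _ _).
  + exact: (integrableZl mD _ (ide k)).
  (* One factor [exp (- y)] of [exp (- (k + 1) y)] is spent on [y exp (- y) <= 1 - exp (- y)]. This
     is why the bound is the increment of [phi] that ends at [k + 1]. *)
  + move=> y /D0 y0; rewrite (_ : _ - _ = ce k.+1%:R y * (1 - ce w y)); last first.
      by rewrite /h ceD; ring.
    rewrite cmodM cmod_ce Re_nat -/(e k.+1 y) eS.
    rewrite (le_trans (ler_wpM2l _ (cmod_oneB_ce w0 y0)))//; first by rewrite mulr_ge0 ?expR_ge0.
    rewrite [leLHS](_ : _ = cmod w * e k y * (expR (- y) * y)); last by ring.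
    rewrite [leRHS](_ : _ = cmod w * e k y * (1 - expR (- y))); last by ring.
    by rewrite ler_wpM2l ?expRN_mul_le// mulr_ge0 ?cmod_ge0.
- move=> z k z0 k0.
  have zk : 0 <= Re (z + k%:R) by rewrite ReD addr_ge0.
  have kn : 0 < k%:R :> R by rewrite ltr0n.
  pose C := 4 * (cmod z ^+ 2 + cmod z) / k%:R ^+ 2.
  have C0 : 0 <= C by rewrite /C divr_ge0// mulr_ge0// addr_ge0// ?exprn_ge0// cmod_ge0.
  rewrite (_ : 4 * _ * _ / _ = C * pr k); last by rewrite /C; ring.
  apply: (@le_trans _ _ (C * \int[Pi]_(y in D) (1 - e k y))); last first.
    by rewrite ler_wpM2l// prk lerDr addr_ge0// mulr_ge0.
  rewrite (phiE _ zk) (phiE k%:R)// (phiE k.+1%:R)//.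
  rewrite (_ : _ - _ = (cintegral Pi D (h (z + k%:R)) - cintegral Pi D (h k%:R)) -
    z * (cintegral Pi D (h k.+1%:R) - cintegral Pi D (h k%:R))); last by rewrite -natr1; ring.
  have i1 := ih _ zk; have i2 := ih _ (n0 k); have i3 := ih _ (n0 k.+1).
  have i12 := cintbleB mD i1 i2; have i32 := cintbleB mD i3 i2.
  rewrite -(cintegralB mD i1 i2) -(cintegralB mD i3 i2) -(cintegralZ mD z i32).
  rewrite -(cintegralB mD i12 (cintbleZ mD z i32)).
  rewrite -RintegralZl//.
  apply: cmod_cintegral_le => //.
  + exact: cintble_cmeas (cintbleB mD i12 (cintbleZ mD z i32)).
  + exact: (integrableZl mD _ (ie k)).
  + move=> y /D0 y0.
    (* The terms linear in [y] cancel between the two differences, so each of them may be replaced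
       by its second-order Taylor remainder. *)
    rewrite (_ : _ - _ = ce k%:R y * ((1 - ce z y - z * y%:C) - z * (1 - ce 1 y - 1 * y%:C))); last first.
      by rewrite /h -natr1 !ceD; ring.
    rewrite cmodM cmod_ce Re_nat -/(e k y).
    have t1 := cmod_ce_taylor2 z0 y0.
    have t2 : cmod (1 - ce 1 y - 1 * y%:C) <= y ^+ 2.
      by have := @cmod_ce_taylor2 1 y ler01 y0; rewrite cmod1 expr1n [leRHS]mul1r.
    have t3 : cmod ((1 - ce z y - z * y%:C) - z * (1 - ce 1 y - 1 * y%:C)) <= (cmod z ^+ 2 + cmod z) * y ^+ 2.
      rewrite (le_trans (cmodD _ _))// mulrDl lerD// cmodN cmodM ler_wpM2l ?cmod_ge0//.
    rewrite (le_trans (ler_wpM2l (eGe k y) t3))//.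
    have ky : 0 <= k%:R * y by rewrite mulr_ge0.
    have := expRN_sqr_le ky; rewrite -/(e k y) exprMn => t4.
    rewrite [leLHS](_ : _ = (cmod z ^+ 2 + cmod z) / k%:R ^+ 2 * (e k y * (k%:R ^+ 2 * y ^+ 2))); last first.
      by field; rewrite gt_eqF.
    rewrite [leRHS](_ : _ = (cmod z ^+ 2 + cmod z) / k%:R ^+ 2 * (4 * (1 - e k y))); last first.
      by rewrite /C; ring.
    by rewrite ler_wpM2l// divr_ge0// addr_ge0// ?exprn_ge0// cmod_ge0.
Qed.
End bernstein_function.

(** * Absolutely convergent complex series and their convolution *)

Section complex_series.
Context {R : realType}.

Lemma cmod_cvg (u : nat -> R[i]) (l : R[i]) :
  cmod (u n - l) @[n --> \oo] --> (0 : R) -> ((u : nat -> R[i]^o) @ \oo --> (l : R[i]^o)).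
Proof.
move=> ul; apply/cvgrPdist_le => e e0.
have eE : e = (Re e)%:C by apply: complex_ext => //=; exact: ger0_Im (ltW e0).
have re0 : 0 < Re e by move: e0; rewrite eE ltcR.
move/cvgrPdist_le : ul => /(_ _ re0); apply: filterS => n.
rewrite sub0r normrN ger0_norm ?cmod_ge0// => h.
by rewrite distrC normc_def -cmodE eE lecR.
Qed.

Lemma cmod_lim (u : nat -> R[i]) (l : R[i]) :
  cmod (u n - l) @[n --> \oo] --> (0 : R) -> limn (u : nat -> R[i]^o) = l.
Proof. by move=> /cmod_cvg ul; exact: (cvg_lim (@norm_hausdorff _ _) ul). Qed.

Definition csum (x : nat -> R[i]) : R[i] :=
  limn (fun n => (\sum_(0 <= m < n) x m) : R[i]^o).

Lemma csum_cvg (x : nat -> R[i]) (y : nat -> R) : (forall m, cmod (x m) <= y m) ->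
  cvgn (series y) -> cmod (\sum_(0 <= m < n) x m - csum x) @[n --> \oo] --> (0 : R).
Proof.
move=> xy cy.
have key (h : R[i] -> R) : (forall a, `|h a| <= cmod a) -> cvgn (series (h \o x)).
  move=> hx; apply: normed_cvg; apply: series_le_cvg cy => //= n.
  - by apply: le_trans (xy n); exact: cmod_ge0.
  - by rewrite (le_trans (hx _)).
have /cvg_ex[/= lr cr] := key _ (@Re_le_cmod R).
have /cvg_ex[/= li ci] := key _ (@Im_le_cmod R).
have ReS n : Re (\sum_(0 <= m < n) x m) = series ((@complex.Re R) \o x) n.
  by rewrite /series/=; elim/big_ind2: _ => // a b a' b' <- <-; rewrite ReD.
have ImS n : Im (\sum_(0 <= m < n) x m) = series ((@complex.Im R) \o x) n.
  by rewrite /series/=; elim/big_ind2: _ => // a b a' b' <- <-; rewrite ImD.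
have H : cmod (\sum_(0 <= m < n) x m - (lr +i* li)) @[n --> \oo] --> (0 : R).
  apply: (@squeeze_cvgr _ _ _ _ (cst 0) (fun n =>
    `|series ((@complex.Re R) \o x) n - lr| + `|series ((@complex.Im R) \o x) n - li|)).
  - apply: nearW => n; rewrite cmod_ge0/=.
    by rewrite (le_trans (cmod_le_ReIm _))// ReD ImD ReN ImN ReS ImS.
  - exact: cvg_cst.
  - rewrite -[X in _ --> X](addr0 0).
    apply: cvgD; rewrite -(@normr0 _ R^o); apply: cvg_norm.
    + by apply/subr_cvg0.
    + by apply/subr_cvg0.
by rewrite /csum (cmod_lim H).
Qed.

Lemma cmod_csum_le (x : nat -> R[i]) (y : nat -> R) : (forall m, cmod (x m) <= y m) ->
  cvgn (series y) -> cmod (csum x) <= limn (series y).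
Proof.
move=> xy cy; have h := csum_cvg xy cy.
apply/ler_addgt0Pr => e e0.
move/cvgrPdist_le : h => /(_ _ e0)[n _ /(_ _ (leqnn n))/=].
rewrite sub0r normrN ger0_norm ?cmod_ge0// => h.
rewrite -[csum x](subKr (\sum_(0 <= m < n) x m)).
rewrite (le_trans (cmodD _ _))// cmodN lerD//.
rewrite (le_trans (cmod_sum _ _ _))//.
apply: (@le_trans _ _ (series y n)); first exact: ler_sum.
apply: nondecreasing_cvgn_le => //.
by apply: nondecreasing_series => m _ _; apply: le_trans (xy m); exact: cmod_ge0.
Qed.

Lemma cmeas_csum (D : set (measurableTypeR R)) (x : nat -> R -> R[i]) (y : R -> nat -> R) :
  measurable D ->
  (forall m, cmeas D (x m)) -> (forall s m, D s -> cmod (x m s) <= y s m) ->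
  (forall s, D s -> cvgn (series (y s))) -> cmeas D (fun s => csum (x ^~ s)).
Proof.
move=> mD mx xy cy.
have key (h : R[i] -> R) : (forall a b, `|h a - h b| <= cmod (a - b)) ->
    (forall n, measurable_fun D (fun s => h (\sum_(0 <= m < n) x m s))) ->
    measurable_fun D (fun s => h (csum (x ^~ s))).
  move=> hh mh; apply: (measurable_fun_cvg mh) => s Ds.
  apply/cvgrPdist_le => e e0.
  have /cvgrPdist_le /(_ _ e0) := csum_cvg (fun m => xy s m Ds) (cy s Ds).
  apply: filterS => n; rewrite sub0r normrN ger0_norm ?cmod_ge0// => h1.
  by rewrite distrC (le_trans (hh _ _)).
split; apply: key => [a b|n].
- by rewrite -ReN -ReD Re_le_cmod.
- by have [] := @cmeas_sum _ _ _ D _ (index_iota 0 n) x mx.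
- by rewrite -ImN -ImD Im_le_cmod.
- by have [] := @cmeas_sum _ _ _ D _ (index_iota 0 n) x mx.
Qed.

Lemma lbd_sum (x : nat -> R -> R[i]) n : (forall m, lbd (x m)) ->
  lbd (fun s => \sum_(0 <= m < n) x m s).
Proof.
move=> hx; elim: n => [|n IH].
  by rewrite (_ : (fun s => _) = fun=> 0); [exact: lbd_cst|apply/funext => s; rewrite big_geq].
rewrite (_ : (fun s => _) = fun s => \sum_(0 <= m < n) x m s + x n s); first exact: lbdD.
by apply/funext => s; rewrite big_nat_recr.
Qed.

Lemma conv_sum u (x : nat -> R -> R[i]) n t : lint u -> (forall m, lbd (x m)) ->
  conv u (fun s => \sum_(0 <= m < n) x m s) t = \sum_(0 <= m < n) conv u (x m) t.
Proof.
move=> hu hx; elim: n => [|n IH].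
  rewrite big_geq// (_ : (fun s => _) = fun s => 0 * (fun=> 0) s); last first.
    by apply/funext => s; rewrite big_geq// mul0r.
  by rewrite convZr ?mul0r//; exact: lbd_cst.
rewrite big_nat_recr//= -IH -convDr//; last exact: lbd_sum.
by apply: eq_conv => // s _; rewrite big_nat_recr.
Qed.

(** Dominated convergence with majorant [C * cmod (u s)]: the partial sums are bounded by [C]
    uniformly on [0, t]. *)
Lemma conv_csum (u : R -> R[i]) (x : nat -> R -> R[i]) (y : R -> nat -> R) (C t : R) :
  lint u -> (forall m, lbd (x m)) ->
  (forall s m, 0 <= s -> cmod (x m s) <= y s m) ->
  (forall s, 0 <= s -> cvgn (series (y s))) ->
  (forall s, 0 <= s <= t -> limn (series (y s)) <= C) ->
  cmod (\sum_(0 <= m < n) conv u (x m) t - conv u (fun s => csum (x ^~ s)) t)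
    @[n --> \oo] --> (0 : R).
Proof.
move=> hu hx xy cy yC.
have E n : cmod (\sum_(0 <= m < n) conv u (x m) t - conv u (fun s => csum (x ^~ s)) t) =
  cmod (conv u (fun s => \sum_(0 <= m < n) x m s) t - conv u (fun s => csum (x ^~ s)) t).
  by rewrite conv_sum.
rewrite (funext E) {E}.
have tI s : `[0, t]%classic s -> 0 <= s <= t /\ 0 <= t - s <= t.
  by rewrite /= in_itv/= => /andP[s0 st]; split; [rewrite s0|lra].
have mC (D : set R) : measurable D -> measurable_fun (D : set (measurableTypeR R)) (fun s => t - s).
  by move=> mD; apply: measurable_funB => //; exact: measurable_cst.
have mx m : cmeas (`[0, t] : set (measurableTypeR R)) (fun s => x m (t - s)).
  have := cmeas_crB (hx m t).1 (mC _ measurableT).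
  move=> /(cmeasS measurableT (@subsetT _ `[0, t])).
  by apply: eq_cmeas => s /tI[_ st]; rewrite /cres mem_setE in_itv/= st.
pose U n (s : measurableTypeR R) : R[i] := u s * \sum_(0 <= m < n) x m (t - s).
pose V (s : measurableTypeR R) : R[i] := u s * csum (x ^~ (t - s)).
pose g (s : measurableTypeR R) : R := C * cmod (u s).
suff H : cmod (cintegral (@lebesgue_measure R) `[0, t] (U n) -
  cintegral (@lebesgue_measure R) `[0, t] V) @[n --> \oo] --> (0 : R) by exact: H.
apply: (@cintegral_dct _ _ _ (@lebesgue_measure R) `[0, t]%classic (measurable_itvR _) U V g).
- by move=> n; apply: cmeasM; [exact: cintble_cmeas (hu t)|exact: cmeas_sum].
- apply: cmeasM; first exact: cintble_cmeas (hu t).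
  apply: (@cmeas_csum _ (fun m s => x m (t - s)) (fun s => y (t - s))) => //.
  + by move=> s m /tI[_ /andP[st _]]; exact: xy.
  + by move=> s /tI[_ /andP[st _]]; exact: cy.
- move=> s /tI[_ /andP[st _]].
  have h := csum_cvg (fun m => xy (t - s) m st) (cy _ st).
  have E n : cmod (u s * \sum_(0 <= m < n) x m (t - s) - u s * csum (x ^~ (t - s))) =
      cmod (u s) * cmod (\sum_(0 <= m < n) x m (t - s) - csum (x ^~ (t - s))).
    by rewrite -mulrBr cmodM.
  by rewrite (funext E) -[X in _ --> X](mulr0 (cmod (u s))); exact: cvgMr.
- exact: (integrableZl (measurable_itvR _) C (integrable_cmod (measurable_itvR _) (hu t))).
- move=> n s /tI[_ st]; rewrite cmodM mulrC ler_wpM2r ?cmod_ge0//.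
  have /andP[st0 _] := st.
  rewrite (le_trans (cmod_sum _ _ _))// (le_trans _ (yC _ st))//.
  apply: (@le_trans _ _ (series (y (t - s)) n)); first by apply: ler_sum => m _; exact: xy.
  apply: nondecreasing_cvgn_le; last exact: cy.
  by apply: nondecreasing_series => m _ _; apply: le_trans (xy _ m st0); exact: cmod_ge0.
Qed.
End complex_series.

(** * The brackets *)

Section confluent_hypergeometric.
Context {R : realType}.
Notation leb := (@lebesgue_measure R).

Definition kcoef (z : R[i]) (D : R) (m : nat) : R[i] :=
  rising z m * (- D%:C) ^+ m / (m`!%:R) ^+ 2.

(** The derivative in [t] of [kummerB z D], with the index shifted so that the series starts at
    0. *)
Definition kummerA (z : R[i]) (D t : R) : R[i] :=
  csum (fun m => kcoef z D m.+1 * (m.+1%:R * t%:C ^+ m)).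

(** Kummer's confluent hypergeometric function [1F1(z; 1; - D t)]. *)
Definition kummerB (z : R[i]) (D t : R) : R[i] :=
  csum (fun m => kcoef z D m * t%:C ^+ m).

Lemma cmod_limit_unique (u : nat -> R[i]) (a b : R[i]) :
  cmod (u n - a) @[n --> \oo] --> (0 : R) -> cmod (u n - b) @[n --> \oo] --> (0 : R) -> a = b.
Proof. by move=> /cmod_lim <- /cmod_lim <-. Qed.

Lemma csum_recl (x : nat -> R[i]) (y : nat -> R) : (forall m, cmod (x m) <= y m) ->
  cvgn (series y) -> csum x = x 0%N + csum (fun m => x m.+1).
Proof.
move=> xy cy.
have cy' : cvgn (series (fun m => y m.+1)).
  have /cvg_ex[l /= yl] := cy.
  apply/cvg_ex; exists (l - y 0%N) => /=.
  have -> : series (fun m => y m.+1) = (fun n => series y n.+1 - y 0%N).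
    by apply/funext => n; rewrite /series/= big_nat_recl// addrC addKr.
  by apply: cvgB; [rewrite cvg_shiftS|exact: cvg_cst].
have h := csum_cvg (fun m => xy m.+1) cy'.
have h' := csum_cvg xy cy; rewrite -(cvg_shiftS (fun n => cmod (\sum_(0 <= m < n) x m - csum x))) in h'.
apply: (cmod_limit_unique h').
have E n : cmod (\sum_(0 <= m < n.+1) x m - (x 0%N + csum (fun m => x m.+1))) =
    cmod (\sum_(0 <= m < n) x m.+1 - csum (fun m => x m.+1)).
  by rewrite big_nat_recl//; congr cmod; ring.
by rewrite (funext E).
Qed.

Lemma exp_tail (x : R) : cvgn (series (fun m => exp_coeff x m.+1)) /\
  limn (series (fun m => exp_coeff x m.+1)) = expR x - 1.
Proof.
have H : series (fun m => exp_coeff x m.+1) @ \oo --> expR x - 1.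
  have -> : series (fun m => exp_coeff x m.+1) = (fun n => series (exp_coeff x) n.+1 - 1).
    apply/funext => n; rewrite /series/= big_nat_recl// addrC.
    by rewrite /exp_coeff/= expr0 fact0 divr1 addKr.
  apply: cvgB; last exact: cvg_cst.
  by rewrite (cvg_shiftS (series (exp_coeff x))) ; exact: is_cvg_series_exp_coeff.
split; first by apply/cvg_ex; exists (expR x - 1).
exact: (cvg_lim (@norm_hausdorff _ _) H).
Qed.

Lemma cvg_exp_series (x : R) : cvgn (series (exp_coeff x)).
Proof. exact: is_cvg_series_exp_coeff. Qed.

Lemma risingS (z : R[i]) m : rising z m.+1 = rising z m * (z + m%:R).
Proof. by rewrite /rising big_ord_recr. Qed.

Lemma rising0 (z : R[i]) : rising z 0 = 1.
Proof. by rewrite /rising big_ord0. Qed.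

Lemma rising_neq0 (z : R[i]) m : 0 < Re z -> rising z m != 0.
Proof.
move=> z0; elim: m => [|m IH]; first by rewrite rising0 oner_neq0.
rewrite risingS mulf_neq0//; apply: contraTneq z0 => h.
have := congr1 (@complex.Re R) h; rewrite ReD Re_nat => h'.
by rewrite -leNgt -(addrK m%:R (Re z)) h' sub0r oppr_le0.
Qed.

Lemma factC_neq0 m : (m`!%:R : R[i]) != 0.
Proof. by rewrite pnatr_eq0 -lt0n fact_gt0. Qed.

(** Since [cmod (z + m) <= (1 + cmod z) * m.+1], the rising factorial is at most [m!] times a
    geometric factor and cancels one of the two factorials. An exponential series of rate
    [b = (1 + cmod z) * D] dominates everything that follows. *)
Lemma cmod_kcoef (z : R[i]) (D : R) m : 0 <= D ->
  cmod (kcoef z D m) <= exp_coeff ((1 + cmod z) * D) m.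
Proof.
move=> D0.
have hr : cmod (rising z m) <= (1 + cmod z) ^+ m * m`!%:R.
  elim: m => [|m IH]; first by rewrite rising0 cmod1 expr0 mul1r.
  rewrite risingS cmodM exprSr factS natrM [_.+1%:R * _]mulrC mulrACA.
  rewrite ler_pM ?cmod_ge0// (le_trans (cmodD _ _))// cmod_nat.
  by rewrite mulrDl mul1r -natr1 mulrDr mulr1; have := cmod_ge0 z; have := ler0n R m; nra.
rewrite /kcoef !cmodM cmodV !cmodX cmod_nat cmodN cmodC ger0_norm// /exp_coeff/=.
have f0 : 0 < m`!%:R :> R by rewrite ltr0n fact_gt0.
rewrite ler_pdivrMr ?exprn_gt0// exprMn expr2.
rewrite [leRHS](_ : _ = (1 + cmod z) ^+ m * m`!%:R * D ^+ m).
  by rewrite ler_wpM2r// exprn_ge0.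
by field; rewrite gt_eqF.
Qed.

Variables (z : R[i]) (D : R).
Hypotheses (z0 : 0 < Re z) (D0 : 0 <= D).
Let b := (1 + cmod z) * D.
Let b0 : 0 <= b. Proof. by rewrite mulr_ge0// addr_ge0 ?cmod_ge0. Qed.

Lemma kummerA_dom (t : R) m : 0 <= t ->
  cmod (kcoef z D m.+1 * (m.+1%:R * t%:C ^+ m)) <= b * exp_coeff (b * t) m.
Proof.
move=> t0; rewrite cmodM [cmod (_.+1%:R * _)]cmodM cmod_nat cmodX cmodC ger0_norm//.
rewrite (le_trans (ler_wpM2r _ (cmod_kcoef z m.+1 D0)))// ?mulr_ge0 ?exprn_ge0//.
rewrite -/b /exp_coeff/= factS natrM exprS [(b * t) ^+ m]exprMn le_eqVlt; apply/orP; left; apply/eqP.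
have : (m`!%:R : R) != 0 by rewrite gt_eqF// ltr0n fact_gt0.
have : (m.+1%:R : R) != 0 by rewrite gt_eqF.
move: (m`!%:R : R) (m.+1%:R : R) (b ^+ m) (t ^+ m) b => f n bm tm c h1 h2.
by field; rewrite h1 h2.
Qed.

Lemma kummerB_dom (t : R) m : 0 <= t ->
  cmod (kcoef z D m * t%:C ^+ m) <= exp_coeff (b * t) m.
Proof.
move=> t0; rewrite cmodM cmodX cmodC ger0_norm//.
rewrite (le_trans (ler_wpM2r _ (cmod_kcoef z m D0)))// ?exprn_ge0//.
by rewrite -/b /exp_coeff/= [(b * t) ^+ m]exprMn mulrAC.
Qed.

Lemma kummerA_dom_cvg (t : R) :
  series (fun m => b * exp_coeff (b * t) m) @ \oo --> b * expR (b * t).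
Proof.
have -> : series (fun m => b * exp_coeff (b * t) m) = (fun n => b * series (exp_coeff (b * t)) n).
  by apply/funext => n; rewrite /series/= mulr_sumr.
by apply: cvgMr; exact: (@cvg_exp_series (b * t)).
Qed.

Lemma cvg_kummerA_dom (t : R) : cvgn (series (fun m => b * exp_coeff (b * t) m)).
Proof. by apply/cvg_ex; eexists; exact: kummerA_dom_cvg. Qed.

Lemma lim_kummerA_dom (t : R) : limn (series (fun m => b * exp_coeff (b * t) m)) = b * expR (b * t).
Proof. exact: (cvg_lim (@norm_hausdorff _ _) (@kummerA_dom_cvg t)). Qed.

Lemma lbd_pow m : lbd (fun s : R => s%:C ^+ m).
Proof.
move=> T; split.
  have -> : (fun s : R => s%:C ^+ m) = (fun s => (s ^+ m)%:C).
    by apply/funext => s; rewrite rmorphXn.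
  by apply: cmeas_real; apply: measurable_funX; exact: measurable_id.
exists (T ^+ m) => s /andP[s0 sT]; rewrite cmodX cmodC ger0_norm//.
by rewrite lerXn2r// nnegrE// (le_trans s0).
Qed.

Lemma lbd_kummerA : lbd (kummerA z D).
Proof.
move=> T; split.
- apply: (@cmeas_csum _ _ (fun m s => kcoef z D m.+1 * (m.+1%:R * s%:C ^+ m))
    (fun t m => b * exp_coeff (b * t) m)) => //.
  + by move=> m; exact: (lbdZ _ (lbdZ _ (lbd_pow m)) T).1.
  + by move=> s m; rewrite /= in_itv/= => /andP[s0 _]; exact: kummerA_dom.
  + by move=> s _; exact: (@cvg_kummerA_dom s).
- exists (b * expR (b * T)) => s /andP[s0 sT].
  rewrite (le_trans (cmod_csum_le (fun m => kummerA_dom m s0) (@cvg_kummerA_dom s)))//.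
  by rewrite lim_kummerA_dom ler_wpM2l// ler_expR ler_wpM2l.
Qed.

Lemma lbd_kummerB : lbd (kummerB z D).
Proof.
move=> T; split.
- apply: (@cmeas_csum _ _ (fun m s => kcoef z D m * s%:C ^+ m)
    (fun t m => exp_coeff (b * t) m)) => //.
  + by move=> m; exact: (lbdZ _ (lbd_pow m) T).1.
  + by move=> s m; rewrite /= in_itv/= => /andP[s0 _]; exact: kummerB_dom.
  + by move=> s _; exact: (@cvg_exp_series (b * s)).
- exists (expR (b * T)) => s /andP[s0 sT].
  rewrite (le_trans (cmod_csum_le (fun m => kummerB_dom m s0) (@cvg_exp_series _)))//.
  by rewrite -/(expR _) ler_expR ler_wpM2l.
Qed.

(** The power rule for primitives is specialised to [f = 1], whose primitive at [s] is [s], to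
    integrate plain powers. *)
Let one01 (s : R) : (0 : R) <= (fun=> 1) s <= (1 : R). Proof. by rewrite ler01 lexx. Qed.
Let mone : measurable_fun (setT : set (measurableTypeR R)) (fun=> (1 : R)).
Proof. exact: measurable_cst. Qed.
Let prim0 (s : R) : 0 < s -> 0 < \int[leb]_(r in `[0, s]) 1.
Proof. by move=> s0; rewrite primitive_id// ltW. Qed.

Lemma lint_cpow (w : R[i]) : 0 < Re w -> lint (fun s => cpow s (w - 1)).
Proof.
move=> w0 T; have [T0|T0] := ltP T 0.
  rewrite set_itv_ge ?bnd_simp -?ltNge//; split; exact: integrable_set0.
have := cintble_power mone one01 prim0 w0 T0.
apply: (eq_cintble (measurable_itvR _)) => s /=; rewrite in_itv/= => /andP[s0 _].
by rewrite primitive_id// mulr1.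
Qed.

Lemma integrable_powR (x t : R) : 0 < x -> 0 <= t ->
  leb.-integrable `[0, t] (EFin \o (fun s => s `^ (x - 1))) /\
  \int[leb]_(s in `[0, t]) s `^ (x - 1) = t `^ x / x.
Proof.
move=> x0 t0; have i := integrable_power mone one01 prim0 x0 t0.
have e := Rintegral_power_itv mone one01 prim0 x0 t0.
rewrite primitive_id// in e; rewrite -e; split.
  apply: eq_integrable i; first exact: measurable_itvR.
  by move=> s; rewrite inE/= in_itv/= => /andP[s0 _]; rewrite primitive_id// mulr1.
apply: eq_Rintegral => s; rewrite inE/= in_itv/= => /andP[s0 _].
by rewrite primitive_id// mulr1.
Qed.

Lemma conv_cpow1 (w : R[i]) (t : R) : 0 < Re w -> 0 <= t ->
  conv (fun s => cpow s (w - 1)) (fun=> 1) t = cpow t w / w.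
Proof.
move=> w0 t0; have wn0 : w != 0 by apply: contraTneq w0 => ->; rewrite ltxx.
have := cintegral_power mone one01 prim0 w0 t0; rewrite primitive_id// => E.
have -> : conv (fun s => cpow s (w - 1)) (fun=> 1) t =
    cintegral leb `[0, t] (fun r => cpow (\int[leb]_(s in `[0, r]) 1) (w - 1) * 1%:C).
  by apply: eq_cintegral => s /=; rewrite in_itv/= => /andP[s0 _]; rewrite primitive_id.
by apply: (canRL (mulfK wn0)); rewrite -E; exact: mulrC.
Qed.

Lemma cpow_addn (t : R) (w : R[i]) n : 0 < t -> cpow t (w + n%:R) = cpow t w * t%:C ^+ n.
Proof.
move=> t0; elim: n => [|n IH]; first by rewrite addr0 expr0 mulr1.
by rewrite -natr1 addrA cpowD// IH cpow1// exprSr mulrA.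
Qed.

Lemma cpow_nat (t : R) n : 0 <= t -> cpow t n%:R = t%:C ^+ n.
Proof.
rewrite le_eqVlt => /orP[/eqP<-|t0].
  by rewrite /cpow eqxx expr0n pnatr_eq0.
by rewrite -[n%:R]add0r cpow_addn// cpow_z0 ?mul1r// ltW.
Qed.

Lemma conv_pow1 m (t : R) : 0 <= t ->
  conv (fun s : R => s%:C ^+ m) (fun=> 1) t = t%:C ^+ m.+1 / m.+1%:R.
Proof.
move=> t0; rewrite -cpow_nat// -conv_cpow1//; last by rewrite Re_nat.
by apply: eq_conv => // s /andP[s0 _]; rewrite -natr1 addrK cpow_nat.
Qed.

(** The beta integral [B(z, m + 1)] without the gamma function: [s ^ (m + 1)] is [m + 1] times the
    convolution of [s ^ m] with 1, so each step is an integration of a power. *)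
Lemma beta_nat m (t : R) : 0 <= t ->
  conv (fun s => cpow s (z - 1)) (fun s => s%:C ^+ m) t =
  m`!%:R / rising z m.+1 * cpow t (z + m%:R).
Proof.
have lz := lint_cpow z0.
elim: m t => [|m IH] t t0.
  transitivity (conv (fun s => cpow s (z - 1)) (fun=> 1) t).
    by apply: eq_conv => // s _; rewrite expr0.
  rewrite conv_cpow1// addr0 risingS rising0 mul1r addr0 fact0.
  by rewrite mul1r mulrC.
have Rezm : 0 < Re (z + m.+1%:R) by rewrite ReD Re_nat ltr_pwDl.
have m0 : (m.+1%:R : R[i]) != 0 by rewrite pnatr_eq0.
transitivity (m.+1%:R * conv (conv (fun s => cpow s (z - 1)) (fun s => s%:C ^+ m)) (fun=> 1) t).
  rewrite convA//; [|exact: lbd_pow|exact: lbd_cst].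
  rewrite -convZr//; last by apply: lbd_conv; [exact: lbd_lint (lbd_pow m)|exact: lbd_cst].
  by apply: eq_conv => // s /andP[s0 _]; rewrite conv_pow1// mulrC divfK.
transitivity (m.+1%:R * (m`!%:R / rising z m.+1 *
    conv (fun s => cpow s (z + m.+1%:R - 1)) (fun=> 1) t)).
  congr (_ * _); rewrite -convZl; [|exact: lint_cpow|exact: lbd_cst].
  by apply: eq_conv => // s /andP[s0 _]; rewrite IH// -natr1 addrA addrK.
rewrite conv_cpow1// factS natrM (risingS z m.+1).
have zm0 : z + m.+1%:R != 0 by apply: contraTneq Rezm => ->; rewrite ltxx.
have := @rising_neq0 z m.+1 z0; move: zm0; move: (z + m.+1%:R) => w.
move: (rising z m.+1) (m.+1%:R : R[i]) (m`!%:R : R[i]) (cpow t w) => a c e f h1 h2.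
by field; rewrite h1 h2.
Qed.

(** The beta integral cancels the rising factorial and leaves the coefficients of [exp (- D t)].
    Thus the purpose of the first sum of a bracket is to change the exponential rate in front of
    [t ^ (z - 1)]. *)
Lemma kummerA_conv (t : R) : 0 < t ->
  cpow t (z - 1) + conv (fun s => cpow s (z - 1)) (kummerA z D) t =
  cpow t (z - 1) * ce D%:C t.
Proof.
move=> t0; have lz := lint_cpow z0.
suff -> : conv (fun s => cpow s (z - 1)) (kummerA z D) t = cpow t (z - 1) * (ce D%:C t - 1).
  by rewrite mulrBr mulr1 subrKC.
pose x m (s : R) := kcoef z D m.+1 * (m.+1%:R * s%:C ^+ m).
have H := @conv_csum R _ x (fun s m => b * exp_coeff (b * s) m) (b * expR (b * t)) t lz
  (fun m => lbdZ _ (lbdZ _ (lbd_pow m))) (fun s m s0 => kummerA_dom m s0)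
  (fun s _ => @cvg_kummerA_dom s).
apply: (cmod_limit_unique (H _)).
  by move=> s /andP[s0 st]; rewrite lim_kummerA_dom ler_wpM2l// ler_expR ler_wpM2l.
have e m : conv (fun s => cpow s (z - 1)) (x m) t = cpow t (z - 1) * (exp_coeff (- (D * t)) m.+1)%:C.
  rewrite convZr//; last by apply: lbdZ; exact: lbd_pow.
  rewrite convZr//; last exact: lbd_pow.
  rewrite beta_nat ?ltW// (_ : z + m%:R = (z - 1) + m.+1%:R); last by rewrite -natr1; ring.
  rewrite cpow_addn// /kcoef /exp_coeff/= factS.
  rewrite !rmorphM/= rmorphXn/= rmorphN rmorphM/= fmorphV rmorph_nat.
  rewrite -mulNr exprMn natrM.
  have := factC_neq0 m; have := @rising_neq0 z m.+1 z0.
  have : (m.+1%:R : R[i]) != 0 by rewrite pnatr_eq0.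
  move: (rising z m.+1) (m.+1%:R : R[i]) (m`!%:R : R[i]) ((- D%:C) ^+ m.+1) (t%:C ^+ m.+1) => a c e f g.
  by move=> h1 h2 h3; field; rewrite h1 h2 h3.
have E n : cmod (\sum_(0 <= m < n) conv (fun s => cpow s (z - 1)) (x m) t - cpow t (z - 1) * (ce D%:C t - 1)) =
    cmod (cpow t (z - 1)) * `|series (fun m => exp_coeff (- (D * t)) m.+1) n - (expR (- (D * t)) - 1)|.
  under eq_bigr do rewrite e; rewrite -mulr_sumr -mulrBr cmodM -cmodC; congr (_ * cmod _).
  rewrite !rmorphB/= rmorph_sum/=; congr (_ - (_ - _)).
  by rewrite /ce -rmorphM -rmorphN cexpC.
rewrite (funext E) -[X in _ --> X](mulr0 (cmod (cpow t (z - 1)))); apply: cvgMr.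
have [c l] := exp_tail (- (D * t)); rewrite -(@normr0 _ R^o); apply: cvg_norm.
by apply/subr_cvg0; rewrite -l.
Qed.

Lemma kummerAB (t : R) : 0 <= t -> conv (fun=> 1) (kummerA z D) t + 1 = kummerB z D t.
Proof.
move=> t0.
pose x m (s : R) := kcoef z D m.+1 * (m.+1%:R * s%:C ^+ m).
have H := @conv_csum R (fun=> 1) x (fun s m => b * exp_coeff (b * s) m) (b * expR (b * t)) t
  (lbd_lint (lbd_cst 1))
  (fun m => lbdZ _ (lbdZ _ (lbd_pow m))) (fun s m s0 => kummerA_dom m s0)
  (fun s _ => @cvg_kummerA_dom s).
have {}H : cmod (\sum_(0 <= m < n) conv (fun=> 1) (x m) t - conv (fun=> 1) (kummerA z D) t)
    @[n --> \oo] --> (0 : R).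
  by apply: H => s /andP[s0 st]; rewrite lim_kummerA_dom ler_wpM2l// ler_expR ler_wpM2l.
have e m : conv (fun=> 1) (x m) t = kcoef z D m.+1 * t%:C ^+ m.+1.
  have l1 := lbd_lint (lbd_cst (1 : R[i])).
  rewrite convZr//; last by apply: lbdZ; exact: lbd_pow.
  rewrite convZr//; last exact: lbd_pow.
  rewrite convC//; last exact: lbd_pow.
  by rewrite conv_pow1// [_.+1%:R * _]mulrC divfK// pnatr_eq0.
rewrite /kummerB (csum_recl (fun m => kummerB_dom m t0) (@cvg_exp_series _)) addrC.
congr (_ + _).
  by rewrite expr0 mulr1 /kcoef rising0 expr0 fact0 expr1n divr1 mulr1.
apply: (cmod_limit_unique H).
under eq_fun do under eq_bigr do rewrite e.
have [c _] := exp_tail (b * t).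
exact: (csum_cvg (fun m => kummerB_dom m.+1 t0) c).
Qed.
End confluent_hypergeometric.

(** * The truncated convolutions as K_n applied to G_n *)

Section truncated_convolutions.
Context {R : realType}.
Variables (phi : R[i] -> R[i]) (z : R[i]).
Hypotheses (hphi : bernstein phi) (z0 : 0 < Re z).
Notation leb := (@lebesgue_measure R).
Notation pr k := (Re (phi k%:R)).
Notation D k := (pr k.+1 - pr k).
Notation p k := (phi k%:R).
Notation a k := (phi (z + k%:R) - phi k%:R).

Let phiC k : p k = (pr k)%:C. Proof. by have [] := bernstein_facts hphi. Qed.
Let D0 k : 0 <= D k. Proof. by have [_ _ h _ _] := bernstein_facts hphi; rewrite subr_ge0. Qed.
Let DC k : p k.+1 - p k = (D k)%:C. Proof. by rewrite rmorphB/= -!phiC. Qed.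

(** Concavity on the integers together with [phi 0 >= 0]: the last increment is at most the mean of
    all the preceding ones. *)
Lemma bernstein_increment_le k : k.+1%:R * D k <= pr k.+1.
Proof.
have [_ _ _ cv _] := bernstein_facts hphi.
suff H : k%:R * D k <= pr k by rewrite -natr1 mulrDl mul1r; move: H; lra.
have pr0 : 0 <= pr 0 by have [] := bernstein_facts hphi.
elim: k => [|k IH]; first by rewrite mul0r.
rewrite (le_trans (ler_wpM2l _ (cv k)))//.
by rewrite -natr1 mulrDl mul1r; move: IH; lra.
Qed.

Definition kernel k (t : R) : R[i] :=
  ce (p k) t * kummerA z (D k) t + a k * (ce (p k) t * kummerB z (D k) t).

Lemma bracket_densityE k (t : R) : 0 <= t -> bracket_density phi z k t = kernel k t.
Proof.
move=> t0; rewrite /bracket_density DC -cexpN1 -/(ce (p k) t) /kernel; congr (_ + _ * _).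
  have h := csum_cvg (fun m => kummerA_dom z (D0 k) m t0) (@cvg_kummerA_dom _ z (D k) t).
  (* The sum in the bracket starts at [m = 1], so its truncation at [n.+1] has the first [n] terms
     of [kummerA]. *)
  apply: cmod_lim; rewrite -cvg_shiftS.
  have E n : cmod (\sum_(1 <= m < n.+1) rising z m * (- (D k)%:C) ^+ m / m`!%:R ^+ 2 *
        (m%:R * t%:C ^+ m.-1 * ce (p k) t) - ce (p k) t * kummerA z (D k) t) =
      cmod (ce (p k) t) * cmod (\sum_(0 <= m < n) kcoef z (D k) m.+1 * (m.+1%:R * t%:C ^+ m) - kummerA z (D k) t).
    rewrite -cmodM mulrBr mulr_sumr big_add1/=; congr (cmod (_ - _)).
    by apply: eq_bigr => m _; rewrite /kcoef; ring.
  have M : cmod (ce (p k) t) * cmod (\sum_(0 <= m < n) kcoef z (D k) m.+1 * (m.+1%:R * t%:C ^+ m) -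
      kummerA z (D k) t) @[n --> \oo] --> (0 : R).
    by rewrite -[X in _ --> X](mulr0 (cmod (ce (p k) t))); exact: cvgMr.
  by apply: cvg_trans M; apply: near_eq_cvg; apply: nearW => n; rewrite /= E.
have h := csum_cvg (fun m => kummerB_dom z (D0 k) m t0) (@cvg_exp_series _ ((1 + cmod z) * D k * t)).
apply: cmod_lim.
have E n : cmod (\sum_(0 <= m < n) rising z m * (- (D k)%:C) ^+ m / m`!%:R ^+ 2 *
      (t%:C ^+ m * ce (p k) t) - ce (p k) t * kummerB z (D k) t) =
    cmod (ce (p k) t) * cmod (\sum_(0 <= m < n) kcoef z (D k) m * t%:C ^+ m - kummerB z (D k) t).
  rewrite -cmodM mulrBr mulr_sumr; congr (cmod (_ - _)).
  by apply: eq_bigr => m _; rewrite /kcoef; ring.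
by rewrite (funext E) -[X in _ --> X](mulr0 (cmod (ce (p k) t))); exact: cvgMr.
Qed.

Lemma lbd_kernel k : lbd (kernel k).
Proof.
apply: lbdD; first by apply: lbdM; [exact: lbd_ce|exact: lbd_kummerA].
by apply: lbdZ; apply: lbdM; [exact: lbd_ce|exact: lbd_kummerB].
Qed.

Definition gdens n (s : R) : R[i] := z * (ce (p n.+1) s * cpow s (z - 1)).
Definition Gfun n : R -> R[i] := conv (gdens n) (fun=> 1).

Let lc : lint (fun s : R => cpow s (z - 1)). Proof. exact: lint_cpow. Qed.

Lemma lint_gdens n : lint (gdens n).
Proof. by apply: lintZ; apply: lintM => //; exact: lbd_ce. Qed.

Lemma lbd_Gfun n : lbd (Gfun n).
Proof. by apply: lbd_conv; [exact: lint_gdens|exact: lbd_cst]. Qed.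

Lemma conv_at0 (u v : R -> R[i]) : conv u v 0 = 0.
Proof. by rewrite /conv /cintegral set_itv1 !Rintegral_set1. Qed.

(** The common factor [ce (p n.+1)] comes out of the convolution, and [kummerA_conv] then adds
    [D n.+1] to the rate, which becomes [p n.+2]. *)
Lemma gdens_conv n (s : R) : 0 <= s ->
  conv (gdens n) (fun r => ce (p n.+1) r * kummerA z (D n.+1) r) s = gdens n.+1 s - gdens n s.
Proof.
rewrite le_eqVlt => /orP[/eqP<-|s0]; first by rewrite conv_at0 /gdens !ce0 subrr.
have lA := @lbd_kummerA _ z (D n.+1) (D0 n.+1).
rewrite convZl; [|by apply: lintM => //; exact: lbd_ce|by apply: lbdM => //; exact: lbd_ce].
rewrite conv_ce//.
have -> : conv ((cpow (R:=R))^~ (z - 1)) (kummerA z (D n.+1)) s =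
    cpow s (z - 1) * ce (D n.+1)%:C s - cpow s (z - 1).
  by rewrite -(kummerA_conv z0 (D0 n.+1) s0) [RHS]addrC addKr.
have -> : ce (D n.+1)%:C s = ce (- p n.+1) s * ce (p n.+2) s by rewrite -ceD -DC addrC.
rewrite /gdens; have := ceN (p n.+1) s.
move: (ce _ s) (ce _ s) (ce _ s) (cpow s _) => e1 e2 e3 c h.
rewrite [LHS](_ : _ = z * (e3 * e2 * e1 * c) - z * (e2 * c)); last by ring.
by rewrite h mul1r.
Qed.

(** By [gdens_conv], [delta_0 + cA] sends [G_n] to [G_{n+1}]. As [kummerB] is 1 plus the primitive
    of [kummerA], [cB] is [E_{p n.+1}] convolved with [delta_0 + cA], so it sends [G_n] to the
    smoothing of [G_{n+1}]. *)
Lemma Gfun_kernel n (t : R) :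
  Gfun n t + conv (Gfun n) (kernel n.+1) t =
  Gfun n.+1 t + a n.+1 * expo (p n.+1) (Gfun n.+1) t.
Proof.
have [t0|t0] := ltP t 0.
  by rewrite /Gfun /expo !conv_neg// mulr0.
pose cA (r : R) := ce (p n.+1) r * kummerA z (D n.+1) r.
pose cB (r : R) := ce (p n.+1) r * kummerB z (D n.+1) r.
have lce := @lbd_ce R (p n.+1).
have lA := @lbd_kummerA _ z (D n.+1) (D0 n.+1).
have lB := @lbd_kummerB _ z (D n.+1) (D0 n.+1).
have lcA : lbd cA by exact: lbdM.
have lcB : lbd cB by exact: lbdM.
have lG m := lbd_Gfun m.
have iG m := lbd_lint (lG m).
have l1 : lbd (fun=> 1 : R[i]) by exact: lbd_cst.
have EA (s : R) : 0 <= s -> conv (Gfun n) cA s = Gfun n.+1 s - Gfun n s.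
  move=> s0; rewrite /Gfun convAC//; last exact: lint_gdens.
  transitivity (conv (fun r => gdens n.+1 r + -1 * gdens n r) (fun=> 1) s).
    by apply: eq_conv => // r /andP[r0 _]; rewrite gdens_conv// mulN1r.
  rewrite convDl//; [|exact: lint_gdens|by apply: lintZ; exact: lint_gdens].
  by rewrite (@convZl _ (-1) (gdens n))// ?mulN1r//; exact: lint_gdens.
have EB : conv (Gfun n) cB t = expo (p n.+1) (Gfun n.+1) t.
  transitivity (conv (Gfun n) (fun r => conv (ce (p n.+1)) cA r + ce (p n.+1) r) t).
    apply: eq_conv => // s /andP[s0 _].
    rewrite /cB -(@kummerAB _ z _ (D0 n.+1) s s0) mulrDr mulr1; congr (_ + _).
    rewrite -conv_ce//; last exact: lbd_lint.
    by apply: eq_conv => // r _; rewrite mulr1.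
  rewrite convDr//; last exact: lbd_conv (lbd_lint lce) lcA.
  rewrite -convA// convAC// -/(expo _ _ _).
  rewrite -[X in _ + X]/(expo (p n.+1) (Gfun n) t).
  rewrite (eq_expo (p n.+1) (v := fun s => Gfun n.+1 s + -1 * Gfun n s)); last first.
    by move=> s /andP[s0 _]; rewrite EA// mulN1r.
  rewrite /expo convDl//; last exact: lintZ.
  by rewrite convZl// mulN1r subrK.
rewrite /kernel convDr//; last exact: lbdZ.
by rewrite EA// convZr// EB; ring.
Qed.

Lemma conv_measure_dirac (u : R -> R[i]) (t : R) : lbd u -> 0 <= t ->
  conv_measure u (\d_(0 : R)) t = u t.
Proof.
move=> hu t0; rewrite /conv_measure.
have tI s : `[0, t]%classic s -> 0 <= t - s <= t.
  by rewrite /= in_itv/= => /andP[s0 st]; lra.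
have mC : measurable_fun (setT : set (measurableTypeR R)) (fun s : R => t - s).
  by apply: measurable_funB => //; exact: measurable_cst.
have [mr mi] : cmeas (`[0, t] : set (measurableTypeR R)) (fun s => u (t - s)).
  have := cmeas_crB (hu t).1 mC => /(cmeasS measurableT (@subsetT _ `[0, t])).
  by apply: eq_cmeas => s /tI st; rewrite /cres mem_setE in_itv/= st.
rewrite /cintegral /Rintegral !integral_dirac; [|exact: measurable_itvR|exact/measurable_EFinP|
  exact: measurable_itvR|exact/measurable_EFinP].
rewrite !diracE mem_set ?mul1e/= ?subr0; first by case: (u t).
by rewrite in_itv/= lexx.
Qed.

Notation q k := (phi (z + k%:R)).

Lemma Kop_Gfun_succ n (t : R) :
  Kop (fun k => p k) (fun k => q k) n.+1 (Gfun n.+1) t =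
  Kop (fun k => p k) (fun k => q k) n (Gfun n) t +
  conv (Kop (fun k => p k) (fun k => q k) n (Gfun n)) (kernel n.+1) t.
Proof.
have lG m := lbd_Gfun m; have lk := lbd_kernel n.+1.
rewrite -Kop_conv//.
rewrite -[RHS]/((fun t => Kop _ _ n (Gfun n) t + Kop _ _ n (conv (Gfun n) (kernel n.+1)) t) t).
rewrite -KopD//; last by apply: lbd_conv => //; exact: lbd_lint.
rewrite (funext (Gfun_kernel n)) KopD//; last by apply: lbdZ; apply: lbd_expo; exact: lbd_lint.
rewrite KopZ; last by apply: lbd_expo; exact: lbd_lint.
by rewrite /= Kop_expo.
Qed.

Lemma truncated_convolutionE n :
  truncated_convolution phi z n = Kop (fun k => p k) (fun k => q k) n (Gfun n).
Proof.
have lG m := lbd_Gfun m.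
have lK m := lbd_Kop (fun k => p k) (fun k => q k) m (lG m).
elim: n => [|n IH].
  apply/funext => t /=; rewrite /Gfun [RHS]convC; [|exact: lint_gdens|exact: lbd_cst].
  have [t0|t0] := ltP t 0; first by rewrite !conv_neg.
  apply: eq_conv => // s _; rewrite /initial_density /gdens -cexpN1 -/(ce _ s).
  by rewrite mulrC mulrCA mulrA.
apply/funext => t; rewrite /truncated_convolution -/truncated_convolution IH /conv_dirac_density.
(* Negative times, where every convolution is 0, are included because the two sides are equated as
   functions on the line. *)
rewrite Kop_Gfun_succ; have [t0|t0] := ltP t 0.
  rewrite /conv_measure !conv_neg// /cintegral set_itv_ge ?bnd_simp -?ltNge// !Rintegral_set0.
  have K0 m u : u t = 0 -> Kop (fun k => p k) (fun k => q k) m u t = 0.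
    by move=> u0; elim: m => //= m ->; rewrite /expo conv_neg// mulr0 addr0.
  by rewrite K0// /Gfun conv_neg.
rewrite conv_measure_dirac//.
by congr (_ + _); apply: eq_conv => // s /andP[s0 _]; exact: bracket_densityE.
Qed.
End truncated_convolutions.

(** * Convergence of iterated convolutions and mass of the brackets *)

Section convolution_products.
Context {R : realType}.
Notation leb := (@lebesgue_measure R).

(** From [1 + c n <= expR (c n)] all [V n] share the bound [B * expR l], where [l] is the sum of the
    [c n]. The increments are then summable, and [d n] is the tail of the series times that
    bound. *)
Lemma wb_convolution_limit (V h : nat -> R -> R[i]) (c : nat -> R) (B : R) :
  0 <= B -> (forall n, 0 <= c n) -> cvgn (series c) ->
  lbd (V 0%N) -> (forall n, lbd (h n)) -> wb B (V 0%N) ->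
  (forall n t, 0 <= t -> V n.+1 t = V n t + conv (V n) (h n) t) ->
  (forall n, lbd (V n)) ->
  (forall n T, 0 <= T -> \int[leb]_(s in `[0, T]) (expR (- s) * cmod (h n s)) <= c n) ->
  exists (U : R -> R[i]) (d : nat -> R),
    [/\ lbd U, d n @[n --> \oo] --> (0 : R) & forall n, wb (d n) (fun s => V n s - U s)].
Proof.
move=> B0 c0 cc l0 lh w0 VE lV hc.
have /cvg_ex[/= l cl] := cc.
have Sl n : series c n <= l.
  rewrite -(cvg_lim (@norm_hausdorff _ _) cl); apply: nondecreasing_cvgn_le => //.
  by apply: nondecreasing_series => m _ _.
pose B' := B * expR l.
have B'0 : 0 <= B' by rewrite mulr_ge0 ?expR_ge0.
have wV n : wb B' (V n).
  suff : wb (B * expR (series c n)) (V n).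
    by apply: wb_le; rewrite ler_wpM2l// ler_expR.
  elim: n => [|n IH]; first by rewrite /series/= big_geq// expR0 mulr1.
  move=> s s0; rewrite VE//.
  have Bn : 0 <= B * expR (series c n) by rewrite mulr_ge0 ?expR_ge0.
  have H := wbD IH (wb_conv Bn IH (lV n) (lh n) (hc n)).
  have {H} := H s s0; move/le_trans; apply; rewrite ler_wpM2r ?expR_ge0//.
  rewrite -[X in X + _]mulr1 -mulrDr (_ : series c n.+1 = series c n + c n); last first.
    by rewrite /series/= big_nat_recr.
  by rewrite expRD mulrA ler_wpM2l// expR_ge1Dx.
have hV n : wb (B' * c n) (conv (V n) (h n)) by exact: wb_conv (wV n) (lV n) (lh n) (hc n).
pose x t m := conv (V m) (h m) t.
pose y (t : R) m := B' * expR t * c m.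
have xy t : 0 <= t -> forall m, cmod (x t m) <= y t m.
  by move=> t0 m; rewrite (le_trans (hV m t t0))// /y mulrAC.
have yE t n : series (y t) n = B' * expR t * series c n by rewrite /series/= mulr_sumr.
have cy t : series (y t) @ \oo --> B' * expR t * l.
  by rewrite (funext (yE t)); exact: cvgMr.
have cvy t : cvgn (series (y t)) by apply/cvg_ex; eexists; exact: cy.
have VS n t : 0 <= t -> V n t = V 0%N t + \sum_(0 <= m < n) x t m.
  move=> t0; elim: n => [|n IH]; first by rewrite big_geq// addr0.
  by rewrite VE// big_nat_recr//= IH addrA.
exists (fun t => V 0%N t + csum (x t)), (fun n => B' * (l - series c n)); split.
- apply: lbdD => // T; split.
    apply: (@cmeas_csum _ _ (fun m s => x s m) y) => //.
    + by move=> m; have := lbd_conv (lbd_lint (lV m)) (lh m) T => -[].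
    + by move=> s m; rewrite /= in_itv/= => /andP[s0 _]; exact: xy.
  exists (B' * expR T * l) => s /andP[s0 sT].
  rewrite (le_trans (cmod_csum_le (xy s s0) (cvy s)))//.
  rewrite (cvg_lim (@norm_hausdorff _ _) (cy s)).
  rewrite ler_wpM2r//; first by have := Sl 0%N; rewrite /series/= big_geq.
  by rewrite ler_wpM2l// ler_expR.
- rewrite -[X in _ --> X](mulr0 B'); apply: cvgMr; rewrite -(subrr l).
  by apply: cvgB => //; exact: cvg_cst.
- move=> n t t0; rewrite VS// (_ : _ - _ = \sum_(0 <= m < n) x t m - csum (x t)); last by ring.
  have H := csum_cvg (xy t t0) (cvy t).
  apply/ler_addgt0Pr => e e0.
  move/cvgrPdist_le : H => /(_ _ e0)[N _ /(_ _ (leq_maxl N n))/=].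
  rewrite sub0r normrN ger0_norm ?cmod_ge0//; set M := maxn N n => hM.
  have nM : (n <= M)%N by exact: leq_maxr.
  rewrite -(subrK (\sum_(0 <= m < M) x t m) (\sum_(0 <= m < n) x t m)) -addrA.
  rewrite (le_trans (cmodD _ _))// lerD//.
  rewrite -cmodN opprB (big_cat_nat (n := n))//= [X in cmod X]addrC addKr.
  rewrite (le_trans (cmod_sum _ _ _))// (le_trans (ler_sum _ (fun m _ => xy t t0 m)))//.
  rewrite -mulr_sumr [leRHS](_ : _ = B' * expR t * (l - series c n)); last by ring.
  rewrite ler_wpM2l ?mulr_ge0 ?expR_ge0// lerBrDl.
  by apply: le_trans (Sl M); rewrite /series/= [leRHS](big_cat_nat (n := n)).
Qed.
End convolution_products.

Section kernel_mass.
Context {R : realType}.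
Variables (phi : R[i] -> R[i]) (z : R[i]).
Hypotheses (hphi : bernstein phi) (z0 : 0 < Re z).
Notation leb := (@lebesgue_measure R).
Notation pr k := (Re (phi k%:R)).
Notation D k := (pr k.+1 - pr k).
Notation p k := (phi k%:R).
Notation a k := (phi (z + k%:R) - phi k%:R).
Notation b := (1 + cmod z).

Let D0 k : 0 <= D k.
Proof. by have [_ _ h _ _] := bernstein_facts hphi; rewrite subr_ge0. Qed.

Lemma expR_sub1_le (x : R) : 0 <= x -> expR x - 1 <= x * expR x.
Proof.
move=> x0; have := expR_ge1Dx (- x); rewrite expRN => h.
rewrite lerBlDr -lerBlDl -[X in X - _ ]mul1r -mulrBl.
by rewrite -ler_pdivlMr ?expR_gt0// mul1r.
Qed.

Lemma cmod_kummerB_sub (t : R) k : 0 <= t ->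
  cmod (kummerB z (D k) t - 1) <= b * D k * t * expR (b * D k * t).
Proof.
move=> t0; have bD0 : 0 <= b * D k by apply: mulr_ge0 => //; rewrite addr_ge0 ?cmod_ge0.
rewrite /kummerB (csum_recl (fun m => kummerB_dom z (D0 k) m t0) (@cvg_exp_series _ _)).
rewrite expr0 mulr1 [kcoef _ _ 0](_ : _ = 1); last first.
  by rewrite /kcoef rising0 expr0 fact0 expr1n divr1 mulr1.
rewrite addrC addKr; have [c l] := exp_tail (b * D k * t).
rewrite (le_trans (cmod_csum_le (fun m => kummerB_dom z (D0 k) m.+1 t0) c))// l.
by rewrite expR_sub1_le// mulr_ge0.
Qed.

(** The constant term of [kummerA z D] is [- z D]; what remains is of second order in [D]. *)
Lemma cmod_kummerA_sub (t : R) k : 0 <= t ->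
  cmod (kummerA z (D k) t + z * (D k)%:C) <= b * D k * (b * D k * t * expR (b * D k * t)).
Proof.
move=> t0; have bD0 : 0 <= b * D k by apply: mulr_ge0 => //; rewrite addr_ge0 ?cmod_ge0.
have := @kummerA_dom _ z _ (D0 k) t ^~ t0.
move=> dom; have cv := @cvg_kummerA_dom _ z (D k) t.
rewrite /kummerA (csum_recl dom cv).
rewrite [kcoef _ _ 1 * _](_ : _ = - (z * (D k)%:C)); last first.
  by rewrite /kcoef risingS rising0 addr0 expr1 expr0 (_ : 1`! = 1%N)// expr1n divr1 !mul1r !mulr1 mulrN.
rewrite addrAC addNr add0r; have [c l] := exp_tail (b * D k * t).
have SE : series (fun m => b * D k * exp_coeff (b * D k * t) m.+1) @ \oo -->
    b * D k * (expR (b * D k * t) - 1).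
  rewrite (_ : series _ = fun n => b * D k * series (fun m => exp_coeff (b * D k * t) m.+1) n).
    by apply: cvgMr; rewrite -l.
  by apply/funext => n; rewrite /series/= mulr_sumr.
have c' : cvgn (series (fun m => b * D k * exp_coeff (b * D k * t) m.+1)).
  by apply/cvg_ex; eexists; exact: SE.
rewrite (le_trans (cmod_csum_le (fun m => dom m.+1) c'))//.
by rewrite (cvg_lim (@norm_hausdorff _ _) SE) ler_wpM2l// expR_sub1_le// mulr_ge0.
Qed.

(** In the kernel [a k] meets the constant term [- z D k] of [kummerA], and the sum is of order
    [la / k ^+ 2]. The other terms are products of two factors among [D k] and [a k], which are
    [O(la / k)] by concavity, and of [s]; the exponential absorbs [la * s]. The condition
    [2 * b <= k] keeps the growth rate [b * D k] of the Kummer series below [la / 2]. At the end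
    [la / (1 + la / 4) <= 4] turns 12 into 48. *)
Lemma kernel_mass k T : (0 < k)%N -> 2 * b <= k%:R -> 0 <= T ->
  \int[leb]_(s in `[0, T]) (expR (- s) * cmod (kernel phi z k s)) <= 48 * b ^+ 2 / k%:R ^+ 2.
Proof.
move=> k0 bk T0.
have [phiC pr0 _ cv [_ f1 f2]] := bernstein_facts hphi.
set la := pr k; have la0 : 0 <= la by exact: pr0.
have kn : 0 < k%:R :> R by rewrite ltr0n.
have c0 := cmod_ge0 z.
have b1 : 1 <= b by rewrite lerDl.
have Dk : D k <= la / k%:R.
  rewrite ler_pdivlMr// mulrC -(prednK k0) -[k]prednK//.
  have h := bernstein_increment_le hphi k.-1.
  have h' := cv k.-1; move: h h'; rewrite !prednK// => h h'.
  by apply: le_trans h; rewrite ler_wpM2l.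
have ak : cmod (a k) <= b * (la / k%:R).
  have := f1 z k.-1 (ltW z0); rewrite prednK// => /le_trans; apply.
  have h := bernstein_increment_le hphi k.-1; move: h; rewrite prednK// => h.
  have h2 : pr k - pr k.-1 <= la / k%:R by rewrite ler_pdivlMr// mulrC.
  rewrite (le_trans (ler_wpM2l c0 h2))// ler_wpM2r ?divr_ge0//.
  by rewrite lerDr.
have az : cmod (a k - z * (D k)%:C) <= 4 * b ^+ 2 * la / k%:R ^+ 2.
  have := f2 z k (ltW z0) k0; rewrite (_ : p k.+1 - p k = (D k)%:C); last first.
    by rewrite rmorphB/= -!phiC.
  move/le_trans; apply; rewrite ler_wpM2r ?invr_ge0 ?exprn_ge0//.
  by rewrite ler_wpM2r// ler_wpM2l//; nra.
(* The constant is 4 from [az] plus 2 times 4: two remainders, each bounded through [EE] below. *)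
pose M := 12 * b ^+ 2 * la / k%:R ^+ 2.
have M0 : 0 <= M by rewrite /M divr_ge0 ?exprn_ge0// mulr_ge0// mulr_ge0// exprn_ge0// addr_ge0.
have pw s : 0 <= s -> cmod (kernel phi z k s) <= M * expR (- (la / 4 * s)).
  move=> s0; have bD0 : 0 <= b * D k by rewrite mulr_ge0// addr_ge0.
  have bDl : b * D k <= la / 2.
    rewrite (le_trans (ler_wpM2l _ Dk))//; first by rewrite addr_ge0.
    rewrite mulrCA ler_wpM2l// ler_pdivrMr// mulrC ler_pdivlMr//; move: bk; lra.
  have hA := cmod_kummerA_sub k s0; have hB := cmod_kummerB_sub k s0.
  set A := kummerA _ _ _ in hA; set B := kummerB _ _ _ in hB.
  rewrite /kernel -/A -/B (_ : _ + _ = ce (p k) s * ((a k - z * (D k)%:C) +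
    (A + z * (D k)%:C) + a k * (B - 1))); last by ring.
  rewrite cmodM cmod_ce -/la.
  set E := b * D k * s * expR (b * D k * s) in hA hB.
  have E0 : 0 <= E by rewrite mulr_ge0 ?expR_ge0// mulr_ge0.
  have br : cmod ((a k - z * (D k)%:C) + (A + z * (D k)%:C) + a k * (B - 1)) <=
      4 * b ^+ 2 * la / k%:R ^+ 2 + 2 * b * la / k%:R * E.
    rewrite (le_trans (cmodD _ _))// (le_trans (lerD (cmodD _ _) (lexx _)))//.
    rewrite -addrA lerD// cmodM.
    have h1 : b * D k * E <= b * (la / k%:R) * E.
      by rewrite ler_wpM2r// ler_wpM2l// addr_ge0.
    have h2 : cmod (a k) * cmod (B - 1) <= b * (la / k%:R) * E.
      by rewrite ler_pM ?cmod_ge0.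
    by rewrite (le_trans (lerD (le_trans hA h1) h2))// le_eqVlt; apply/orP; left; apply/eqP; ring.
  (* The exponential is split into a half that cancels the growth of the Kummer series, a quarter
     that absorbs the factor [la * s], and a quarter that is kept. *)
  have EE : expR (- (la * s)) * E <= b * 4 / k%:R * expR (- (la / 4 * s)).
    have h1 : E <= b * (la / k%:R) * s * expR (la / 2 * s).
      rewrite /E ler_pM ?expR_ge0//; first by rewrite mulr_ge0.
        by rewrite ler_wpM2r// ler_wpM2l// addr_ge0.
      by rewrite ler_expR ler_wpM2r.
    rewrite (le_trans (ler_wpM2l (expR_ge0 _) h1))//.
    have h2 : la * s <= 4 * expR (la / 4 * s).
      by have := expR_ge1Dx (la / 4 * s); nra.
    have -> : expR (- (la * s)) = expR (- (la / 4 * s)) * (expR (- (la / 4 * s)) * expR (- (la / 2 * s))).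
      by rewrite -!expRD; congr expR; field.
    rewrite mulrCA [X in _ <= X]mulrC.
    have e2 : expR (- (la / 2 * s)) * expR (la / 2 * s) = 1 by rewrite -expRD addNr expR0.
    have e4 : expR (- (la / 4 * s)) * expR (la / 4 * s) = 1 by rewrite -expRD addNr expR0.
    rewrite [leLHS](_ : _ = (expR (- (la / 2 * s)) * expR (la / 2 * s)) *
      ((b / k%:R * expR (- (la / 4 * s))) * (expR (- (la / 4 * s)) * (la * s)))); last by field; lra.
    rewrite e2 mul1r [leRHS](_ : _ = (b / k%:R * expR (- (la / 4 * s))) * 4); last by field; lra.
    rewrite ler_wpM2l//; first by rewrite mulr_ge0 ?expR_ge0// divr_ge0// addr_ge0.
    rewrite (le_trans (ler_wpM2l (expR_ge0 _) h2))// mulrCA e4 mulr1//.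
  rewrite (le_trans (ler_wpM2l (expR_ge0 _) br))// mulrDr.
  have ex : expR (- (la * s)) <= expR (- (la / 4 * s)).
    by rewrite ler_expR lerN2 ler_wpM2r//; move: la0; lra.
  apply: (@le_trans _ _ (4 * b ^+ 2 * la / k%:R ^+ 2 * expR (- (la / 4 * s)) +
    2 * b * la / k%:R * (b * 4 / k%:R * expR (- (la / 4 * s))))).
    apply: lerD.
      rewrite [leLHS]mulrC; apply: ler_wpM2l => //.
      by rewrite divr_ge0 ?exprn_ge0// mulr_ge0// mulr_ge0// exprn_ge0// addr_ge0.
    rewrite mulrCA; apply: ler_wpM2l => //.
    by rewrite divr_ge0// mulr_ge0// mulr_ge0// addr_ge0.
  rewrite le_eqVlt; apply/orP; left; apply/eqP; rewrite /M.
  by move: (expR _) => e; field; lra.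
have mI := @measurable_itvR R `[0, T].
have i1 : leb.-integrable `[0, T] (EFin \o (fun s => expR (- s) * cmod (kernel phi z k s))).
  have := integrable_cmod mI (lbd_lint (lbdM (@lbd_ce R 1) (lbd_kernel z hphi k)) T).
  apply: eq_integrable => // s _ /=.
  by rewrite cmodM cmod_ce (_ : Re 1 = 1)// mul1r.
have i2 : leb.-integrable `[0, T] (EFin \o (fun s => expR (- s) * expR (- (la / 4 * s)))).
  have := integrable_cmod mI (lbd_lint (@lbd_ce R (1 + la / 4)%:C) T).
  apply: eq_integrable => // s _ /=.
  by rewrite cmod_ce /= mulrDl mul1r opprD expRD.
apply: (@le_trans _ _ (\int[leb]_(s in `[0, T]) (M * (expR (- s) * expR (- (la / 4 * s)))))).
  apply: le_Rintegral => //; first exact: (integrableZl mI M i2).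
  move=> s; rewrite /= in_itv/= => /andP[s0 _].
  by rewrite mulrCA ler_wpM2l ?expR_ge0// pw.
rewrite RintegralZl//; have l4 : 0 <= la / 4 by rewrite divr_ge0.
rewrite (le_trans (ler_wpM2l M0 (ce_mass l4 T0)))// ler_pdivrMr; last by move: l4; lra.
rewrite /M -subr_ge0 [X in 0 <= X](_ : _ = 48 * b ^+ 2 / k%:R ^+ 2); last by field; lra.
by rewrite divr_ge0 ?exprn_ge0// mulr_ge0// exprn_ge0// addr_ge0.
Qed.
End kernel_mass.

(** * Independence *)

Lemma probability_lty d (T : measurableType d) (R : realType) (P : probability T R) :
  (P setT < +oo)%E.
Proof. by rewrite probability_setT ltry. Qed.

Section expectation_tools.
Context d (T : measurableType d) (R : realType) (P : probability T R).

Lemma cexpectationE (Z : T -> R[i]) : cexpectation P Z = cintegral P setT Z.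
Proof. by rewrite /cexpectation unlock. Qed.

Lemma cintble_probability (Z : T -> R[i]) (C : R) : cmeas setT Z ->
  (forall w, cmod (Z w) <= C) -> cintble P setT Z.
Proof.
move=> mZ ZC; apply: (@cintble_bounded _ _ _ P _ _ C) => //.
exact: probability_lty.
Qed.

Lemma cfubini_prod d1 d2 (T1 : measurableType d1) (T2 : measurableType d2)
    (m1 : {sigma_finite_measure set T1 -> \bar R})
    (m2 : {sigma_finite_measure set T2 -> \bar R}) (f : T1 * T2 -> R[i]) :
  cintble (m1 \x m2)%E setT f -> (forall x, cintble m2 setT (fun y => f (x, y))) ->
  cintegral (m1 \x m2)%E setT f =
  cintegral m1 setT (fun x => cintegral m2 setT (fun y => f (x, y))).
Proof.
move=> [cr cI] int1; rewrite {1 2}/cintegral; apply: complex_ext => /=.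
- rewrite /Rintegral -(integral12_prod_meas1 cr); congr fine.
  apply: eq_integral => x _; rewrite /fubini_F fineK//.
  exact: (integrable_fin_num _ (int1 x).1).
- rewrite /Rintegral -(integral12_prod_meas1 cI); congr fine.
  apply: eq_integral => x _; rewrite /fubini_F fineK//.
  exact: (integrable_fin_num _ (int1 x).2).
Qed.

Section independence.
Context d1 d2 (T1 : measurableType d1) (T2 : measurableType d2).
Variables (W : T -> T1) (X X' : T -> T2).
Hypotheses (mW : measurable_fun setT W) (mX : measurable_fun setT X)
  (mX' : measurable_fun setT X').
Hypothesis WX : forall A B, measurable A -> measurable B ->
  P (W @^-1` A `&` X @^-1` B) = (P (W @^-1` A) * P (X' @^-1` B))%E.

Let W_ : {mfun T >-> T1} := HB.pack W (isMeasurableFun.Build _ _ _ _ W mW).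
Let X_ : {mfun T >-> T2} := HB.pack X' (isMeasurableFun.Build _ _ _ _ X' mX').
Let m1 : probability T1 R := distribution P W_.
Let m2 : probability T2 R := distribution P X_.

Let mWX : measurable_fun setT (fun w => (W w, X w)).
Proof. exact/measurable_fun_pairP. Qed.

Let WX_ : {mfun T >-> (T1 * T2)%type} :=
  HB.pack (fun w => (W w, X w)) (isMeasurableFun.Build _ _ _ _ _ mWX).

Let law A : measurable A -> P ((fun w => (W w, X w)) @^-1` A) = (m1 \x m2)%E A.
Proof.
move=> mA; symmetry.
exact: (@product_measure_unique _ _ _ _ _ m1 m2 (distribution P WX_) _ A mA).
Qed.

(** The hypothesis [WX] says at once that [X] is independent of [W] and distributed as [X'];
    independence and stationarity of increments enter in this combined form. *)
Lemma indep_cexpectation (F : T1 -> R[i]) (G : T2 -> R[i]) (CF CG : R) :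
  cmeas setT F -> cmeas setT G ->
  (forall x, cmod (F x) <= CF) -> (forall x, cmod (G x) <= CG) ->
  cintegral P setT (fun w => F (W w) * G (X w)) =
  cintegral P setT (fun w => F (W w)) * cintegral P setT (fun w => G (X' w)).
Proof.
move=> mF mG hF hG.
have CF0 : 0 <= CF by apply: le_trans (hF point); exact: cmod_ge0.
have CG0 : 0 <= CG by apply: le_trans (hG point); exact: cmod_ge0.
pose f (p : T1 * T2) := F p.1 * G p.2.
have mf : cmeas setT f.
  by apply: cmeasM; [exact: (cmeas_comp mF measurable_fst)|exact: (cmeas_comp mG measurable_snd)].
have iG : cintble m2 setT G.
  by apply: (@cintble_bounded _ _ _ m2 _ _ CG) => //; exact: probability_lty.
have iF : cintble m1 setT F.
  by apply: (@cintble_bounded _ _ _ m1 _ _ CF) => //; exact: probability_lty.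
have if_ : cintble (m1 \x m2)%E setT f.
  apply: (@cintble_bounded _ _ _ (m1 \x m2)%E _ _ (CF * CG)) => //.
    apply: (@eq_ind _ _ (fun x => (x < +oo)%E) (probability_lty P)).
    by have h := law measurableT; rewrite preimage_setT in h; exact: h.
  by move=> p _; rewrite cmodM ler_pM ?cmod_ge0.
rewrite (@cintegral_preserving _ _ _ _ _ P (m1 \x m2)%E _ mWX law f if_).
rewrite (@cfubini_prod _ _ _ _ m1 m2 f if_); last by move=> x; exact: (cintbleZ measurableT (F x) iG).
transitivity (cintegral m1 setT (fun x => cintegral m2 setT G * F x)).
  by apply: eq_cintegral => x _; rewrite /f/= cintegralZ// mulrC.
rewrite cintegralZ// mulrC; congr (_ * _).
  by symmetry; apply: (@cintegral_preserving _ _ _ _ _ P m1 W mW).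
by symmetry; apply: (@cintegral_preserving _ _ _ _ _ P m2 X' mX').
Qed.
End independence.

(** The time is moved to the next point, strictly to the right, of the grid of step [1 / m.+1]. The
    resulting functions are constant in time on countably many strips, hence jointly measurable, and
    right continuity gives the limit. *)
Lemma measurable_right_continuous (f : R -> T -> R) :
  (forall s, 0 <= s -> measurable_fun setT (f s)) ->
  (forall w s, 0 <= s -> f s' w @[s' --> s^'+] --> f s w) ->
  measurable_fun setT (fun p : measurableTypeR R * T => f (Num.max p.1 0) p.2).
Proof.
move=> mf rc.
pose k m (s : R) : nat := Num.truncn (m.+1%:R * Num.max s 0).
pose fm (m : nat) (p : measurableTypeR R * T) := f ((k m p.1).+1%:R / m.+1%:R) p.2.
apply: (@measurable_fun_cvg _ _ _ _ fm).
- move=> m _ Y mY; rewrite setTI.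
  pose g (s : measurableTypeR R) : R := m.+1%:R * Num.max s 0.
  have mg : measurable_fun setT g.
    apply: measurable_funM => //; apply: measurable_maxr => //.
  have -> : fm m @^-1` Y = \bigcup_j
      ((g @^-1` `[j%:R, j.+1%:R[) `*` (f (j.+1%:R / m.+1%:R) @^-1` Y)).
    apply/seteqP; split => [[s w]/= Yw|[s w]/= [j _ [/= gj Yw]]].
      exists (k m s) => //; split => //=; rewrite in_itv/=.
      by rewrite truncn_le ?truncnS_gt// mulr_ge0// le_max lexx orbT.
    rewrite /fm/= (_ : k m s = j)//; apply/eqP; rewrite truncn_eq//.
    by rewrite mulr_ge0// le_max lexx orbT.
  apply: bigcup_measurable => j _; apply: measurableX.
    by rewrite -[_ @^-1` _]setTI; apply: mg => //; exact: measurable_itvR.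
  by rewrite -[_ @^-1` _]setTI; apply: mf => //; rewrite divr_ge0.
- move=> [s w] _ /=; set s0 := Num.max s 0.
  have s00 : 0 <= s0 by rewrite le_max lexx orbT.
  rewrite /fm/=.
  have := rc w s0 s00; apply: (@cvg_comp _ _ _ (fun m => (k m s).+1%:R / m.+1%:R : R) (f ^~ w)).
  move=> A [e /= e0 eA]; exists (Num.truncn e^-1) => // m /= Nm.
  have m0 : 0 < m.+1%:R :> R by rewrite ltr0n.
  have mN : (m.+1%:R)^-1 < e.
    rewrite invf_plt ?posrE//; apply: (lt_le_trans (truncnS_gt _)).
    by rewrite ler_nat ltnS.
  have ks : m.+1%:R * s0 < (k m s).+1%:R by exact: truncnS_gt.
  have sk : (k m s)%:R <= m.+1%:R * s0 by rewrite truncn_le mulr_ge0.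
  have lt1 : s0 < (k m s).+1%:R / m.+1%:R by rewrite ltr_pdivlMr// mulrC.
  apply: eA => //; rewrite /ball_/= distrC ger0_norm ?subr_ge0 ?ltW//.
  apply: le_lt_trans mN; rewrite lerBlDr -natr1 mulrDl mul1r addrC lerD2l.
  by rewrite ler_pdivrMr// mulrC.
Qed.
End expectation_tools.

(** * Riemann sums and functionals of finitely many increments *)

Section step_approximation.
Context {R : realType}.
Notation leb := (@lebesgue_measure R).

Lemma cpow_lipschitz (w : R[i]) (a b K : R) : 0 < a -> a <= b ->
  (forall u, a <= u <= b -> u `^ (Re w - 1) <= K) ->
  cmod (cpow b w - cpow a w) <= cmod w * K * (b - a).
Proof.
move=> a0 ab hK.
have K0 : 0 <= K by apply: le_trans (hK a _); rewrite ?powR_ge0 ?lexx.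
apply: cmod_leP; first by rewrite mulr_ge0 ?subr_ge0// mulr_ge0 ?cmod_ge0.
move=> c c1; rewrite mulrBr ReD ReN.
have dx (x : R) : a <= x -> is_derive x 1 (fun u => Re (c * cpow u w)) (Re (c * w * cpow x (w - 1))).
  by move=> ax; apply: is_derive_Re_cpow; exact: lt_le_trans ax.
have [x||x] := @MVT_segment R (fun u => Re (c * cpow u w)) (fun u => Re (c * w * cpow u (w - 1))) a b ab.
- by rewrite in_itv/= => /andP[/ltW ax _]; exact: dx.
- apply: derivable_within_continuous => x; rewrite in_itv/= => /andP[ax _].
  by have [] := dx x ax.
rewrite in_itv/= => /andP[ax xb] ->.
rewrite ler_wpM2r ?subr_ge0// (le_trans (ler_norm _))// (le_trans (Re_le_cmod _))//.
rewrite !cmodM c1 mul1r ler_wpM2l ?cmod_ge0// cmod_cpow; last exact: lt_le_trans ax.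
by rewrite ReD ReN hK// ax.
Qed.

Lemma cvg_cpow (w : R[i]) (u : nat -> R) (l : R) : 0 < l -> u n @[n --> \oo] --> l ->
  cmod (cpow (u n) w - cpow l w) @[n --> \oo] --> (0 : R).
Proof.
move=> l0 ul.
have h (c : R[i]) : Re (c * cpow (u n) w) @[n --> \oo] --> Re (c * cpow l w).
  have cl : Re (c * cpow v w) @[v --> l] --> Re (c * cpow l w).
    apply: differentiable_continuous; apply/derivable1_diffP.
    by have [] := is_derive_Re_cpow c w l0.
  exact: cvg_comp ul cl.
apply: (@squeeze_cvgr _ _ _ _ (cst 0) (fun n =>
  `|Re (1 * cpow (u n) w) - Re (1 * cpow l w)| +
  `|Re (- 'i * cpow (u n) w) - Re (- 'i * cpow l w)|)).
- apply: nearW => n; rewrite cmod_ge0/=.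
  by rewrite (le_trans (cmod_le_ReIm _))// -!Im_ReNi !mul1r ReD ImD ReN ImN.
- exact: cvg_cst.
- rewrite -[X in _ --> X](addr0 0).
  by apply: cvgD; rewrite -(@normr0 _ R^o); apply: cvg_norm; apply/subr_cvg0; exact: h.
Qed.

Variable f : R -> R.
Hypothesis mf : measurable_fun (setT : set (measurableTypeR R)) f.
Hypothesis f01 : forall s, 0 <= f s <= 1.
Hypothesis fdec : forall s t, 0 <= s -> s <= t -> f t <= f s.
Let A s := \int[leb]_(r in `[0, s]) f r.

Lemma primitive_step (a b : R) : 0 <= a -> a <= b ->
  f b * (b - a) <= A b - A a <= f a * (b - a).
Proof.
move=> a0 ab; rewrite (primitiveB mf f01)//.
have i1 := unit_integrable mf f01 (leb_itvoc_lty a b).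
have ic c := integrable_cst_itv c (leb_itvoc_lty a b).
apply/andP; split; rewrite -Rintegral_itvoc_cst//; apply: le_Rintegral => //.
  by move=> x; rewrite /= in_itv/= => /andP[ax xb]; apply: fdec => //; rewrite (le_trans a0)// ltW.
by move=> x; rewrite /= in_itv/= => /andP[ax xb]; apply: fdec => //; exact: ltW.
Qed.

(** For decreasing [f] the right-endpoint sum lies below the integral, and the errors of the cells
    telescope to at most [h * (f 0 - f (m h))]. *)
Lemma riemann_sum (h : R) m : 0 <= h ->
  `|h * (\sum_(0 <= j < m) f (j.+1%:R * h)) - A (m%:R * h)| <= h.
Proof.
move=> h0.
suff : h * (\sum_(0 <= j < m) f (j.+1%:R * h)) <= A (m%:R * h) <=
    h * (\sum_(0 <= j < m) f (j.+1%:R * h)) + h * (f 0 - f (m%:R * h)).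
  have /andP[_ f0] := f01 0; have /andP[fm _] := f01 (m%:R * h).
  move=> /andP[h1 h2]; rewrite distrC ger0_norm ?subr_ge0// lerBlDl.
  by rewrite (le_trans h2)// lerD2l ler_piMr//; lra.
elim: m => [|m /andP[IH1 IH2]].
  rewrite big_geq// mulr0 mul0r subrr mulr0 addr0 /A.
  by rewrite set_itv1 Rintegral_set1 lexx.
have m0 : 0 <= m%:R * h by rewrite mulr_ge0.
have mm : m%:R * h <= m.+1%:R * h by rewrite ler_wpM2r// ler_nat.
have /andP[] := primitive_step m0 mm.
rewrite (_ : m.+1%:R * h - m%:R * h = h); last by rewrite -natr1; ring.
rewrite big_nat_recr//= mulrDr; move: IH1 IH2.
by move: (\sum_(0 <= j < m) _) (A _) (A _) (f _) (f _) (f 0) => S a b fa fb fc; nra.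
Qed.
End step_approximation.

Section path_space.
Context {R : realType}.

(** Finite-dimensional boxes in the first [m] coordinates. Sequences stand for [m]-tuples: the
    sigma-algebra generated by [boxes m] does not see the coordinates from [m] on. *)
Definition boxes (m : nat) : set (set (nat -> R)) :=
  [set A | exists B : nat -> set R, (forall i, measurable (B i)) /\
    A = [set x | forall i, (i < m)%N -> B i (x i)]].

Definition pathType (m : nat) := g_sigma_algebraType (boxes m).

Lemma setI_closed_boxes m : setI_closed (boxes m).
Proof.
move=> _ _ [B [mB ->]] [B' [mB' ->]]; exists (fun i => B i `&` B' i); split.
  by move=> i; exact: measurableI.
by apply/seteqP; split => [x /= [h1 h2] i im|x /= h]; [split; [exact: h1|exact: h2]|split => i im; have [] := h i im].
Qed.

Lemma boxesT m : boxes m setT.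
Proof. by exists (fun=> setT); split => //; apply/seteqP; split. Qed.

Lemma measurable_coord m i : (i < m)%N -> measurable_fun setT (fun x : pathType m => x i : R).
Proof.
move=> im _ B mB; rewrite setTI; apply: sub_sigma_algebra.
exists (fun j => if j == i then B else setT); split; first by move=> j; case: ifP.
apply/seteqP; split => x /= h; first by move=> j jm; case: eqVneq => [->|].
by have := h i im; rewrite eqxx.
Qed.

Context d (T : measurableType d).

Lemma measurable_path m (X : T -> nat -> R) :
  (forall i, (i < m)%N -> measurable_fun setT (fun w => X w i)) ->
  measurable_fun setT (X : T -> pathType m).
Proof.
move=> mX; apply: (@measurability _ _ T (pathType m) setT X (boxes m) erefl).
move=> _ [_ [B [mB ->]] <-].
rewrite setTI (_ : _ @^-1` _ = \bigcap_(i in [set i | (i < m)%N]) (X ^~ i @^-1` B i)) //.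
by apply: bigcap_measurableType => i im; rewrite -[X in measurable X]setTI; exact: mX.
Qed.

(** As functions of [C] both sides are finite measures, and they agree on the boxes, which are
    stable under intersection and contain the whole space. *)
Lemma path_law (P : probability T R) m (X X' : T -> nat -> R) (E : set T) :
  measurable E ->
  (forall i, (i < m)%N -> measurable_fun setT (fun w => X w i)) ->
  (forall i, (i < m)%N -> measurable_fun setT (fun w => X' w i)) ->
  (forall B : nat -> set R, (forall i, measurable (B i)) ->
    P (E `&` [set w | forall i, (i < m)%N -> B i (X w i)]) =
    (P E * P [set w | forall i, (i < m)%N -> B i (X' w i)])%E) ->
  forall C : set (pathType m), measurable C ->
    P (E `&` X @^-1` C) = (P E * P (X' @^-1` C))%E.
Proof.
move=> mE mX mX' H C mC.
have mX_ := measurable_path mX; have mX'_ := measurable_path mX'.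
pose X_ : {mfun T >-> pathType m} := HB.pack (X : T -> pathType m) (isMeasurableFun.Build _ _ _ _ _ mX_).
pose X'_ : {mfun T >-> pathType m} := HB.pack (X' : T -> pathType m) (isMeasurableFun.Build _ _ _ _ _ mX'_).
have PE0 : 0 <= fine (P E) by exact: fine_ge0.
have PEE : (fine (P E))%:E = P E by rewrite fineK// fin_num_measure.
pose m1' : {measure set (pathType m) -> \bar R} := pushforward (mrestr P mE) X_.
pose m1 := m1' mX_.
pose m2' : {measure set (pathType m) -> \bar R} := mscale (NngNum PE0) (pushforward P X'_).
pose m2 := m2' mX'_.
have E1 A : m1 A = P (E `&` X @^-1` A) by rewrite /m1/= /pushforward/= /mrestr setIC.
have E2 A : m2 A = (P E * P (X' @^-1` A))%E.
  by rewrite /m2/= /mscale/= -PEE.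
rewrite -E1 -E2.
apply: (@measure_unique _ R (pathType m) (boxes m) (fun=> setT)) => //.
- exact: setI_closed_boxes.
- by move=> _; exact: boxesT.
- by rewrite bigcup_const.
- by move=> _ [B [mB ->]]; rewrite E1 E2; exact: H.
- by move=> _; rewrite E1 preimage_setT setIT ltey_eq fin_num_measure.
Qed.
End path_space.

Section decreasing_primitive.
Context {R : realType} d (T : measurableType d) (f : R -> T -> R).
Notation leb := (@lebesgue_measure R).
Hypothesis mf1 : forall s, 0 <= s -> measurable_fun setT (f s).
Hypothesis mf2 : forall w, measurable_fun (setT : set (measurableTypeR R)) (f ^~ w).
Hypothesis f01 : forall s w, 0 <= f s w <= 1.
Hypothesis fdec : forall w s t, 0 <= s -> s <= t -> f t w <= f s w.

Lemma riemann_cvg (w : T) (r : R) : 0 <= r ->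
  (r / n.+1%:R) * (\sum_(0 <= j < n.+1) f (j.+1%:R * (r / n.+1%:R)) w) @[n --> \oo] -->
  \int[leb]_(s in `[0, r]) f s w.
Proof.
move=> r0; apply/subr_cvg0.
apply: (@squeeze_cvgr _ _ _ _ (fun n => - (r / n.+1%:R)) (fun n => r / n.+1%:R)).
- apply: nearW => n; rewrite -ler_norml.
  have n0 : n.+1%:R != 0 :> R by [].
  have := @riemann_sum R _ (mf2 w) (f01 ^~ w) (fun s t => @fdec w s t) (r / n.+1%:R) n.+1.
  by rewrite mulrCA divff// mulr1; apply; rewrite divr_ge0.
- by rewrite -oppr0; apply: cvgN; rewrite -(mulr0 r); apply: cvgMr; exact: cvg_harmonic.
- by rewrite -(mulr0 r); apply: cvgMr; exact: cvg_harmonic.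
Qed.

(** A pointwise limit of finite combinations of the [f s]. It therefore applies as well with the
    sigma-algebra generated by the process, as independence of the killing time requires. *)
Lemma measurable_riemann (r : R) : 0 <= r ->
  measurable_fun setT (fun w => \int[leb]_(s in `[0, r]) f s w).
Proof.
move=> r0.
apply: (@measurable_fun_cvg _ _ _ _ (fun n w => (r / n.+1%:R) * (\sum_(0 <= j < n.+1) f (j.+1%:R * (r / n.+1%:R)) w))).
- move=> n; apply: measurable_funM => //; apply: measurable_sum => j.
  by apply: mf1; rewrite mulr_ge0// divr_ge0.
- by move=> w _; exact: riemann_cvg.
Qed.
End decreasing_primitive.

Section weighted_power.
Context {R : realType}.
Variable z : R[i].
Hypothesis z0 : 0 < Re z.

Definition wpow (n : nat) (l a : R) : R[i] := ce n%:R l * cpow a (z - 1).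

(** When [Re z < 1] the power of [a] can exceed that of [r], by a factor of at most
    [expR (l * (1 - Re z))]; [n >= 1] and [Re z > 0] let [exp (- n l)] compensate it. The bound is
    deterministic and so fit for dominated convergence. *)
Lemma cmod_wpow n (l a r : R) : (0 < n)%N -> 0 <= l -> 0 < r -> r * expR (- l) <= a <= r ->
  cmod (wpow n l a) <= r `^ (Re z - 1).
Proof.
move=> n0 l0 r0 /andP[ra ar].
have re0 : 0 < r * expR (- l) by rewrite mulr_gt0 ?expR_gt0.
have a0 : 0 < a by exact: lt_le_trans ra.
have n1 : (1 : R) <= n%:R by rewrite ler1n.
rewrite cmodM cmod_ce Re_nat cmod_cpow// ReD ReN (_ : Re 1 = 1)//.
have [x1|x1] := leP 1 (Re z).
  rewrite -[leRHS]mul1r ler_pM ?expR_ge0 ?powR_ge0//.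
    by rewrite -expR0 ler_expR oppr_le0 mulr_ge0// ler0n.
  by rewrite ge0_ler_powR ?nnegrE ?subr_ge0// ltW.
have h : a `^ (Re z - 1) <= r `^ (Re z - 1) * expR (l * (1 - Re z)).
  rewrite (_ : expR _ = expR (- l) `^ (Re z - 1)); last by rewrite -expRM; congr expR; ring.
  rewrite -powRM ?expR_ge0 ?(ltW r0)//.
  have x' : 0 <= 1 - Re z by lra.
  rewrite -(opprB 1) !powRN lef_pV2 ?posrE ?powR_gt0//.
  by rewrite ge0_ler_powR// nnegrE ltW.
rewrite (le_trans (ler_wpM2l (expR_ge0 _) h))// mulrCA ler_piMr ?powR_ge0//.
rewrite -expRD -[leRHS]expR0 ler_expR; have := z0; nra.
Qed.
End weighted_power.

(* The truncations [max _ 0] keep the functionals bounded on the whole path space,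
   although increments of a subordinator are nonnegative anyway. *)
Section path_functionals.
Context {R : realType}.

Definition pathL (m : nat) (x : nat -> R) : R := \sum_(0 <= i < m) Num.max (x i) 0.
Definition pathA (m : nat) (h : R) (x : nat -> R) : R :=
  h * \sum_(0 <= j < m) expR (- pathL j.+1 x).

Lemma pathL_ge0 m x : 0 <= pathL m x.
Proof. by apply: sumr_ge0 => i _; rewrite le_max lexx orbT. Qed.

Lemma pathL_le j m x : (j <= m)%N -> pathL j x <= pathL m x.
Proof.
move=> jm; rewrite /pathL (big_cat_nat (n := j) _ jm)//= lerDl.
by apply: sumr_ge0 => i _; rewrite le_max lexx orbT.
Qed.

Lemma pathA_bounds m (h : R) x : 0 <= h ->
  m%:R * h * expR (- pathL m x) <= pathA m h x <= m%:R * h.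
Proof.
move=> h0; rewrite [m%:R * h]mulrC -mulrA /pathA.
have e (c : R) : m%:R * c = \sum_(0 <= j < m) c.
  by rewrite sumr_const_nat subn0 mulr_natl.
rewrite !e mulr_sumr -[X in _ <= _ <= h * X]mulr1 e.
apply/andP; split; rewrite mulr_sumr.
  rewrite big_nat [leRHS]big_nat ler_sum// => j /andP[_ jm].
  by rewrite ler_wpM2l// ler_expR lerN2 pathL_le.
rewrite [leRHS]mulr_sumr ler_sum// => j _.
by rewrite ler_wpM2l// -expR0 ler_expR oppr_le0 pathL_ge0.
Qed.

Lemma measurable_pathL m k : (k <= m)%N ->
  measurable_fun setT (pathL k : pathType m -> R).
Proof.
move=> km; elim: k km => [|k IH] km.
  rewrite (_ : pathL 0 = cst 0); last by apply/funext => x; rewrite /pathL big_geq.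
  exact: measurable_cst.
rewrite (_ : pathL k.+1 = fun x => pathL k x + Num.max (x k) 0); last first.
  by apply/funext => x; rewrite /pathL big_nat_recr.
apply: measurable_funD; first exact: IH (ltnW km).
by apply: measurable_maxr => //; exact: measurable_coord.
Qed.

Lemma measurable_pathA m (h : R) : measurable_fun setT (pathA m h : pathType m -> R).
Proof.
apply: measurable_funM => //.
suff H k : (k <= m)%N ->
    measurable_fun setT (fun x : pathType m => \sum_(0 <= j < k) expR (- pathL j.+1 x)) by exact: H.
elim: k => [|k IH] km.
  rewrite (_ : (fun x => _) = cst 0); last by apply/funext => x; rewrite big_geq.
  exact: measurable_cst.
rewrite (_ : (fun x => _) = fun x : pathType m => \sum_(0 <= j < k) expR (- pathL j.+1 x) + expR (- pathL k.+1 x)); last first.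
  by apply/funext => x; rewrite big_nat_recr.
apply: measurable_funD; first exact: IH (ltnW km).
by apply: measurableT_comp => //; apply: measurable_funN; exact: measurable_pathL.
Qed.
End path_functionals.

(** * Subordinators *)

Section subordinators.
Context d (T : measurableType d) (R : realType) (P : probability T R).
Variable Y : R -> {RV P >-> R}.
Hypothesis hY : subordinator Y.
Notation leb := (@lebesgue_measure R).

Let Y0 w : Y 0 w = 0. Proof. by have [] := hY. Qed.
Let Yle w s t : 0 <= s -> s <= t -> Y s w <= Y t w.
Proof. by have [_ h _ _ _] := hY; exact: h. Qed.

Let mY s : measurable_fun setT (Y s : T -> R). Proof. exact: measurable_funPT. Qed.

Definition incr (s h : R) (w : T) (i : nat) : R :=
  Y (s + i.+1%:R * h) w - Y (s + i%:R * h) w.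

(* Negative times, about which [subordinator] says nothing, are replaced by 0. *)
Definition shifted (s u : R) (w : T) : R := Y (s + Num.max u 0) w - Y s w.
Definition decay (s u : R) (w : T) : R := expR (- shifted s u w).
Definition Jint (s r : R) (w : T) : R := \int[leb]_(u in `[0, r]) decay s u w.

Lemma shifted_ge0 s u w : 0 <= s -> 0 <= shifted s u w.
Proof. by move=> s0; rewrite subr_ge0 Yle// lerDl le_max lexx orbT. Qed.

Lemma shifted_le s u v w : 0 <= s -> u <= v -> shifted s u w <= shifted s v w.
Proof.
move=> s0 uv; rewrite lerD2r Yle//; first by rewrite addr_ge0// le_max lexx orbT.
by rewrite lerD2l ge_max !le_max uv lexx orbT.
Qed.

Lemma decay01 s u w : 0 <= s -> 0 <= decay s u w <= 1.
Proof. by move=> s0; rewrite expR_ge0/= -expR0 ler_expR oppr_le0 shifted_ge0. Qed.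

Lemma decay_le s w u v : 0 <= s -> u <= v -> decay s v w <= decay s u w.
Proof. by move=> s0 uv; rewrite ler_expR lerN2 shifted_le. Qed.

Lemma measurable_decay1 s u : measurable_fun setT (decay s u).
Proof.
apply: measurableT_comp => //; apply: measurable_funN.
by apply: measurable_funB; exact: mY.
Qed.

Lemma measurable_decay2 s w : 0 <= s ->
  measurable_fun (setT : set (measurableTypeR R)) (fun u => decay s u w).
Proof.
move=> s0; apply: measurableT_comp => //; apply: measurable_funN.
by apply: nondecreasing_measurable => // u v uv; exact: shifted_le.
Qed.

Lemma Jint_le s r w : 0 <= s -> 0 <= r -> Jint s r w <= r.
Proof.
move=> s0 r0.
exact: (primitive_le (measurable_decay2 w s0) (fun u => decay01 u w s0) r0).
Qed.

Lemma Jint_ge s r w : 0 <= s -> 0 <= r -> r * decay s r w <= Jint s r w.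
Proof.
move=> s0 r0; have := @primitive_step R _ (measurable_decay2 w s0) (fun u => decay01 u w s0)
  (fun u v _ uv => decay_le w s0 uv) 0 r (lexx 0) r0.
rewrite subr0 [X in _ - X]/Rintegral set_itv1 integral_set1 subr0 mulrC.
by move=> /andP[].
Qed.

Lemma Jint_gt0 s r w : 0 <= s -> 0 < r -> 0 < Jint s r w.
Proof.
by move=> s0 r0; apply: lt_le_trans (Jint_ge w s0 (ltW r0)); rewrite mulr_gt0 ?expR_gt0.
Qed.

Lemma measurable_Jint s r : 0 <= s -> 0 <= r -> measurable_fun setT (Jint s r).
Proof.
move=> s0 r0; apply: (@measurable_riemann R _ T (fun u w => decay s u w)) => //.
- by move=> u _; exact: measurable_decay1.
- by move=> w; exact: measurable_decay2.
- by move=> u w; exact: decay01.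
- by move=> w u v _ uv; exact: decay_le.
Qed.

Lemma pathL_incr s h m w : 0 <= s -> 0 <= h ->
  pathL m (incr s h w) = shifted s (m%:R * h) w.
Proof.
move=> s0 h0; rewrite /shifted max_l ?mulr_ge0//.
elim: m => [|m IH]; first by rewrite /pathL big_geq// mul0r addr0 subrr.
rewrite /pathL big_nat_recr//= -/(pathL m _) IH max_l /incr; first by ring.
by rewrite subr_ge0 Yle ?addr_ge0 ?mulr_ge0// lerD2l ler_wpM2r// ler_nat.
Qed.

Lemma pathA_incr s h m w : 0 <= s -> 0 <= h ->
  pathA m h (incr s h w) = h * \sum_(0 <= j < m) decay s (j.+1%:R * h) w.
Proof.
by move=> s0 h0; congr (_ * _); apply: eq_bigr => j _; rewrite pathL_incr.
Qed.

Lemma measurable_incr s h i : measurable_fun setT (fun w => incr s h w i).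
Proof. by apply: measurable_funB; exact: mY. Qed.

Variable z : R[i].
Hypothesis z0 : 0 < Re z.

Definition pathG (n m : nat) (h : R) (x : nat -> R) : R[i] :=
  wpow z n (pathL m x) (pathA m h x).

Lemma cmeas_wpow d' (U : measurableType d') n (l a : U -> R) :
  measurable_fun setT l -> measurable_fun setT a ->
  cmeas setT (fun w => wpow z n (l w) (a w)).
Proof.
move=> ml ma; apply: cmeasM; last exact: cmeas_cpow.
apply: cmeas_cexp => //; apply: cmeasN; apply: cmeasM; first exact: cmeas_cst.
exact: cmeas_real.
Qed.

Lemma pathG_cvg n s r w : 0 <= s -> 0 < r ->
  cmod (pathG n m.+1 (r / m.+1%:R) (incr s (r / m.+1%:R) w) -
    wpow z n (shifted s r w) (Jint s r w)) @[m --> \oo] --> (0 : R).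
Proof.
move=> s0 r0.
have E m : cmod (pathG n m.+1 (r / m.+1%:R) (incr s (r / m.+1%:R) w) -
    wpow z n (shifted s r w) (Jint s r w)) = cmod (ce n%:R (shifted s r w)) *
    cmod (cpow (r / m.+1%:R * \sum_(0 <= j < m.+1) decay s (j.+1%:R * (r / m.+1%:R)) w) (z - 1) -
      cpow (Jint s r w) (z - 1)).
  have h0 : 0 <= r / m.+1%:R by rewrite divr_ge0// ltW.
  rewrite /pathG pathL_incr// pathA_incr// (_ : m.+1%:R * (r / m.+1%:R) = r); last by rewrite mulrC divfK.
  by rewrite /wpow -mulrBr cmodM.
rewrite (funext E) -[X in _ --> X](mulr0 (cmod (ce n%:R (shifted s r w)))); apply: cvgMr.
apply: cvg_cpow; first exact: Jint_gt0.
apply: (@riemann_cvg R _ T (fun u w => decay s u w)); last exact: ltW.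
- by move=> w'; exact: measurable_decay2.
- by move=> u w'; exact: decay01.
- by move=> w' u v _ uv; exact: decay_le.
Qed.

Lemma cmod_pathG n m h x : (0 < n)%N -> (0 < m)%N -> 0 < h ->
  cmod (pathG n m h x) <= (m%:R * h) `^ (Re z - 1).
Proof.
move=> n0 m0 h0; apply: cmod_wpow => //; first exact: pathL_ge0.
  by rewrite mulr_gt0// ltr0n.
by apply: pathA_bounds; exact: ltW.
Qed.

Lemma cmod_wpow_Jint n s r w : (0 < n)%N -> 0 <= s -> 0 < r ->
  cmod (wpow z n (shifted s r w) (Jint s r w)) <= r `^ (Re z - 1).
Proof.
move=> n0 s0 r0; apply: cmod_wpow => //; first exact: shifted_ge0.
by rewrite Jint_ge ?Jint_le// ltW.
Qed.

(** The functional of the path after [s] is the limit of the functionals [pathG] of [m.+1]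
    increments, for which the product rule follows from the hypothesis on boxes. The bound in
    [cmod_pathG] does not depend on [m], so dominated convergence applies to both sides. *)
Lemma increments_product (W : T -> R) (F : R -> R[i]) (CF : R) n (s r : R) :
  measurable_fun setT W -> cmeas setT F -> (forall x, cmod (F x) <= CF) ->
  (0 < n)%N -> 0 <= s -> 0 < r ->
  (forall m A (B : nat -> set R), measurable A -> (forall i, measurable (B i)) ->
    P (W @^-1` A `&` [set w | forall i, (i < m.+1)%N -> B i (incr s (r / m.+1%:R) w i)]) =
    (P (W @^-1` A) * P [set w | forall i, (i < m.+1)%N -> B i (incr 0 (r / m.+1%:R) w i)])%E) ->
  cintegral P setT (fun w => F (W w) * wpow z n (shifted s r w) (Jint s r w)) =
  cintegral P setT (fun w => F (W w)) *
  cintegral P setT (fun w => wpow z n (shifted 0 r w) (Jint 0 r w)).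
Proof.
move=> mW mF FC n0 s0 r0 H.
have CF0 : 0 <= CF by apply: le_trans (FC 0); exact: cmod_ge0.
pose h m : R := r / m.+1%:R.
have h0 m : 0 < h m by rewrite divr_gt0.
have mh m : m.+1%:R * h m = r by rewrite mulrC divfK.
have mFW : cmeas setT (fun w => F (W w)) by exact: cmeas_comp.
have mp s' m : measurable_fun setT ((fun w => incr s' (h m) w) : T -> pathType m.+1).
  by apply: measurable_path => i _; exact: measurable_incr.
have mG m : cmeas setT (pathG n m.+1 (h m) : pathType m.+1 -> R[i]).
  by apply: cmeas_wpow; [exact: measurable_pathL|exact: measurable_pathA].
have GC m x : cmod (pathG n m.+1 (h m) x) <= r `^ (Re z - 1).
  by rewrite -[X in X `^ _](mh m) cmod_pathG.
have EQ m : cintegral P setT (fun w => F (W w) * pathG n m.+1 (h m) (incr s (h m) w)) =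
    cintegral P setT (fun w => F (W w)) * cintegral P setT (fun w => pathG n m.+1 (h m) (incr 0 (h m) w)).
  apply: (@indep_cexpectation _ T R P _ _ _ (pathType m.+1) W (fun w => incr s (h m) w)
    (fun w => incr 0 (h m) w) mW (mp s m) (mp 0 m) _ F (pathG n m.+1 (h m)) CF (r `^ (Re z - 1))) => //.
  move=> A B mA mB; apply: path_law => //.
  - by rewrite -[X in measurable X]setTI; exact: mW.
  - by move=> i _; exact: measurable_incr.
  - by move=> i _; exact: measurable_incr.
  - by move=> B' mB'; exact: H.
have ms s' : 0 <= s' -> measurable_fun setT (shifted s' r).
  by move=> _; apply: measurable_funB; exact: mY.
have mlim s' : 0 <= s' -> cmeas setT (fun w => wpow z n (shifted s' r w) (Jint s' r w)).
  by move=> s'0; apply: cmeas_wpow; [exact: ms|apply: measurable_Jint => //; exact: ltW].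
have icst (c : R) : P.-integrable setT (EFin \o (fun=> c)) by exact: finite_measure_integrable_cst.
have lim1 : cmod (cintegral P setT (fun w => F (W w) * pathG n m.+1 (h m) (incr s (h m) w)) -
    cintegral P setT (fun w => F (W w) * wpow z n (shifted s r w) (Jint s r w))) @[m --> \oo] --> (0 : R).
  apply: (@cintegral_dct _ _ _ P setT measurableT
    (fun m w => F (W w) * pathG n m.+1 (h m) (incr s (h m) w)) _ (fun=> CF * r `^ (Re z - 1))) => //.
  - by move=> m; apply: cmeasM => //; exact: (cmeas_comp (mG m) (mp s m)).
  - by apply: cmeasM => //; exact: mlim.
  - move=> w _.
    have E m : cmod (F (W w) * pathG n m.+1 (h m) (incr s (h m) w) - F (W w) * wpow z n (shifted s r w) (Jint s r w)) =
        cmod (F (W w)) * cmod (pathG n m.+1 (h m) (incr s (h m) w) - wpow z n (shifted s r w) (Jint s r w)).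
      by rewrite -mulrBr cmodM.
    rewrite (funext E) -[X in _ --> X](mulr0 (cmod (F (W w)))); apply: cvgMr.
    exact: pathG_cvg.
  - by move=> m w _; rewrite cmodM ler_pM ?cmod_ge0.
have lim2 : cmod (cintegral P setT (fun w => pathG n m.+1 (h m) (incr 0 (h m) w)) -
    cintegral P setT (fun w => wpow z n (shifted 0 r w) (Jint 0 r w))) @[m --> \oo] --> (0 : R).
  apply: (@cintegral_dct _ _ _ P setT measurableT
    (fun m w => pathG n m.+1 (h m) (incr 0 (h m) w)) _ (fun=> r `^ (Re z - 1))) => //.
  - by move=> m; exact: (cmeas_comp (mG m) (mp 0 m)).
  - exact: mlim.
  - by move=> w _; exact: pathG_cvg.
apply: (cmod_limit_unique lim1).
have E m : cmod (cintegral P setT (fun w => F (W w) * pathG n m.+1 (h m) (incr s (h m) w)) -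
    cintegral P setT (fun w => F (W w)) * cintegral P setT (fun w => wpow z n (shifted 0 r w) (Jint 0 r w))) =
    cmod (cintegral P setT (fun w => F (W w))) *
    cmod (cintegral P setT (fun w => pathG n m.+1 (h m) (incr 0 (h m) w)) -
    cintegral P setT (fun w => wpow z n (shifted 0 r w) (Jint 0 r w))).
  by rewrite EQ -mulrBr cmodM.
by rewrite (funext E) -[X in _ --> X](mulr0 (cmod (cintegral P setT (fun w => F (W w))))); exact: cvgMr.
Qed.
End subordinators.

Section interval_fubini.
Context d (T : measurableType d) (R : realType) (P : probability T R).
Notation leb := (@lebesgue_measure R).

(** The independence lemma with a constant [W], which is independent of everything. *)
Lemma cintegral_same_law (X X' : T -> R) (F : R -> R[i]) (C : R) :
  measurable_fun setT X -> measurable_fun setT X' -> cmeas setT F ->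
  (forall x, cmod (F x) <= C) ->
  (forall B, measurable B -> P (X @^-1` B) = P (X' @^-1` B)) ->
  cintegral P setT (fun w => F (X w)) = cintegral P setT (fun w => F (X' w)).
Proof.
move=> mX mX' mF FC XX'.
have m1 : measurable_fun setT (fun _ : T => tt) by exact: measurable_cst.
have := @indep_cexpectation _ T R P _ _ _ _ (fun _ : T => tt) X X' m1 mX mX' _ (fun=> 1) F 1 C.
move=> /(_ _ (cmeas_cst _ _) mF _ FC) H.
have E1 : cintegral P setT (fun=> 1 : R[i]) = 1.
  have := @cintegral_real _ _ _ P setT (fun=> 1); rewrite Rintegral_cst// => ->.
  by rewrite mul1r; exact: (congr1 (fun x => (fine x)%:C) (probability_setT P)).
rewrite (_ : (fun w => F (X w)) = (fun w => 1 * F (X w))); last by apply/funext => w; rewrite mul1r.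
rewrite H ?E1 ?mul1r//; last by move=> _; rewrite cmod1.
move=> A B mA mB; rewrite preimage_cst; case: ifPn => _.
  by rewrite setTI XX'// probability_setT mul1e.
by rewrite set0I measure0 mul0e.
Qed.

Lemma cfubini_itv (H : R -> T -> R[i]) (b : R -> R) (t : R) :
  cmeas setT (fun p : measurableTypeR R * T => H p.1 p.2) ->
  leb.-integrable `[0, t] (EFin \o b) ->
  (forall r w, 0 <= r <= t -> cmod (H r w) <= b r) ->
  cintble leb `[0, t] (fun r => cintegral P setT (H r)) /\
  cintegral P setT (fun w => cintegral leb `[0, t] (fun r => H r w)) =
  cintegral leb `[0, t] (fun r => cintegral P setT (H r)).
Proof.
move=> mH ib Hb.
have mI := @measurable_itvR R `[0, t].
pose f (p : measurableTypeR R * T) : R[i] := cres `[0, t] (fun r => H r p.2) p.1.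
have fE r w : f (r, w) = if (0 <= r <= t) then H r w else 0.
  by rewrite /f /cres mem_setE in_itv.
have mf : cmeas setT f.
  rewrite (_ : f = fun p => if p.1 \in `[0, t] then H p.1 p.2 else 0); last first.
    by apply/funext => -[r w]; rewrite fE in_itv.
  apply: cmeas_if; [by []| |exact: mH|exact: cmeas_cst].
  apply: (measurable_fun_bool true) => //; rewrite setTI.
  rewrite (_ : _ @^-1` _ = (`[0, t]%classic : set (measurableTypeR R)) `*` (setT : set T)).
    by apply: measurableX.
  by apply/seteqP; split => -[r w] /=; [split|case].
pose b0 : measurableTypeR R -> R := fun r => (b \_ `[0, t]%classic) r.
have ib0 : leb.-integrable setT (EFin \o b0).
  pose b' : measurableTypeR R -> \bar R := EFin \o b.
  have := (integrable_mkcond b' mI).1 ib.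
  by apply: eq_integrable => // r _; rewrite /b0 /= /patch; case: ifP.
have icst (c : R) : P.-integrable setT (EFin \o (fun=> c)) by exact: finite_measure_integrable_cst.
have fb r w : cmod (f (r, w)) <= b0 r * 1.
  rewrite fE /b0 /patch mem_setE in_itv/= mulr1; case: ifPn => [h|_]; first exact: Hb.
  by rewrite cmod0.
have if_ := integrable_prod_dom mf ib0 (icst 1) fb.
have i1 r : cintble P setT (fun w => f (r, w)).
  apply: (cintble_dom measurableT _ (icst (b0 r * 1))); last by move=> w _; exact: fb.
  exact: (cmeas_comp mf (measurable_pair1 r)).
have i2 w : cintble leb setT (fun r => f (r, w)).
  apply: (cintble_dom measurableT _ ib0); last by move=> r _; rewrite -[leRHS]mulr1; exact: fb.
  exact: (cmeas_comp mf (measurable_pair2 w)).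
have e1 r : `[0, t]%classic r -> cintegral P setT (fun w => f (r, w)) = cintegral P setT (H r).
  by rewrite /= in_itv/= => h; apply: eq_cintegral => w _; rewrite fE h.
have E r : cintegral P setT (fun w => f (r, w)) = cres `[0, t] (fun r => cintegral P setT (H r)) r.
  rewrite /cres mem_setE; case: ifPn => h; first exact: e1.
  transitivity (cintegral P setT (fun=> (0 : R)%:C)).
    by apply: eq_cintegral => w _; rewrite fE; move: h; rewrite in_itv => /negbTE ->.
  by rewrite cintegral_real Rintegral_cst// mul0r.
split.
  apply: (eq_cintble mI e1); apply: (cintbleS measurableT mI (@subsetT _ _)).
  exact: (cintble_fubini1 mf if_ i1).
have := cfubini mf if_ i1 i2; rewrite (funext E) -cintegral_cres => ->.
by apply: eq_cintegral => w _; rewrite cintegral_cres.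
Qed.

Lemma joint_primitive (g : R -> T -> R) :
  measurable_fun setT (fun p : measurableTypeR R * T => g p.1 p.2) ->
  (forall r w, 0 <= g r w <= 1) ->
  measurable_fun setT (fun p : measurableTypeR R * T =>
    \int[leb]_(s in `[0, Num.max p.1 0]) g s p.2).
Proof.
move=> mg g01.
have mg2 w : measurable_fun (setT : set (measurableTypeR R)) (fun r => g r w).
  exact: (measurableT_comp mg (measurable_pair2 w)).
apply: (@measurable_right_continuous _ T R (fun s w => \int[leb]_(r in `[0, s]) g r w)) => [s s0|w s s0].
- have mI := @measurable_itvR R `[0, s].
  pose f (p : measurableTypeR R * T) : \bar R := ((if p.1 \in `[0, s] then g p.1 p.2 else 0)%:E).
  have mf : measurable_fun setT f.
    apply/measurable_EFinP; apply: measurable_fun_if => //.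
    + apply: (measurable_fun_bool true) => //; rewrite setTI.
      rewrite (_ : _ @^-1` _ = (`[0, s]%classic : set (measurableTypeR R)) `*` (setT : set T)).
        by apply: measurableX.
      by apply/seteqP; split => -[r w] /=; [split|case].
    + exact: measurable_funTS.
  have f0 p : (0 <= f p)%E.
    by rewrite lee_fin; case: ifP => // _; have /andP[] := g01 p.1 p.2.
  have := @measurable_fun_fubini_tonelli_G _ _ _ T R leb f mf f0.
  move=> /(measurableT_comp (@fine_measurable R _ measurableT)); apply: eq_measurable_fun => w _ /=.
  rewrite /fubini_G /Rintegral; congr fine; rewrite [RHS]integral_mkcond; apply: eq_integral => r _.
  by rewrite /f /patch/= mem_setE; case: ifP.
- have inc := primitive_increment (mg2 w) (g01 ^~ w).
  apply/cvgrPdist_le => e e0; near=> u.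
  have su : s < u by near: u; exact: nbhs_right_gt.
  have ue : u < s + e by near: u; apply: nbhs_right_lt; rewrite ltrDl.
  have /andP[h1 h2] := inc s u s0 (ltW su).
  by rewrite distrC ger0_norm// (le_trans h2)// lerBlDl ltW.
Unshelve. all: by end_near.
Qed.

(** Commutativity of the convolution of [g] with the constant 1. *)
Lemma Rintegral_reflect (g : R -> R) (r : R) : 0 <= r ->
  measurable_fun (setT : set (measurableTypeR R)) g -> (forall s, 0 <= g s <= 1) ->
  \int[leb]_(s in `[0, r]) g (r - s) = \int[leb]_(s in `[0, r]) g s.
Proof.
move=> r0 mg g01.
have lg : lbd (fun s => (g s)%:C).
  move=> T'; split; first by apply: cmeas_real; exact: measurable_funTS.
  by exists 1 => s _; have /andP[g0 g1] := g01 s; rewrite cmodC ger0_norm.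
have := @convC R _ _ r (lbd_lint lg) (lbd_cst 1).
have -> : conv (fun s => (g s)%:C) (fun=> 1) r = (\int[leb]_(s in `[0, r]) g s)%:C.
  by rewrite -cintegral_real; apply: eq_cintegral => s _; rewrite mulr1.
have -> : conv (fun=> 1) (fun s => (g s)%:C) r = (\int[leb]_(s in `[0, r]) g (r - s))%:C.
  by rewrite -cintegral_real; apply: eq_cintegral => s _; rewrite mul1r.
by move=> /complexI ->.
Qed.
End interval_fubini.

(** * The killed process and its moments *)

Section killed.
Context d (T : measurableType d) (R : realType) (P : probability T R).
Variables (phi : R[i] -> R[i]) (Y : R -> {RV P >-> R}) (e : {mfun T >-> \bar R}).
Variable z : R[i].
Notation leb := (@lebesgue_measure R).
Notation kap := (Re (phi 0)).
Hypothesis hY : subordinator Y.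
Hypothesis he : forall s : R, 0 <= s -> P [set w | (s%:E < e w)%E] = (expR (- (kap * s)))%:E.
Hypothesis hind : forall (A : set T) (B : set (\bar R)), sigma_of_process Y A ->
  measurable B -> P (A `&` e @^-1` B) = (P A * P (e @^-1` B))%E.
Hypothesis hX : forall (w : R[i]) (t : R), 0 <= Re w -> 0 <= t ->
  cexpectation P (fun x => cexpN w (if (t%:E < e x)%E then (Y t x)%:E else +oo%E)) = ce (phi w) t.
Hypothesis z0 : 0 < Re z.

Let Y0 w : Y 0 w = 0. Proof. by have [] := hY. Qed.
Let Yle w s t : 0 <= s -> s <= t -> Y s w <= Y t w.
Proof. by have [_ h _ _ _] := hY; exact: h. Qed.
Let Yge0 w s : 0 <= s -> 0 <= Y s w.
Proof. by move=> s0; rewrite -(Y0 w) Yle. Qed.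
Let mY s : measurable_fun setT (Y s : T -> R). Proof. exact: measurable_funPT. Qed.

(** The sample space with the sigma-algebra generated by [Y]; by [hind], its events are independent
    of the killing time. *)
Definition past := g_sigma_algebraType
  [set Y t @^-1` B | t in [set t : R | 0 <= t] & B in measurable].

Let mpast : measurable_fun setT (id : T -> past).
Proof.
apply: (@measurability _ _ T past setT id _ erefl).
move=> _ [_ [t t0 [B mB <-]] <-].
by rewrite setTI -[X in measurable X]setTI; exact: mY.
Qed.

Let mYpast s : 0 <= s -> measurable_fun setT (Y s : past -> R).
Proof.
move=> s0 _ B mB; rewrite setTI; apply: sub_sigma_algebra.
by exists s => //; exists B.
Qed.

Let malive (s : R) : measurable [set x : \bar R | (s%:E < x)%E].
Proof.
rewrite (_ : [set x | _] = `]s%:E, +oo[%classic); first exact: emeasurable_itv.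
by apply/seteqP; split => x /=; rewrite in_itv/= andbT.
Qed.

Lemma alive_product (s : R) (G : T -> R[i]) (C : R) : 0 <= s ->
  cmeas (setT : set past) G -> (forall w, cmod (G w) <= C) ->
  cintegral P setT (fun w => (if (s%:E < e w)%E then 1 else 0) * G w) =
  ce kap%:C s * cintegral P setT G.
Proof.
move=> s0 mG GC.
have me : measurable_fun setT (e : T -> \bar R) by exact: measurable_funPT.
pose F (x : \bar R) : R[i] := if (s%:E < x)%E then 1 else 0.
have mF : cmeas setT F.
  apply: cmeas_if; [by []| |exact: cmeas_cst|exact: cmeas_cst].
  by apply: (measurable_fun_bool true) => //; rewrite setTI; exact: malive.
have F1 x : cmod (F x) <= 1 by rewrite /F; case: ifP => _; rewrite ?cmod1 ?cmod0.
(* The whole path is represented by the identity from [T] to [past], the killing time playing the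
   part of [W]. *)
have H := @indep_cexpectation _ T R P _ _ _ past e id id me mpast mpast.
rewrite [LHS](H _ F G 1 C) //; last first.
  by move=> A B mA mB; rewrite setIC hind// muleC.
congr (_ * _).
rewrite (_ : (fun w => F (e w)) = fun w => (\1_[set w | (s%:E < e w)%E] w)%:C); last first.
  apply/funext => w; rewrite /F indicE; case: ifPn => h; first by rewrite mem_set.
  by rewrite memNset// => h'; move: h; rewrite h'.
rewrite cintegral_real /Rintegral integral_indic//; last first.
  by have := me measurableT _ (malive s); rewrite setTI.
by rewrite setIT [X in fine X]he//= /ce -rmorphM -rmorphN cexpC.
Qed.

Definition laplace (w : R[i]) (t : R) : R[i] := cintegral P setT (fun x => ce w (Y t x)).

Lemma cmeas_ce d' (U : measurableType d') (w : R[i]) (f : U -> R) :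
  measurable_fun setT f -> cmeas setT (fun x => ce w (f x)).
Proof.
move=> mf; apply: cmeas_cexp => //; apply: cmeasN; apply: cmeasM; first exact: cmeas_cst.
exact: cmeas_real.
Qed.

Lemma cmod_ce_le1 (w : R[i]) (y : R) : 0 <= Re w -> 0 <= y -> cmod (ce w y) <= 1.
Proof. by move=> w0 y0; rewrite cmod_ce -expR0 ler_expR oppr_le0 mulr_ge0. Qed.

Lemma laplaceE (w : R[i]) (t : R) : 0 <= Re w -> 0 <= t ->
  ce (phi w) t = ce kap%:C t * laplace w t.
Proof.
move=> w0 t0; rewrite -hX// cexpectationE -(@alive_product t _ 1)//.
- by apply: eq_cintegral => x _; case: ifP => _; rewrite ?mul1r ?mul0r.
- by apply: cmeas_ce; exact: mYpast.
- by move=> x; apply: cmod_ce_le1 => //; exact: Yge0.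
Qed.

Lemma laplace_increment (w : R[i]) (s r : R) : 0 <= Re w -> 0 <= s -> 0 <= r ->
  cintegral P setT (fun x => ce w (Num.max (Y (s + r) x - Y s x) 0)) = laplace w r.
Proof.
move=> w0 s0 r0; have [_ _ _ _ st] := hY.
pose F (y : R) := ce w (Num.max y 0).
have mF : cmeas setT F by apply: cmeas_ce; exact: measurable_maxr.
rewrite (_ : laplace w r = cintegral P setT (fun x => F (Y r x))); last first.
  by apply: eq_cintegral => x _; rewrite /F max_l// Yge0.
apply: (@cintegral_same_law _ T R P (fun x => Y (s + r) x - Y s x) (Y r) F 1) => //.
- exact: measurable_funB.
- by move=> y; apply: cmod_ce_le1 => //; rewrite le_max lexx orbT.
- by move=> B mB; exact: st.
Qed.

(** [V_n] for the unkilled process; [Vfun] adds the survival factor. *)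
Definition vfun (n : nat) (r : R) : R[i] :=
  cintegral P setT (fun x => wpow z n (shifted Y 0 r x) (Jint Y 0 r x)).

Lemma wpow0 n : wpow z n 0 0 = cpow 0 (z - 1).
Proof. by rewrite /wpow ce0 mul1r. Qed.

Lemma shifted0 s w : shifted Y s 0 w = 0.
Proof. by rewrite /shifted maxxx addr0 subrr. Qed.

Lemma Jint0 s w : Jint Y s 0 w = 0.
Proof. by rewrite /Jint set_itv1 Rintegral_set1. Qed.

Lemma cmod_wpow_Jint0 n s r w : (0 < n)%N -> 0 <= s -> 0 <= r ->
  cmod (wpow z n (shifted Y s r w) (Jint Y s r w)) <= r `^ (Re z - 1).
Proof.
move=> n0 s0; rewrite le_eqVlt => /orP[/eqP<-|r0]; last exact: cmod_wpow_Jint.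
rewrite shifted0 Jint0 wpow0 (_ : Re z - 1 = Re (z - 1)); last by rewrite ReD ReN.
exact: cmod_cpow_le.
Qed.

Lemma vfun0 n : vfun n 0 = cpow 0 (z - 1).
Proof.
rewrite /vfun (_ : (fun x => _) = fun=> cpow 0 (z - 1) * 1); last first.
  by apply/funext => x; rewrite shifted0 Jint0 wpow0 mulr1.
rewrite cintegralZ//; last by apply: (@cintble_probability _ _ _ _ _ 1); [exact: cmeas_cst|move=> _; rewrite cmod1].
rewrite (_ : cintegral _ _ _ = 1) ?mulr1// (cintegral_real P setT (fun=> 1)) Rintegral_cst//.
by rewrite mul1r; exact: (congr1 (fun x => (fine x)%:C) (probability_setT P)).
Qed.

(** Adds the end point [r = 0], where the functional is the constant [cpow 0 (z - 1)], so that the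
    product rule holds on all of [0, t]. *)
Lemma shifted_product (W : T -> R) (F : R -> R[i]) (CF : R) n (s r : R) :
  measurable_fun setT W -> cmeas setT F -> (forall x, cmod (F x) <= CF) ->
  (0 < n)%N -> 0 <= s -> 0 <= r ->
  (0 < r -> forall m A (B : nat -> set R), measurable A -> (forall i, measurable (B i)) ->
    P (W @^-1` A `&` [set w | forall i, (i < m.+1)%N -> B i (incr Y s (r / m.+1%:R) w i)]) =
    (P (W @^-1` A) * P [set w | forall i, (i < m.+1)%N -> B i (incr Y 0 (r / m.+1%:R) w i)])%E) ->
  cintegral P setT (fun w => F (W w) * wpow z n (shifted Y s r w) (Jint Y s r w)) =
  cintegral P setT (fun w => F (W w)) * vfun n r.
Proof.
move=> mW mF FC n0 s0; rewrite le_eqVlt => /orP[/eqP<-|r0] H.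
  have iF : cintble P setT (fun w => F (W w)).
    by apply: (@cintble_probability _ _ _ _ _ CF) => //; exact: cmeas_comp.
  rewrite vfun0.
  rewrite mulrC -cintegralZ//; apply: eq_cintegral => w _.
  by rewrite shifted0 Jint0 wpow0 mulrC.
exact: (increments_product hY z0 mW mF FC n0 s0 r0 (H r0)).
Qed.

Lemma future_product (m : nat) (h u t : R) A (B : nat -> set R) : 0 <= h ->
  m%:R * h = u -> u <= t -> measurable A -> (forall i, measurable (B i)) ->
  P ((fun w => (Y t w - Y u w)%R) @^-1` A `&` [set w | forall i, (i < m)%N -> B i (incr Y 0 h w i)]) =
  (P ((fun w => (Y t w - Y u w)%R) @^-1` A) * P [set w | forall i, (i < m)%N -> B i (incr Y 0 h w i)])%E.
Proof.
move=> h0 mh ut mA mB; have [_ _ _ ind _] := hY.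
(* The grid of [0, u] with the point [t] appended: the last increment is [Y t - Y u]. *)
pose t' i := if (i <= m)%N then i%:R * h else t.
pose B' i := if (i < m)%N then B i else A.
have E i w : (i < m)%N -> Y (t' i.+1) w - Y (t' i) w = incr Y 0 h w i.
  by move=> im; rewrite /t' im (ltnW im) /incr !add0r.
have Em w : Y (t' m.+1) w - Y (t' m) w = Y t w - Y u w.
  by rewrite /t' ltnn leqnn mh.
have mono i : t' i <= t' i.+1.
  rewrite /t'; case: (ltngtP i m) => [im|//|->]; last by rewrite mh.
  by rewrite ler_wpM2r// ler_nat.
have mB' i : measurable (B' i) by rewrite /B'; case: ifP.
have t0 : 0 <= t' 0%N by rewrite /t' leq0n mul0r.
have H1 := ind m.+1 t' B' t0 (fun i _ => mono i) mB'.
have H0 := ind m t' B' t0 (fun i _ => mono i) mB'.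
rewrite big_ord_recr/= -H0 in H1.
have S1 : \bigcap_(i < m) [set w | B' i (Y (t' i.+1) w - Y (t' i) w)] =
    [set w | forall i, (i < m)%N -> B i (incr Y 0 h w i)].
  apply/seteqP; split => w /= hw i im; have := hw i im.
    by rewrite /= E// /B' im.
  by rewrite /= E// /B' im.
have S2 : [set w | B' m (Y (t' m.+1) w - Y (t' m) w)] = (fun w => (Y t w - Y u w)%R) @^-1` A.
  by apply/seteqP; split => w /=; rewrite Em /B' ltnn.
rewrite S1 S2 in H1; rewrite muleC -H1; congr (P _).
apply/seteqP; split => w /=.
  move=> [wA wB] i; rewrite /= ltnS leq_eqVlt => /orP[/eqP->|im]; first by rewrite Em /B' ltnn.
  by rewrite E// /B' im; exact: wB.
move=> hw; split; first by have := hw m (ltnSn m); rewrite /= Em /B' ltnn.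
by move=> i im; have := hw i (ltnW im); rewrite /= E// /B' im.
Qed.

Lemma past_product (m : nat) (h s : R) A (B : nat -> set R) : 0 <= h -> 0 <= s ->
  measurable A -> (forall i, measurable (B i)) ->
  P (Y s @^-1` A `&` [set w | forall i, (i < m)%N -> B i (incr Y s h w i)]) =
  (P (Y s @^-1` A) * P [set w | forall i, (i < m)%N -> B i (incr Y 0 h w i)])%E.
Proof.
move=> h0 s0 mA mB; have [_ _ _ ind st] := hY.
(* The time 0 is put before the grid that starts at [s], so that [Y s] is the first increment;
   stationarity then moves the other increments to the grid at 0. *)
pose t' i : R := if i is i'.+1 then s + i'%:R * h else 0.
pose B' i := if i is i'.+1 then B i' else A.
have mono i : t' i <= t' i.+1.
  by case: i => [|i] /=; [rewrite mul0r addr0|rewrite lerD2l ler_wpM2r// ler_nat].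
have mB' i : measurable (B' i) by case: i.
have H1 := ind m.+1 t' B' (lexx 0) (fun i _ => mono i) mB'.
have mono0 i : (i%:R * h : R) <= i.+1%:R * h by rewrite ler_wpM2r// ler_nat.
have z00 : 0 <= (0%:R * h : R) by rewrite mul0r.
have H0 := ind m (fun i => i%:R * h) B z00 (fun i _ => mono0 i) mB.
rewrite big_ord_recl/= in H1.
have st1 (u : R) i : 0 <= u -> P [set w | B i (incr Y u h w i)] = P [set w | B i (Y h w)].
  move=> u0; have := st (u + i%:R * h) h (B i) _ h0 (mB i).
  rewrite -addrA (_ : i%:R * h + h = i.+1%:R * h); last by rewrite -natr1; ring.
  by apply; rewrite addr_ge0// mulr_ge0.
have S0 : \bigcap_(i < m) [set w | B i (Y (i.+1%:R * h) w - Y (i%:R * h) w)] =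
    [set w | forall i, (i < m)%N -> B i (incr Y 0 h w i)].
  by apply/seteqP; split => w /= hw i im; have := hw i im; rewrite /incr /= !add0r.
rewrite S0 in H0; rewrite H0.
transitivity (P (\bigcap_(i < m.+1) [set w | B' i (Y (t' i.+1) w - Y (t' i) w)])).
  congr (P _); apply/seteqP; split => w /=.
    by move=> [wA wB] [|i] im /=; [rewrite mul0r addr0 Y0 subr0|exact: wB].
  move=> hw; split; last by move=> i im; exact: (hw i.+1 im).
  by have := hw 0%N (ltn0Sn m); rewrite /= mul0r addr0 Y0 subr0.
rewrite H1; congr (_ * _)%E.
  by congr (P _); apply/seteqP; split => w /=; rewrite mul0r addr0 Y0 subr0.
apply: eq_bigr => i _ /=.
have := st1 0 i (lexx 0); rewrite /incr !add0r => ->.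
exact: (st1 s i s0).
Qed.

Lemma joint_Y : measurable_fun setT (fun p : measurableTypeR R * T => Y (Num.max p.1 0) p.2 : R).
Proof.
have [_ _ rc _ _] := hY.
by apply: (@measurable_right_continuous _ T R (fun s w => Y s w)) => [s _|w s s0]; [exact: mY|exact: rc].
Qed.

Lemma joint_decay : measurable_fun setT (fun p : measurableTypeR R * T => decay Y 0 p.1 p.2).
Proof.
apply: measurableT_comp => //; apply: measurable_funN; apply: measurable_funB.
  rewrite (_ : (fun _ => _) = (fun p : measurableTypeR R * T => Y (Num.max p.1 0) p.2 : R)); first exact: joint_Y.
  by apply/funext => p /=; rewrite add0r.
exact: (measurableT_comp (mY 0) measurable_snd).
Qed.

Lemma ce1 (y : R) : ce 1 y = (expR (- y))%:C.
Proof. by have := @ce_nat R 1 y; rewrite mul1r. Qed.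

Lemma cpow_scale (y J : R) (w : R[i]) : 0 <= J -> cpow (expR (- y) * J) w = ce w y * cpow J w.
Proof.
rewrite le_eqVlt => /orP[/eqP<-|J0].
  rewrite mulr0; have [->|w0] := eqVneq w 0; first by rewrite ce_0 mul1r.
  by rewrite !cpow0// mulr0.
rewrite !cpowE ?mulr_gt0 ?expR_gt0// lnM ?posrE ?expR_gt0// expRK /ce -cexpD.
by congr cexp; rewrite rmorphD/= rmorphN; ring.
Qed.

Let mI (t : R) := @measurable_itvR R `[0, t].

Let cm_joint n (t : R) (A : R -> T -> R) (g : R -> T -> R) :
  measurable_fun setT (fun p : measurableTypeR R * T => A p.1 p.2) ->
  measurable_fun setT (fun p : measurableTypeR R * T => g p.1 p.2) ->
  cmeas setT (fun p : measurableTypeR R * T =>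
    ce n%:R (Y t p.2) * (cpow (A p.1 p.2) (z - 1) * (g p.1 p.2)%:C)).
Proof.
move=> mA mg; apply: cmeasM.
  by apply: cmeas_ce; exact: (measurableT_comp (mY t) measurable_snd).
by apply: cmeasM; [exact: cmeas_cpow|exact: cmeas_real].
Qed.

Let Jmax (r : R) w : 0 <= r -> \int[leb]_(s in `[0, Num.max r 0]) decay Y 0 s w = Jint Y 0 r w.
Proof. by move=> r0; rewrite max_l. Qed.

Let shifted0E (r : R) w : 0 <= r -> shifted Y 0 r w = Y r w.
Proof. by move=> r0; rewrite /shifted max_l// add0r Y0 subr0. Qed.

Lemma fubini_moment (Q : T -> R[i]) (H : R -> T -> R[i]) (t : R) : 0 <= t ->
  cintble P setT Q -> cmeas setT (fun p : measurableTypeR R * T => H p.1 p.2) ->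
  (forall r w, 0 <= r <= t -> cmod (H r w) <= r `^ (Re z - 1)) ->
  (forall w, z * cintegral leb `[0, t] (fun r => H r w) = Q w) ->
  cintble leb `[0, t] (fun r => cintegral P setT (H r)) /\
  cintegral P setT Q = z * cintegral leb `[0, t] (fun r => cintegral P setT (H r)).
Proof.
move=> t0 iQ mH Hb HQ; have zn0 : z != 0 by apply: contraTneq z0 => ->; rewrite ltxx.
have [i1 <-] := cfubini_itv P mH (integrable_powR z0 t0).1 Hb; split=> //.
rewrite (_ : (fun w => cintegral leb _ _) = fun w => z^-1 * Q w); last first.
  by apply/funext => w; rewrite -HQ mulKf.
by rewrite cintegralZ// mulVKf.
Qed.

Lemma path_moment (f : R -> R) (c : R[i]) (h : R -> R[i]) (t : R) : 0 <= t ->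
  measurable_fun (setT : set (measurableTypeR R)) f -> (forall s, 0 <= f s <= 1) ->
  (forall s, 0 < s -> 0 < \int[leb]_(r in `[0, s]) f r) ->
  (forall r, 0 <= r <= t -> h r = c * (cpow (\int[leb]_(s in `[0, r]) f s) (z - 1) * (f r)%:C)) ->
  z * cintegral leb `[0, t] h = c * cpow (\int[leb]_(s in `[0, t]) f s) z.
Proof.
move=> t0 mf f01 A0 hE; rewrite -(cintegral_power mf f01 A0 z0 t0).
have i := cintble_power mf f01 A0 z0 t0.
have -> : cintegral leb `[0, t] h =
    c * cintegral leb `[0, t] (fun r => cpow (\int[leb]_(s in `[0, r]) f s) (z - 1) * (f r)%:C).
  by rewrite -(cintegralZ (mI t) c i); apply: eq_cintegral => r; rewrite /= in_itv/=; exact: hE.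
exact: mulrCA.
Qed.

Let cintble_moment n (t : R) : 0 <= t ->
  cintble P setT (fun w => ce n%:R (Y t w) * cpow (Jint Y 0 t w) z).
Proof.
move=> t0; apply: (@cintble_probability _ _ _ _ _ (t `^ Re z)).
  apply: cmeasM; first exact: cmeas_ce.
  by apply: cmeas_cpow => //; apply: measurable_Jint.
move=> w; rewrite cmodM -[leRHS]mul1r ler_pM ?cmod_ge0//.
  by apply: cmod_ce_le1; rewrite ?Re_nat// Yge0.
have [J0 Jt] : 0 <= Jint Y 0 t w /\ Jint Y 0 t w <= t.
  split; last exact: Jint_le.
  by apply: le_trans (Jint_ge hY w (lexx 0) t0); rewrite mulr_ge0// expR_ge0.
rewrite (le_trans (cmod_cpow_le _ J0))// ge0_ler_powR ?nnegrE//; exact: ltW.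
Qed.

(* Split at [r] through [J r]: [e^{-n Y_t} = e^{-n Y_r} e^{-n (Y_t - Y_r)}]. *)
Lemma moment_future n (t : R) : (0 < n)%N -> 0 <= t ->
  cintegral P setT (fun w => ce n%:R (Y t w) * cpow (Jint Y 0 t w) z) =
  z * conv (vfun n.+1) (laplace n%:R) t.
Proof.
move=> n0 t0.
pose H (r : R) (w : T) : R[i] := ce n%:R (Y t w) *
  (cpow (\int[leb]_(s in `[0, Num.max r 0]) decay Y 0 s w) (z - 1) * (decay Y 0 r w)%:C).
have n0' : 0 <= Re (n%:R : R[i]) by rewrite Re_nat.
(* The density [decay] of [J] supplies one more factor [exp (- Y_r)], hence the index [n.+1]. *)
have HE r w : 0 <= r <= t -> H r w =
    ce n%:R (Num.max (Y t w - Y r w) 0) * wpow z n.+1 (shifted Y 0 r w) (Jint Y 0 r w).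
  move=> /andP[r0 rt]; rewrite /H Jmax// max_l ?subr_ge0 ?Yle// /wpow shifted0E//.
  have -> : (decay Y 0 r w)%:C = ce 1 (Y r w).
    by rewrite /decay shifted0E// ce1.
  rewrite -natr1 ceD (_ : ce n%:R (Y t w) = ce n%:R (Y t w - Y r w) * ce n%:R (Y r w)); last first.
    by rewrite -ce_add subrK.
  by ring.
have mH : cmeas setT (fun p : measurableTypeR R * T => H p.1 p.2).
  apply: (@cm_joint n t (fun r w => \int[leb]_(s in `[0, Num.max r 0]) decay Y 0 s w)); last exact: joint_decay.
  apply: (@joint_primitive _ T R (fun r w => decay Y 0 r w)); first exact: joint_decay.
  by move=> r w; exact: decay01.
have Hb r w : 0 <= r <= t -> cmod (H r w) <= r `^ (Re z - 1).
  move=> /[dup] /andP[r0 _] rt; rewrite HE// cmodM -[leRHS]mul1r ler_pM ?cmod_ge0//.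
    by apply: cmod_ce_le1 => //; rewrite le_max lexx orbT.
  exact: cmod_wpow_Jint0.
have HQ w : z * cintegral leb `[0, t] (fun r => H r w) = ce n%:R (Y t w) * cpow (Jint Y 0 t w) z.
  apply: (path_moment t0 (measurable_decay2 hY w (lexx 0)) (fun r => decay01 hY r w (lexx 0))
    (fun r r0 => Jint_gt0 hY w (lexx 0) r0)).
  by move=> r /andP[r0 _]; rewrite /H max_l.
have mW r : measurable_fun setT (fun w => Y t w - Y r w : R) by exact: measurable_funB.
have mF : cmeas setT (fun y : R => ce n%:R (Num.max y 0)) by apply: cmeas_ce; exact: measurable_maxr.
have F1 (y : R) : cmod (ce n%:R (Num.max y 0)) <= 1.
  by apply: cmod_ce_le1 => //; rewrite le_max lexx orbT.
have [_ ->] := fubini_moment t0 (cintble_moment n t0) mH Hb HQ.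
congr (_ * _); apply: eq_cintegral => r.
rewrite /= in_itv/= => /[dup] rt /andP[r0 rt'].
transitivity (cintegral P setT (fun w => ce n%:R (Num.max (Y t w - Y r w) 0) *
    wpow z n.+1 (shifted Y 0 r w) (Jint Y 0 r w))).
  by apply: eq_cintegral => w _; rewrite HE.
rewrite (@shifted_product (fun w => Y t w - Y r w) (fun y => ce n%:R (Num.max y 0)) 1 n.+1 0 r)//.
  have := @laplace_increment n%:R r (t - r) n0' r0; rewrite subrKC => ->; last by rewrite subr_ge0.
  by rewrite mulrC.
move=> rpos m A B mA mB; apply: future_product => //; first by rewrite divr_ge0.
by rewrite mulrC divfK.
Qed.

(* Split at [t - r] through [J t - J (t - r)], the functional of the shifted process
   scaled by [e^{-Y_{t-r}}]. *)
Lemma moment_past n (t : R) : (0 < n)%N -> 0 <= t ->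
  cintegral P setT (fun w => ce n%:R (Y t w) * cpow (Jint Y 0 t w) z) =
  z * conv (vfun n) (laplace (z + n%:R)) t.
Proof.
move=> n0 t0.
pose g (u : R) (w : T) : R := decay Y 0 (t - u) w.
pose A (r : R) (w : T) : R := \int[leb]_(s in `[0, Num.max r 0]) g s w.
pose H (r : R) (w : T) : R[i] := ce n%:R (Y t w) * (cpow (A r w) (z - 1) * (g r w)%:C).
have zn0 : 0 <= Re (z + n%:R) by rewrite ReD Re_nat addr_ge0// ltW.
have jg : measurable_fun setT (fun p : measurableTypeR R * T => g p.1 p.2).
  have m1 : measurable_fun setT (fun p : measurableTypeR R * T => ((t - p.1 : measurableTypeR R), p.2)).
    apply/measurable_fun_pairP; split; last exact: measurable_snd.
    by apply: (@measurable_funB _ _ R) => //; exact: measurable_fst.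
  exact: (measurableT_comp joint_decay m1).
have g01 u w : 0 <= g u w <= 1 by exact: decay01.
have mg w : measurable_fun (setT : set (measurableTypeR R)) (fun u => g u w).
  exact: (measurableT_comp jg (measurable_pair2 w)).
have AE r w : 0 <= r <= t -> A r w = expR (- Y (t - r) w) * Jint Y (t - r) r w.
  move=> /andP[r0 rt]; have tr : 0 <= t - r by rewrite subr_ge0.
  rewrite /A max_l// -(Rintegral_reflect r0 (mg w) (g01 ^~ w)) -RintegralZl//; last first.
    apply: (unit_integrable _ (fun u => decay01 hY u w tr)); last exact: leb_itv_lty.
    exact: measurable_decay2.
  apply: eq_Rintegral => u; rewrite inE/= in_itv/= => /andP[u0 ur].
  rewrite /g /decay shifted0E; last by lra.
  rewrite /shifted max_l// -expRD; congr expR.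
  by rewrite (_ : t - (r - u) = t - r + u); ring.
have HE r w : 0 <= r <= t -> H r w =
    ce (z + n%:R) (Num.max (Y (t - r) w) 0) * wpow z n (shifted Y (t - r) r w) (Jint Y (t - r) r w).
  move=> /[dup] rt0 /andP[r0 rt]; have tr : 0 <= t - r by rewrite subr_ge0.
  rewrite /H AE// cpow_scale; last first.
    by apply: le_trans (Jint_ge hY w tr r0); rewrite mulr_ge0// expR_ge0.
  rewrite max_l ?Yge0// /wpow /g.
  have -> : (decay Y 0 (t - r) w)%:C = ce 1 (Y (t - r) w).
    by rewrite /decay shifted0E// ce1.
  have -> : ce n%:R (Y t w) = ce n%:R (Y (t - r) w) * ce n%:R (shifted Y (t - r) r w).
    by rewrite -ce_add /shifted max_l// subrK addrC subrK.
  (* The exponent of [exp (- Y_{t-r})] collects [z - 1] from the scaled power, 1 from the density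
     [g] and [n] from the weight. *)
  rewrite (_ : z + n%:R = (z - 1) + 1 + n%:R); last by ring.
  by rewrite !ceD; ring.
have mH : cmeas setT (fun p : measurableTypeR R * T => H p.1 p.2).
  by apply: (@cm_joint n t A g) => //; exact: (@joint_primitive _ T R g).
have Hb r w : 0 <= r <= t -> cmod (H r w) <= r `^ (Re z - 1).
  move=> /[dup] /andP[r0 rt'] rt; rewrite HE// cmodM -[leRHS]mul1r ler_pM ?cmod_ge0//.
    by apply: cmod_ce_le1 => //; rewrite le_max lexx orbT.
  by apply: cmod_wpow_Jint0 => //; rewrite subr_ge0.
have A0 w r : 0 < r -> 0 < \int[leb]_(s in `[0, r]) g s w.
  move=> r0; have c0 : 0 < decay Y 0 t w by exact: expR_gt0.
  have icst := @integrable_cst_itv R `[0, r] 1 (leb_itv_lty 0 r).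
  apply: (@lt_le_trans _ _ (\int[leb]_(s in `[0, r]) (decay Y 0 t w * 1))).
    by rewrite RintegralZl// primitive_id ?ltW// mulr_gt0.
  apply: le_Rintegral => //; first exact: (integrableZl (mI r) _ icst).
    exact: (unit_integrable (mg w) (g01 ^~ w) (leb_itv_lty 0 r)).
  move=> s; rewrite /= in_itv/= => /andP[s0 _]; rewrite mulr1.
  by apply: decay_le => //; lra.
have HQ w : z * cintegral leb `[0, t] (fun r => H r w) = ce n%:R (Y t w) * cpow (Jint Y 0 t w) z.
  have -> : Jint Y 0 t w = \int[leb]_(r in `[0, t]) g r w.
    exact/esym/(Rintegral_reflect t0 (measurable_decay2 hY w (lexx 0)) (fun r => decay01 hY r w (lexx 0))).
  apply: (path_moment t0 (mg w) (g01 ^~ w) (A0 w)).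
  by move=> r /andP[r0 _]; rewrite /H /A max_l.
have [_ ->] := fubini_moment t0 (cintble_moment n t0) mH Hb HQ.
congr (_ * _); apply: eq_cintegral => r.
rewrite /= in_itv/= => /[dup] rt /andP[r0 rt'].
have tr : 0 <= t - r by rewrite subr_ge0.
have mF : cmeas setT (fun y : R => ce (z + n%:R) (Num.max y 0)) by apply: cmeas_ce; exact: measurable_maxr.
have F1 (y : R) : cmod (ce (z + n%:R) (Num.max y 0)) <= 1.
  by apply: cmod_ce_le1 => //; rewrite le_max lexx orbT.
transitivity (cintegral P setT (fun w => ce (z + n%:R) (Num.max (Y (t - r) w) 0) *
    wpow z n (shifted Y (t - r) r w) (Jint Y (t - r) r w))).
  by apply: eq_cintegral => w _; rewrite HE.
rewrite (@shifted_product (Y (t - r)) (fun y => ce (z + n%:R) (Num.max y 0)) 1 n (t - r) r)//.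
  rewrite mulrC; congr (_ * _); apply: eq_cintegral => w _.
  by rewrite max_l// Yge0.
by move=> rpos m B B' mB mB'; apply: past_product => //; rewrite divr_ge0.
Qed.

Lemma lint_vfun n : (0 < n)%N -> lint (vfun n).
Proof.
move=> n0 t; have [t0|t0] := ltP t 0.
  rewrite set_itv_ge ?bnd_simp -?ltNge//; split; exact: integrable_set0.
pose H (r : R) (w : T) : R[i] := wpow z n (shifted Y 0 r w)
  (\int[leb]_(s in `[0, Num.max r 0]) decay Y 0 s w).
have mH : cmeas setT (fun p : measurableTypeR R * T => H p.1 p.2).
  apply: cmeas_wpow.
    rewrite (_ : (fun _ => _) = (fun p : measurableTypeR R * T => Y (Num.max p.1 0) p.2 : R)); first exact: joint_Y.
    by apply/funext => p; rewrite /shifted add0r Y0 subr0.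
  apply: (@joint_primitive _ T R (fun r w => decay Y 0 r w)); first exact: joint_decay.
  by move=> r w; exact: decay01.
have Hb r w : 0 <= r <= t -> cmod (H r w) <= r `^ (Re z - 1).
  by move=> /andP[r0 _]; rewrite /H Jmax//; exact: cmod_wpow_Jint0.
have [i1 _] := cfubini_itv P mH (integrable_powR z0 t0).1 Hb.
apply: (eq_cintble (mI t) _ i1) => r; rewrite /= in_itv/= => /andP[r0 _].
by apply: eq_cintegral => w _; rewrite /H Jmax.
Qed.

Definition Vfun (n : nat) (r : R) : R[i] := ce kap%:C r * vfun n r.

Lemma lint_Vfun n : (0 < n)%N -> lint (Vfun n).
Proof. by move=> n0; apply: lintM; [exact: lbd_ce|exact: lint_vfun]. Qed.

Lemma conv_Vfun n (w : R[i]) (t : R) : (0 < n)%N -> 0 <= Re w -> 0 <= t ->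
  conv (Vfun n) (ce (phi w)) t = ce kap%:C t * conv (vfun n) (laplace w) t.
Proof.
move=> n0 w0 t0; have lv := lint_vfun n0.
pose f (s : R) := ce (- kap%:C) s * ce (phi w) s.
have lf : lbd f by apply: lbdM; exact: lbd_ce.
transitivity (ce kap%:C t * conv (vfun n) f t).
  rewrite -(conv_ce kap%:C t lv lf); apply: eq_conv => // s _.
  by rewrite /f mulrA [ce _ s * ce _ s]mulrC ceN mul1r.
congr (_ * _); apply: eq_conv => // s /andP[s0 _].
by rewrite /f laplaceE// mulrA ceN mul1r.
Qed.

Lemma Vfun_recursion n (t : R) : (0 < n)%N ->
  conv (Vfun n) (ce (phi (z + n%:R))) t = conv (Vfun n.+1) (ce (phi n%:R)) t.
Proof.
move=> n0; have [t0|t0] := ltP t 0; first by rewrite !conv_neg.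
have zn0 : z != 0 by apply: contraTneq z0 => ->; rewrite ltxx.
have r1 : 0 <= Re (z + n%:R) by rewrite ReD Re_nat addr_ge0// ltW.
have r2 : 0 <= Re (n%:R : R[i]) by rewrite Re_nat.
rewrite (conv_Vfun n0 r1 t0) (conv_Vfun (ltn0Sn n) r2 t0).
suff E : conv (vfun n) (laplace (z + n%:R)) t = conv (vfun n.+1) (laplace n%:R) t by rewrite E.
have := etrans (esym (moment_past n0 t0)) (moment_future n0 t0).
by move=> /(mulfI zn0).
Qed.

Let alive (s : R) (w : T) : R := if (s%:E < e w)%E then 1 else 0.

Let joint_alive : measurable_fun setT (fun p : measurableTypeR R * T => alive (Num.max p.1 0) p.2).
Proof.
have me : measurable_fun setT (e : T -> \bar R) by exact: measurable_funPT.
apply: (@measurable_right_continuous _ T R alive) => [s _|w s s0].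
  apply: measurable_fun_if => //.
  by apply: (measurable_fun_bool true) => //; exact: (me measurableT _ (malive s)).
rewrite /alive; case: ifPn => se; last first.
  apply: cvg_near_cst; near=> u; have su : s < u by near: u; exact: nbhs_right_gt.
  by rewrite ifF//; apply/negbTE; move: se; rewrite -!leNgt => /le_trans; apply; rewrite lee_fin ltW.
apply: cvg_near_cst; move: se; case: (e w) => [a| |//] sa.
- near=> u; rewrite ifT// lte_fin; near: u; exact: nbhs_right_lt.
- by near=> u; rewrite ifT// ltry.
Unshelve. all: by end_near.
Qed.

Let alive01 s w : 0 <= alive s w <= 1.
Proof. by rewrite /alive; case: ifP => _; rewrite ?lexx ?ler01. Qed.

(** The power rule along the killed path, whose integrand is 0 after killing. At a surviving time
    [r] the killed and unkilled integrals coincide, and independence of [e] from the path yields the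
    factor [exp (- kap r)] of [Vfun]. *)
Lemma moment_functional (X : R -> T -> \bar R) (t : R) : 0 <= t ->
  (forall s w, 0 <= s -> X s w = if (s%:E < e w)%E then (Y s w)%:E else +oo%E) ->
  cexpectation P (fun w => cpow (exp_functional X t w) z) = z * conv (Vfun 1) (fun=> 1) t.
Proof.
move=> t0 XE; have zn0 : z != 0 by apply: contraTneq z0 => ->; rewrite ltxx.
pose g (s : R) (w : T) : R := alive (Num.max s 0) w * decay Y 0 s w.
have g01 s w : 0 <= g s w <= 1.
  have /andP[a0 a1] := alive01 (Num.max s 0) w; have /andP[d0 d1] := decay01 hY s w (lexx 0).
  by rewrite mulr_ge0//= mulr_ile1.
have jg : measurable_fun setT (fun p : measurableTypeR R * T => g p.1 p.2).
  by apply: measurable_funM; [exact: joint_alive|exact: joint_decay].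
have mg w : measurable_fun (setT : set (measurableTypeR R)) (fun u => g u w).
  exact: (measurableT_comp jg (measurable_pair2 w)).
have gE s w : 0 <= s -> g s w = alive s w * expR (- Y s w).
  by move=> s0; rewrite /g max_l// /decay shifted0E.
have IE w : exp_functional X t w = \int[leb]_(s in `[0, t]) g s w.
  rewrite /exp_functional /Rintegral; congr fine; apply: eq_integral => s.
  rewrite inE/= in_itv/= => /andP[s0 _]; rewrite gE// XE// /alive.
  by case: ifP => _; rewrite ?mul1r ?mul0r.
have Ialive w r : 0 <= r -> (r%:E < e w)%E -> \int[leb]_(s in `[0, r]) g s w = Jint Y 0 r w.
  move=> r0 re; apply: eq_Rintegral => s; rewrite inE/= in_itv/= => /andP[s0 sr].
  rewrite /g max_l// /alive ifT ?mul1r//; apply: le_lt_trans re; by rewrite lee_fin.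
pose H (r : R) (w : T) : R[i] := (alive (Num.max r 0) w)%:C * wpow z 1 (shifted Y 0 r w)
  (\int[leb]_(s in `[0, Num.max r 0]) decay Y 0 s w).
have mH : cmeas setT (fun p : measurableTypeR R * T => H p.1 p.2).
  apply: cmeasM; first exact: (cmeas_real joint_alive).
  apply: cmeas_wpow.
    rewrite (_ : (fun _ => _) = (fun p : measurableTypeR R * T => Y (Num.max p.1 0) p.2 : R)); first exact: joint_Y.
    by apply/funext => p; rewrite /shifted add0r Y0 subr0.
  apply: (@joint_primitive _ T R (fun r w => decay Y 0 r w)); first exact: joint_decay.
  by move=> r w; exact: decay01.
have Hb r w : 0 <= r <= t -> cmod (H r w) <= r `^ (Re z - 1).
  move=> /andP[r0 _]; rewrite /H Jmax// cmodM -[leRHS]mul1r ler_pM ?cmod_ge0//.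
    by have /andP[a0 a1] := alive01 (Num.max r 0) w; rewrite cmodC ger0_norm.
  exact: cmod_wpow_Jint0.
have HE r w : 0 <= r -> H r w = 1 * (cpow (\int[leb]_(s in `[0, r]) g s w) (z - 1) * (g r w)%:C).
  move=> r0; rewrite /H Jmax// gE// max_l// mul1r /alive; case: ifPn => re; last by rewrite !mul0r mulr0.
  rewrite Ialive// !mul1r /wpow shifted0E// mulrC; congr (_ * _).
  exact: ce1.
have HQ w : z * cintegral leb `[0, t] (fun r => H r w) = cpow (\int[leb]_(s in `[0, t]) g s w) z.
  (* The power rule asks for a positive primitive at positive times, which holds if killing occurs
     after time 0. Otherwise the functional is 0 and both sides vanish, because [cpow 0 z = 0]. *)
  have [e0|e0] := ltP 0%E (e w).
    rewrite -[RHS]mul1r; apply: (path_moment t0 (mg w) (g01 ^~ w)) => [s s0|r /andP[r0 _]]; last exact: HE.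
    have [m /andP[m0 ms] me] : exists2 m : R, 0 < m <= s & (m%:E < e w)%E.
      move: e0; case: (e w) => [a| |]; rewrite ?lte_fin// => a0.
        exists (Num.min s (a / 2)); first by rewrite lt_min s0 divr_gt0// ge_min lexx.
        by rewrite lte_fin gt_min orbC ltr_pdivrMr// ltr_pMr// ltr1n.
      by exists s; rewrite ?s0 ?lexx// ltry.
    apply: (lt_le_trans _ (primitive_homo (mg w) (g01 ^~ w) ms)).
    by rewrite Ialive ?(ltW m0)//; exact: Jint_gt0.
  have a0 s : 0 <= s -> alive s w = 0.
    by move=> s0; rewrite /alive ifF//; apply/negbTE; rewrite -leNgt (le_trans e0)// lee_fin.
  have -> : \int[leb]_(s in `[0, t]) g s w = 0.
    rewrite (_ : \int[leb]_(s in `[0, t]) g s w = \int[leb]_(s in `[0, t]) (cst 0 s)).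
      by rewrite /Rintegral integral0_eq.
    apply: eq_Rintegral => s; rewrite inE/= in_itv/= => /andP[s0 _].
    by rewrite gE// a0// mul0r.
  rewrite cpow0// (_ : cintegral _ _ _ = 0) ?mulr0//.
  rewrite (_ : cintegral _ _ _ = cintegral leb `[0, t] (fun r => (cst 0 r)%:C)).
    by rewrite cintegral_real /Rintegral integral0_eq.
  apply: eq_cintegral => s; rewrite /= in_itv/= => /andP[s0 _].
  by rewrite /H max_l// a0// mul0r.
have mA : measurable_fun setT (fun w => \int[leb]_(s in `[0, t]) g s w).
  have := measurableT_comp (joint_primitive jg g01) (measurable_pair1 (t : measurableTypeR R)).
  by rewrite /comp/= max_l.
have iQ : cintble P setT (fun w => cpow (\int[leb]_(s in `[0, t]) g s w) z).
  apply: (@cintble_probability _ _ _ _ _ (t `^ Re z)); first exact: cmeas_cpow.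
  move=> w; have g0 : 0 <= \int[leb]_(s in `[0, t]) g s w.
    by apply: Rintegral_ge0 => s _; have /andP[] := g01 s w.
  rewrite (le_trans (cmod_cpow_le _ g0))// ge0_ler_powR ?nnegrE//; first exact: ltW.
  exact: (primitive_le (mg w) (g01 ^~ w)).
rewrite cexpectationE (funext (fun w => congr1 (fun a => cpow a z) (IE w))).
have [_ ->] := fubini_moment t0 iQ mH Hb HQ.
congr (_ * _); apply: eq_cintegral => r; rewrite /= in_itv/= => /andP[r0 _]; rewrite mulr1.
pose G (w : T) := wpow z 1 (shifted Y 0 r w) (Jint Y 0 r w).
have mG : cmeas (setT : set past) G.
  apply: cmeas_wpow.
    rewrite (_ : shifted Y 0 r = Y r :> (past -> R)); first exact: mYpast.
    by apply/funext => w; rewrite shifted0E.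
  apply: (@measurable_riemann R _ past (fun u w => decay Y 0 u w)) => //.
  - move=> u u0; rewrite (_ : decay Y 0 u = (fun w => expR (- Y u w)) :> (past -> R)).
      by apply: measurableT_comp => //; apply: measurable_funN; exact: mYpast.
    by apply/funext => w; rewrite /decay shifted0E.
  - by move=> w; exact: measurable_decay2.
  - by move=> u w; exact: decay01.
  - by move=> w u v _ uv; exact: decay_le.
have GC w : cmod (G w) <= r `^ (Re z - 1) by exact: cmod_wpow_Jint0.
transitivity (cintegral P setT (fun w => (if (r%:E < e w)%E then 1 else 0) * G w)).
  apply: eq_cintegral => w _; rewrite /H max_l// /alive /G /Jint.
  by case: ifP.
exact: (alive_product r0 mG GC).
Qed.

(** For [x < 2] the worst case is [u = s * expR (- y)], which costs [expR ((2 - x) * y)]. The factor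
    [expR (2 * y)] is the reason for the index [n.+2] in [Vfun_estimate]. *)
Lemma power_ratio_bound (s J y x u : R) : 0 < s -> 0 <= y -> 0 < x -> s * expR (- y) <= J ->
  J <= u <= s -> u `^ (x - 2) <= s `^ (x - 2) * expR (2 * y).
Proof.
move=> s0 y0 x0 sJ /andP[Ju us].
have se : 0 < s * expR (- y) by rewrite mulr_gt0 ?expR_gt0.
have u0 : 0 < u by rewrite (lt_le_trans se)// (le_trans sJ).
have [x2|x2] := leP 2 x.
  apply: (@le_trans _ _ (s `^ (x - 2))).
    by rewrite ge0_ler_powR ?nnegrE ?subr_ge0//; exact: ltW.
  by rewrite ler_peMr ?powR_ge0// -expR0 ler_expR mulr_ge0.
apply: (@le_trans _ _ ((s * expR (- y)) `^ (x - 2))).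
  rewrite -(opprB 2) !powRN lef_pV2 ?posrE ?powR_gt0// ge0_ler_powR ?nnegrE//.
  - lra.
  - exact: ltW.
  - exact: ltW.
  - exact: le_trans sJ Ju.
rewrite powRM ?expR_ge0 ?(ltW s0)// ler_wpM2l ?powR_ge0// -expRM ler_expR; nra.
Qed.

(** Here [J] is compared with [s]: by the mean value theorem the powers differ by at most a multiple
    of [expR (2 * Y_s) * (s - J)], and [s - J <= s * (1 - expR (- Y_s))]. Against
    [exp (- (n + 2) Y_s)] this leaves [exp (- n Y_s) - exp (- (n + 1) Y_s)], whose expectation is
    known. *)
Lemma Vfun_estimate n (s : R) : 0 <= s ->
  cmod (z * Vfun n.+2 s - z * (ce (phi n.+2%:R) s * cpow s (z - 1))) <=
  cmod z * (cmod (z - 1) * s `^ (Re z - 1) * Re (ce (phi n%:R) s - ce (phi n.+1%:R) s)).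
Proof.
rewrite le_eqVlt => /orP[/eqP<-|s0].
  by rewrite /Vfun vfun0 !ce0 !mul1r !subrr cmod0 (_ : Re 0 = 0)// !mulr0.
have s0' := ltW s0.
have rn k : 0 <= Re (k%:R : R[i]) by rewrite Re_nat.
have ick k : cintble P setT (fun w => ce k%:R (Y s w)).
  apply: (@cintble_probability _ _ _ _ _ 1); first exact: cmeas_ce.
  by move=> w; apply: cmod_ce_le1 => //; exact: Yge0.
have iw : cintble P setT (fun w => wpow z n.+2 (shifted Y 0 s w) (Jint Y 0 s w)).
  apply: (@cintble_probability _ _ _ _ _ (s `^ (Re z - 1))).
    apply: cmeas_wpow; last exact: measurable_Jint.
    rewrite (_ : shifted Y 0 s = Y s :> (T -> R)); first exact: mY.
    by apply/funext => w; rewrite shifted0E.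
  by move=> w; exact: cmod_wpow_Jint0.
rewrite laplaceE// -mulrBr cmodM ler_wpM2l ?cmod_ge0//.
rewrite /Vfun -mulrA -mulrBr cmodM cmod_ce !laplaceE// -mulrBr.
have -> : Re (ce kap%:C s * (laplace n%:R s - laplace n.+1%:R s)) =
    expR (- (kap * s)) * Re (laplace n%:R s - laplace n.+1%:R s).
  by rewrite /ce -rmorphM -rmorphN cexpC ReMc.
rewrite (_ : Re kap%:C = kap)// [leRHS]mulrCA ler_wpM2l ?expR_ge0//.
have -> : laplace n.+2%:R s * cpow s (z - 1) = cintegral P setT (fun w => cpow s (z - 1) * ce n.+2%:R (Y s w)).
  by rewrite mulrC cintegralZ.
have icp := cintbleZ measurableT (cpow s (z - 1)) (ick n.+2).
rewrite /vfun -cintegralB// /laplace -cintegralB//.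
have iB := cintbleB measurableT (ick n) (ick n.+1).
set K := cmod (z - 1) * s `^ (Re z - 1).
rewrite [leRHS](_ : _ = \int[P]_w (K * Re (ce n%:R (Y s w) - ce n.+1%:R (Y s w)))); last first.
  by rewrite RintegralZl//; exact: iB.1.
apply: cmod_cintegral_le => //.
- exact: cintble_cmeas (cintbleB measurableT iw icp).
- exact: (integrableZl measurableT K iB.1).
- move=> w _; rewrite shifted0E// /wpow [cpow s _ * _]mulrC -mulrBr cmodM cmodB cmod_ce Re_nat.
  set y := Y s w; set J := Jint Y 0 s w.
  have y0 : 0 <= y by exact: Yge0.
  have sJ : s * expR (- y) <= J.
    by have := Jint_ge hY w (lexx 0) s0'; rewrite /decay shifted0E.
  have Js : J <= s by exact: Jint_le.
  have J0 : 0 < J by apply: lt_le_trans sJ; rewrite mulr_gt0 ?expR_gt0.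
  have := @cpow_lipschitz R (z - 1) J s (s `^ (Re z - 2) * expR (2 * y)) J0 Js.
  have Rz : Re (z - 1) - 1 = Re z - 2 by rewrite ReD ReN (_ : Re 1 = 1)//; ring.
  rewrite Rz => /(_ (fun u hu => power_ratio_bound s0 y0 z0 sJ hu)) lip.
  have sj : s - J <= s * (1 - expR (- y)) by rewrite mulrBr mulr1 lerD2l lerN2.
  have lip2 : cmod (cpow s (z - 1) - cpow J (z - 1)) <=
      cmod (z - 1) * (s `^ (Re z - 2) * expR (2 * y)) * (s * (1 - expR (- y))).
    rewrite (le_trans lip)// ler_wpM2l//.
    by rewrite mulr_ge0 ?cmod_ge0// mulr_ge0 ?powR_ge0 ?expR_ge0.
  rewrite (le_trans (ler_wpM2l (expR_ge0 _) lip2))//.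
  have ps : s `^ (Re z - 1) = s `^ (Re z - 2) * s.
    rewrite (_ : Re z - 1 = Re z - 2 + 1); last by ring.
    by rewrite powRD ?powRr1// (gt_eqF s0) implybT.
  rewrite !ce_nat -rmorphB /K ps /=.
  have e0 : expR (- (n.+2%:R * y)) * expR (2 * y) = expR (- (n%:R * y)).
    by rewrite -expRD; congr expR; rewrite -addn2 natrD; ring.
  have e1 : expR (- (n.+1%:R * y)) = expR (- (n%:R * y)) * expR (- y).
    by rewrite -expRD; congr expR; rewrite -natr1; ring.
  rewrite e1 -e0 le_eqVlt; apply/orP; left; apply/eqP; ring.
Qed.
End killed.

(** * Convergence of the truncated convolutions *)

Section bounds.
Context {R : realType}.
Notation leb := (@lebesgue_measure R).

Lemma wb_expo_iter N (q : nat -> R[i]) (B : R) (u : R -> R[i]) : 0 <= B ->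
  (forall k, 0 <= Re (q k)) -> lbd u -> wb B u -> wb B (expo_iter q N u).
Proof.
move=> B0; elim: N q u => //= N IH q u q0 hu Bu; apply: IH => //.
- by move=> k; exact: q0.
- exact: lbd_expo (lbd_lint hu).
- apply: wb_le (wb_expo B0 (q0 1%N) hu Bu).
  by rewrite ler_pdivrMr ?ltr_pwDl// ler_peMr// lerDl.
Qed.

(** The power [x] of the inequality [v <= expR v] at [v = u / (2 * x)], chosen to leave the
    exponential [expR (u / 2)]. *)
Lemma powR_le_expR (x u : R) : 0 < x -> 0 <= u -> u `^ x <= (2 * x) `^ x * expR (u / 2).
Proof.
move=> x0 u0; have x2 : 0 < 2 * x by rewrite mulr_gt0.
have h : u / (2 * x) <= expR (u / (2 * x)).
  by rewrite (le_trans _ (expR_ge1Dx _))// lerDr.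
have -> : expR (u / 2) = expR (u / (2 * x)) `^ x by rewrite -expRM; congr expR; field; rewrite gt_eqF.
rewrite -powRM ?expR_ge0 ?(ltW x2)// ge0_ler_powR ?nnegrE ?(ltW x0)//.
- by rewrite mulr_ge0 ?expR_ge0// ltW.
- by rewrite mulrC -ler_pdivrMr.
Qed.

Lemma series_inv_square (c : R) k : (0 < k)%N -> 0 <= c ->
  cvgn (series (fun m => c / (k + m).+1%:R ^+ 2)).
Proof.
move=> k0 c0.
pose y (m : nat) : R := c * (m.+1%:R^-1 - m.+2%:R^-1).
have yS n : series y n = c * (1 - n.+1%:R^-1).
  rewrite /series/= -mulr_sumr; congr (_ * _); elim: n => [|n IH].
    by rewrite big_geq// invr1 subrr.
  by rewrite big_nat_recr//= IH; ring.
apply: (@series_le_cvg _ _ y).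
- by move=> m; rewrite divr_ge0// exprn_ge0.
- by move=> m; rewrite /y mulr_ge0// subr_ge0 lef_pV2 ?posrE ?ltr0n// ler_nat.
- move=> m; rewrite /y ler_wpM2l//.
  have m1 : 0 < m.+1%:R :> R by rewrite ltr0n.
  have m2 : 0 < m.+2%:R :> R by rewrite ltr0n.
  have km : m.+2%:R <= (k + m).+1%:R :> R by rewrite ler_nat ltnS -addn1 addnC leq_add2r.
  rewrite (_ : m.+1%:R^-1 - m.+2%:R^-1 = (m.+1%:R * m.+2%:R)^-1); last first.
    move: m1 m2; rewrite -[m.+2%:R]natr1; move: (m.+1%:R : R) => a a0 a1.
    by field; rewrite !gt_eqF.
  rewrite lef_pV2 ?posrE ?mulr_gt0 ?exprn_gt0 ?ltr0n// expr2.
  apply: ler_pM => //; apply: le_trans km; by rewrite ler_nat.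
- apply/cvg_ex; exists (c * (1 - 0)); rewrite (funext yS); apply: cvgMr.
  by apply: cvgB; [exact: cvg_cst|exact: cvg_harmonic].
Qed.

(* |z + N| - (Re z + N) = (Im z)^2 / (|z + N| + Re z + N) is small for large N. *)
Lemma cmod_shift_excess (z : R[i]) : 0 < Re z ->
  exists2 N : nat, (0 < N)%N & cmod (z + N%:R) - N%:R - Re z <= 1 / 2.
Proof.
move=> z0; pose y := Im z; exists (Num.truncn (2 * y ^+ 2)).+1 => //.
set N := _.+1; have Ny : 2 * y ^+ 2 < N%:R by exact: truncnS_gt.
have xN : 0 <= Re z + N%:R + 1 / 2 by rewrite addr_ge0 ?divr_ge0// addr_ge0// ltW.
set w := cmod _.
suff : w <= Re z + N%:R + 1 / 2 by lra.
rewrite /w cmodE -[leRHS]ger0_norm// -sqrtr_sqr ler_wsqrtr//.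
rewrite ReD ImD Re_nat Im_nat addr0 -/y.
by have := sqr_ge0 y; nra.
Qed.
End bounds.

Section identification.
Context {R : realType}.
Variables (phi : R[i] -> R[i]) (z : R[i]).
Hypotheses (hphi : bernstein phi) (z0 : 0 < Re z).
Notation leb := (@lebesgue_measure R).
Notation pr k := (Re (phi k%:R)).
Notation p := (fun k : nat => phi k%:R).
Notation q := (fun k : nat => phi (z + k%:R)).
Notation x := (Re z).
Let Pn (k : nat) : R := 1 + pr k.

Let pr0 k : 0 <= pr k. Proof. by have [] := bernstein_facts hphi. Qed.
Let Pn1 k : 1 <= Pn k. Proof. by rewrite lerDl. Qed.
Let Pn0 k : 0 < Pn k. Proof. by rewrite (lt_le_trans ltr01). Qed.
Let PnS k : Pn k <= Pn k.+1. Proof. by have [_ _ h _ _] := bernstein_facts hphi; rewrite lerD2l. Qed.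
Let PnC k : p k = (Pn k - 1)%:C.
Proof. by rewrite /Pn addrC addKr; have [] := bernstein_facts hphi. Qed.
Let Pn_le j k : (j <= k)%N -> Pn j <= Pn k.
Proof.
move=> jk; rewrite -(subnK jk); elim: (k - j)%N => [|i IH]; first by rewrite add0n.
by rewrite addSn (le_trans IH).
Qed.

Let Dle k : k%:R * (pr k.+1 - pr k) <= pr k.
Proof. by have := bernstein_increment_le hphi k; rewrite -natr1; lra. Qed.

(** By concavity no increment exceeds the first one. *)
Lemma Pn_linear k : Pn k <= Pn 1 * k.+1%:R.
Proof.
have [_ _ _ cv _] := bernstein_facts hphi.
have D1 k' : pr k'.+1 - pr k' <= pr 1 - pr 0.
  by elim: k' => [|k' IH]//; rewrite (le_trans (cv k')).
elim: k => [|k IH]; first by rewrite mulr1.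
have h := D1 k; have h0 := pr0 0; have h1 := Pn1 1.
rewrite -natr1 mulrDr mulr1 (le_trans (_ : _ <= Pn k + Pn 1))// ?lerD2r//.
by rewrite /Pn; lra.
Qed.

Lemma Re_phi_ge0 (w : R[i]) : 0 <= Re w -> 0 <= Re (phi w).
Proof.
move=> w0; have [_ _ _ _ [h _ _]] := bernstein_facts hphi.
by rewrite (le_trans _ (h w w0))//; exact: (pr0 0).
Qed.

Lemma q_increment (N : nat) k :
  cmod (phi (z + (k.+1 + N)%:R) - p k.+1) <= cmod (z + N%:R) * (Pn k.+1 - Pn k).
Proof.
have [_ _ _ _ [_ h _]] := bernstein_facts hphi.
have w0 : 0 <= Re (z + N%:R) by rewrite ReD Re_nat addr_ge0// ltW.
have := h (z + N%:R) k w0.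
rewrite (_ : z + N%:R + k.+1%:R = z + (k.+1 + N)%:R); last by rewrite natrD; ring.
by rewrite (_ : Pn k.+1 - Pn k = pr k.+1 - pr k)// /Pn; ring.
Qed.

Lemma ccont_Gfun n : ccont (Gfun phi z n).
Proof. by apply: ccont_conv1; exact: lint_gdens. Qed.

Let mI (t : R) := @measurable_itvR R `[0, t].

Lemma wb_Gfun n : wb (cmod z * ((2 * x) `^ x / x)) (Gfun phi z n).
Proof.
move=> t t0.
have [ip ep] := integrable_powR z0 t0.
apply: (@le_trans _ _ (cmod z * (t `^ x / x))).
  rewrite -ep -RintegralZl//.
  apply: cmod_cintegral_le => //.
  - by have := conv_cintble0 t (lint_gdens phi z0 n) (lbd_cst (1 : R[i])) => /cintble_cmeas.
  - exact: (integrableZl (mI t) (cmod z) ip).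
  - move=> s; rewrite /= in_itv/= => /andP[s0 st].
    rewrite !mulr1 /gdens cmodM ler_wpM2l ?cmod_ge0// cmodM cmod_ce.
    rewrite (_ : x - 1 = Re (z - 1)); last by rewrite ReD ReN.
    rewrite -[leRHS]mul1r ler_pM ?expR_ge0 ?cmod_ge0//; last exact: cmod_cpow_le.
    by rewrite -expR0 ler_expR oppr_le0 mulr_ge0.
rewrite -mulrA ler_wpM2l ?cmod_ge0// mulrAC ler_wpM2r ?invr_ge0 ?(ltW z0)//.
rewrite (le_trans (powR_le_expR z0 t0))// ler_wpM2l ?powR_ge0// ler_expR.
by rewrite ler_pdivrMr// ler_peMr// ler1n.
Qed.

(** From here on the process enters only through these properties of [V_n]: local integrability, the
    recursion given by the two splittings, and the comparison of [z V_{n+2}] with the density of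
    [G_{n+1}]. *)
Variable V : nat -> R -> R[i].
Hypothesis lV : forall n, (0 < n)%N -> lint (V n).
Hypothesis Vrec : forall n t, (0 < n)%N ->
  conv (V n) (ce (q n)) t = conv (V n.+1) (ce (p n)) t.
Hypothesis Vest : forall n (s : R), 0 <= s ->
  cmod (z * V n.+2 s - gdens phi z n.+1 s) <=
  cmod z * (cmod (z - 1) * s `^ (x - 1) * Re (ce (p n) s - ce (p n.+1) s)).
Let S n : R -> R[i] := conv (V n) (fun=> 1).

Let l1 : lbd (fun=> 1 : R[i]). Proof. exact: lbd_cst. Qed.
Let lS n : (0 < n)%N -> lbd (S n). Proof. by move=> n0; apply: lbd_conv => //; exact: lV. Qed.

(** Convolve [u] with the identity [1 = E_a + a E_a * 1]. *)
Lemma conv_one_expand (a : R[i]) (u : R -> R[i]) t : lint u ->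
  conv u (fun=> 1) t = conv u (ce a) t + a * conv (conv u (ce a)) (fun=> 1) t.
Proof.
move=> lu; have [t0|t0] := ltP t 0; first by rewrite !conv_neg// mulr0 addr0.
have la : lbd (ce a) by exact: lbd_ce.
have lc : lbd (conv (ce a) (fun=> 1)) by apply: lbd_conv => //; exact: lbd_lint.
rewrite convA// -convZr// -convDr//; last exact: lbdZ.
apply: eq_conv => // s /andP[s0 _].
rewrite (_ : conv _ _ s = cintegral leb `[0, s] (ce a)); last first.
  by apply: eq_cintegral => r _; rewrite mulr1.
by rewrite cintegral_ce// subrKC.
Qed.

(** The 1 in [S_n] is expanded with [E_{q n}] and that in [S_{n+1}] with [E_{p n}]. By [Vrec] the
    leading terms agree, and the others are [q n] and [p n] times the same function, which is
    [expo (p n)] of [S_{n+1}]. *)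
Lemma S_recursion n t : (0 < n)%N ->
  S n t = S n.+1 t + (q n - p n) * expo (p n) (S n.+1) t.
Proof.
move=> n0; have lVn := lV n0; have lVS := lV (ltn0Sn n).
rewrite {1}/S (conv_one_expand (q n) t lVn) /S (conv_one_expand (p n) t lVS).
rewrite (funext (fun t => @Vrec n t n0)) /expo.
rewrite [conv (conv _ (fun=> 1)) _ t]convAC//; last exact: lbd_ce.
by rewrite mulrBl addrAC -addrA subrK.
Qed.

Lemma S_Kop n : S 1 = Kop p q n (S n.+1).
Proof.
elim: n => [|n IH] //; rewrite IH.
rewrite (funext (fun t => @S_recursion n.+1 t (ltn0Sn n))).
have lSn : lbd (S n.+2) by exact: lS.
have lE : lbd (expo (p n.+1) (S n.+2)) by exact: lbd_expo (lbd_lint lSn).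
rewrite KopD//; last exact: lbdZ.
rewrite KopZ//; apply/funext => t /=.
by rewrite Kop_expo.
Qed.

Let err n (t : R) : R[i] := z * S n.+1 t + -1 * Gfun phi z n t.

Let lerr n : lbd (err n).
Proof. by apply: lbdD; apply: lbdZ; [exact: lS|exact: lbd_Gfun]. Qed.

Lemma S_sub_truncated n :
  (fun t => z * S 1 t + -1 * truncated_convolution phi z n t) = Kop p q n (err n).
Proof.
rewrite truncated_convolutionE// /err.
have lSn : lbd (S n.+1) by exact: lS.
have lG := lbd_Gfun phi z0 n.
rewrite KopD; [|exact: lbdZ|exact: lbdZ].
by rewrite !KopZ// (S_Kop n).
Qed.

Let Cerr : R := 2 * cmod z * cmod (z - 1) * (2 * x) `^ x.

(** A bound for the gamma integral: half of the exponential absorbs the power through [powR_le_expR]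
    at [u = P s], and the other half is integrated. *)
Lemma Gamma_mass (P T : R) : 0 < P -> 0 <= T ->
  leb.-integrable `[0, T] (EFin \o (fun s => s `^ x * expR (- (P * s)))) /\
  \int[leb]_(s in `[0, T]) (s `^ x * expR (- (P * s))) <= 2 * (2 * x) `^ x / P `^ (x + 1).
Proof.
move=> P0 T0.
have ie : leb.-integrable `[0, T] (EFin \o (fun s => expR (- (P / 2 * s)))).
  have := integrable_cmod (mI T) (lbd_lint (@lbd_ce R (P / 2)%:C) T).
  by apply: eq_integrable => // s _ /=; rewrite cmod_ce.
have pw s : 0 <= s -> s `^ x * expR (- (P * s)) <= (2 * x) `^ x / P `^ x * expR (- (P / 2 * s)).
  move=> s0; have h := powR_le_expR z0 (mulr_ge0 (ltW P0) s0).
  rewrite mulrAC ler_pdivlMr ?powR_gt0// mulrAC -powRM ?(ltW P0)// [s * P]mulrC.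
  rewrite (le_trans (ler_wpM2r (expR_ge0 _) h))//.
  rewrite [leLHS](_ : _ = (2 * x) `^ x * (expR (P * s / 2) * expR (- (P * s)))); last by ring.
  rewrite ler_wpM2l ?powR_ge0// -expRD ler_expR.
  by rewrite le_eqVlt; apply/orP; left; apply/eqP; field.
have ip : leb.-integrable `[0, T] (EFin \o (fun s => s `^ x * expR (- (P * s)))).
  apply: (@le_integrable _ _ _ leb _ (mI T) _ (EFin \o (fun s => (2 * x) `^ x / P `^ x * expR (- (P / 2 * s))))).
  - apply/measurable_EFinP; apply: measurable_funM.
      by apply: measurable_funTS; exact: measurable_powR.
    apply: measurableT_comp => //; apply: measurable_funN; apply: measurable_funM => //.
  - move=> s; rewrite /= in_itv/= => /andP[s0 _]; rewrite lee_fin !ger0_norm ?pw//.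
      by rewrite mulr_ge0 ?expR_ge0// divr_ge0 ?powR_ge0.
    by rewrite mulr_ge0 ?expR_ge0 ?powR_ge0.
  - exact: (integrableZl (mI T) _ ie).
split=> //.
have P2 : 0 < P / 2 by rewrite divr_gt0.
apply: (@le_trans _ _ ((2 * x) `^ x / P `^ x * (P / 2)^-1)); last first.
  rewrite powRD ?powRr1 ?(ltW P0)//; last by rewrite (gt_eqF P0) implybT.
  by rewrite le_eqVlt; apply/orP; left; apply/eqP; field; rewrite !gt_eqF// powR_gt0.
apply: le_trans (ler_wpM2l _ (le_inv_expR P2 T0)); last by rewrite divr_ge0 ?powR_ge0.
rewrite -RintegralZl//; apply: le_Rintegral => //; first exact: (integrableZl (mI T) _ ie).
by move=> s; rewrite /= in_itv/= => /andP[s0 _]; exact: pw.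
Qed.

(** In [Vest] the difference of exponentials is at most [De * s] times [exp (- pr m s)]. The weight
    [expR t] pays for replacing [pr m] by [Pn m]; then [Gamma_mass] gives the exponent [- (x + 1)]
    of [Pn m], and [De / Pn m <= 1 / m] by concavity. *)
Lemma wb_err m : (0 < m)%N -> wb (Cerr / m%:R / Pn m `^ x) (err m.+1).
Proof.
move=> m0 t t0; have mn : 0 < m%:R :> R by rewrite ltr0n.
have lVm : lint (V m.+2) by exact: lV.
have lg := lint_gdens phi z0 m.+1.
set De := pr m.+1 - pr m.
have De0 : 0 <= De by have := PnS m; rewrite /De /Pn; lra.
have e1 : err m.+1 t = cintegral leb `[0, t] (fun s => z * V m.+2 s - gdens phi z m.+1 s).
  rewrite /err mulN1r /S /Gfun -convZl//.
  have i1 := conv_cintble0 t (lintZ z lVm) l1; have i2 := conv_cintble0 t lg l1.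
  rewrite /conv -(cintegralB (mI t) i1 i2).
  by apply: eq_cintegral => s _; rewrite !mulr1.
have [ig G] := Gamma_mass (Pn0 m) t0.
pose K := cmod z * cmod (z - 1) * De * expR t.
have K0 : 0 <= K by rewrite /K mulr_ge0 ?expR_ge0// mulr_ge0// mulr_ge0// cmod_ge0.
rewrite e1; apply: (@le_trans _ _ (K * (2 * (2 * x) `^ x / Pn m `^ (x + 1)))); last first.
  have -> : Pn m `^ (x + 1) = Pn m `^ x * Pn m.
    by rewrite powRD ?powRr1 ?(ltW (Pn0 m))// (gt_eqF (Pn0 m)) implybT.
  have px : 0 < Pn m `^ x by rewrite powR_gt0.
  have h : De / Pn m <= m%:R^-1.
    rewrite ler_pdivrMr// mulrC ler_pdivlMr// mulrC.
    by rewrite (le_trans (Dle m))// /Pn lerDr.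
  rewrite /K [leLHS](_ : _ = Cerr / Pn m `^ x * expR t * (De / Pn m)); last first.
    by rewrite /Cerr; move: px (Pn0 m) => px p0; field; rewrite !gt_eqF.
  rewrite [leRHS](_ : _ = Cerr / Pn m `^ x * expR t * m%:R^-1); last by ring.
  rewrite ler_wpM2l// mulr_ge0 ?expR_ge0// divr_ge0 ?powR_ge0// /Cerr.
  by rewrite mulr_ge0 ?powR_ge0// mulr_ge0 ?cmod_ge0// mulr_ge0// cmod_ge0.
apply: le_trans (ler_wpM2l K0 G); rewrite -RintegralZl//.
apply: cmod_cintegral_le => //.
- exact: cintble_cmeas (cintbleB (mI t) (lintZ z lVm t) (lg t)).
- exact: (integrableZl (mI t) K ig).
- move=> s; rewrite /= in_itv/= => /andP[s0 st].
  rewrite (le_trans (Vest m s0))// /K -!mulrA ler_wpM2l ?cmod_ge0// ler_wpM2l ?cmod_ge0//.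
  have [->|sn0] := eqVneq s 0.
    rewrite !ce0 subrr (_ : Re 0 = 0)// mulr0 powR0 ?mul0r ?mulr0//.
    by rewrite gt_eqF.
  have sp : 0 < s by rewrite lt_neqAle eq_sym sn0.
  have -> : s `^ x = s `^ (x - 1) * s.
    by rewrite -{1}(subrK 1 x) [LHS]powRD ?powRr1// (gt_eqF sp) implybT.
  rewrite [leRHS](_ : _ = s `^ (x - 1) * (De * s * (expR t * expR (- (Pn m * s))))); last by ring.
  rewrite ler_wpM2l ?powR_ge0//.
  have c k : ce (p k) s = (expR (- (pr k * s)))%:C.
    have [hk _ _ _ _] := bernstein_facts hphi.
    by rewrite /ce hk/= -rmorphM -rmorphN cexpC.
  rewrite !c -rmorphB/=.
  have ee : expR (- (pr m.+1 * s)) = expR (- (pr m * s)) * expR (- (De * s)).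
    by rewrite -expRD; congr expR; rewrite /De; ring.
  have dd : 1 - expR (- (De * s)) <= De * s.
    by rewrite lerBlDl -lerBlDr; have := expR_ge1Dx (- (De * s)); rewrite addrC.
  have et : expR (- (pr m * s)) <= expR t * expR (- (Pn m * s)).
    by rewrite -expRD ler_expR /Pn mulrDl mul1r; lra.
  rewrite ee -[X in X - _]mulr1 -mulrBr mulrC.
  apply: ler_pM => //; rewrite ?expR_ge0//.
  by rewrite subr_ge0 -expR0 ler_expR oppr_le0 mulr_ge0.
Qed.

(** Exponents of [Pn j]: [- x] from the error, [- N] from the chain of smoothings and
    [w = cmod (z + N)] from [wb_Kop]. By [exc] they add up to at most [1 / 2]. Since [Pn j] is at
    most linear in [j], only a square root of [j] is lost against the factor [1 / j] of the
    error. *)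
Lemma expo_iter_Kop_err N j : (0 < N)%N -> (0 < j)%N ->
  cmod (z + N%:R) - N%:R - x <= 1 / 2 ->
  wb (Cerr * Num.sqrt (2 * Pn 1) / Num.sqrt j%:R)
     (expo_iter q N (Kop p q (j + N) (err (j + N)))).
Proof.
move=> N0 j0 exc.
have jn : 0 < j%:R :> R by rewrite ltr0n.
have C0 : 0 <= Cerr.
  by rewrite /Cerr mulr_ge0 ?powR_ge0// mulr_ge0 ?cmod_ge0// mulr_ge0// cmod_ge0.
have le := lerr (j + N).
rewrite expo_iter_Kop//.
have [m mE] : exists m, (j + N)%N = m.+1 by case: (j + N)%N (addn_gt0 j N) => [|m _]; [rewrite j0|exists m].
have jm : (j <= m)%N by rewrite -ltnS -mE -{1}[j]addn0 ltn_add2l.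
have m0 : (0 < m)%N by exact: leq_trans jm.
have B0 : 0 <= Cerr / j%:R / Pn j `^ x by rewrite divr_ge0 ?powR_ge0// divr_ge0.
have wE : wb (Cerr / j%:R / Pn j `^ x) (err (j + N)).
  rewrite mE; apply: wb_le (wb_err m0).
  have pj : 0 < Pn j `^ x by rewrite powR_gt0.
  have pm : Pn j `^ x <= Pn m `^ x.
    by rewrite ge0_ler_powR ?nnegrE ?(ltW z0) ?(ltW (Pn0 _))// Pn_le.
  have hh : m%:R^-1 / Pn m `^ x <= j%:R^-1 / Pn j `^ x.
    apply: ler_pM; rewrite ?invr_ge0 ?powR_ge0//.
      by rewrite lef_pV2 ?posrE ?ltr0n// ler_nat.
    by rewrite lef_pV2 ?posrE ?(lt_le_trans pj).
  by have := ler_wpM2l C0 hh; rewrite !mulrA.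
have [lc wc] := wb_expo_chain j N B0 Pn1 PnC PnS le wE.
have B1 : 0 <= Cerr / j%:R / Pn j `^ x / Pn j ^+ N by rewrite divr_ge0// exprn_ge0// ltW.
have := @wb_Kop R p (fun k => q (k + N)%N) Pn (cmod (z + N%:R)) j _ _ B1 (cmod_ge0 _) Pn1 PnC PnS
  (q_increment N) lc wc.
apply: wb_le; set w := cmod _ in exc *.
have w0 : 0 <= w by exact: cmod_ge0.
have r0 : Pn j / Pn 0%N <= Pn j by rewrite ler_pdivrMr// ler_peMr ?(ltW (Pn0 j)).
have r1 : (Pn j / Pn 0%N) `^ w <= Pn j `^ w.
  by rewrite ge0_ler_powR ?nnegrE ?divr_ge0 ?(ltW (Pn0 _)).
rewrite (le_trans (ler_wpM2l B1 r1))//.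
have e1 : Pn j `^ w / Pn j `^ x / Pn j ^+ N = Pn j `^ (w - N%:R - x).
  rewrite -powR_mulrn ?ltW// -!powRN -!powRD ?(gt_eqF (Pn0 j)) ?implybT//.
  by congr (_ `^ _); ring.
have e2 : Pn j `^ (w - N%:R - x) <= Num.sqrt (2 * Pn 1 * j%:R).
  apply: (@le_trans _ _ (Pn j `^ (1 / 2))); first by rewrite ler_powR.
  rewrite div1r powR12_sqrt ?(ltW (Pn0 j))// ler_wsqrtr// (le_trans (Pn_linear j))//.
  rewrite [leRHS](_ : _ = Pn 1 * (2 * j%:R)); last by ring.
  rewrite ler_wpM2l ?(ltW (Pn0 1))// -natr1 mulrDl mul1r lerD2l ler1n //.
rewrite [leLHS](_ : _ = Cerr / j%:R * (Pn j `^ w / Pn j `^ x / Pn j ^+ N)); last by ring.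
rewrite e1 (le_trans (ler_wpM2l _ e2)) ?divr_ge0//.
have sj : 0 < Num.sqrt j%:R :> R by rewrite sqrtr_gt0.
have jj : j%:R = Num.sqrt j%:R * Num.sqrt j%:R :> R by rewrite -expr2 sqr_sqrtr.
rewrite sqrtrM ?mulr_ge0 ?(ltW (Pn0 1))// {1}jj.
by rewrite le_eqVlt; apply/orP; left; apply/eqP; field; rewrite gt_eqF.
Qed.

Lemma truncated_limit : exists (U : R -> R[i]) (n0 : nat) (d : nat -> R),
  [/\ lbd U, d n @[n --> \oo] --> (0 : R) &
  forall n, wb (d n) (fun s => truncated_convolution phi z (n0 + n) s - U s)].
Proof.
pose b := 1 + cmod z.
have b0 : 0 <= b by rewrite addr_ge0 ?cmod_ge0.
(* [kernel_mass] holds for indices of at least [2 * b], so the infinite product is started at [n0],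
   with the first [n0] brackets as initial function. *)
pose n0 := (Num.truncn (2 * b)).+1.
have n0b : 2 * b <= n0%:R by rewrite ltW// truncnS_gt.
pose W n := truncated_convolution phi z (n0 + n).
pose h n := kernel phi z (n0 + n).+1.
pose c n : R := 48 * b ^+ 2 / (n0 + n).+1%:R ^+ 2.
have C0 : 0 <= 48 * b ^+ 2 by rewrite mulr_ge0// exprn_ge0.
have lW n : lbd (W n) by rewrite /W truncated_convolutionE//; apply: lbd_Kop; exact: lbd_Gfun.
have lh n : lbd (h n) by exact: lbd_kernel.
have BG0 : 0 <= cmod z * ((2 * x) `^ x / x).
  by rewrite mulr_ge0 ?cmod_ge0// divr_ge0 ?powR_ge0// ltW.
have qi k : cmod (q k.+1 - p k.+1) <= cmod z * (Pn k.+1 - Pn k).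
  by have := q_increment 0 k; rewrite addn0 addr0.
have w0 := @wb_Kop R p q Pn (cmod z) n0 _ _ BG0 (cmod_ge0 z) Pn1 PnC PnS qi (lbd_Gfun phi z0 n0) (wb_Gfun n0).
set B := _ * _ `^ _ in w0.
have B0 : 0 <= B by rewrite /B mulr_ge0// powR_ge0.
have wW : wb B (W 0%N) by rewrite /W addn0 truncated_convolutionE.
have kn n : 2 * b <= (n0 + n).+1%:R by apply: le_trans n0b _; rewrite ler_nat -addnS leq_addr.
have WS n (t : R) : 0 <= t -> W n.+1 t = W n t + conv (W n) (h n) t.
  by move=> _; rewrite /W addnS !truncated_convolutionE// Kop_Gfun_succ.
have [U [d [lU d0 dU]]] := @wb_convolution_limit R W h c B B0
  (fun n => divr_ge0 C0 (exprn_ge0 _ (ler0n _ _))) (series_inv_square (ltn0Sn _) C0) (lW 0%N) lh wW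
  WS lW (fun n T T0 => kernel_mass hphi z0 (ltn0Sn _) (kn n) T0).
by exists U, n0, d.
Qed.

(** The limit [U] of the truncated convolutions exists already; its equality with [z S_1] is proved
    after [N] smoothings, which are undone by injectivity, both functions being continuous on the
    open half-line. *)
Lemma truncated_convolution_cvg (t : R) : 0 < t ->
  cmod (truncated_convolution phi z n t - z * conv (V 1) (fun=> 1) t) @[n --> \oo] --> (0 : R).
Proof.
move=> t0; rewrite -/(S 1).
have [U [n0 [d [lU d0 dU]]]] := truncated_limit.
have [N N0 exc] := cmod_shift_excess z0.
have d_ge0 n : 0 <= d n.
  by have := dU n 0 (lexx _); rewrite expR0 mulr1; apply: le_trans; exact: cmod_ge0.
pose W n := truncated_convolution phi z n.
have lW n : lbd (W n) by rewrite /W truncated_convolutionE//; apply: lbd_Kop; exact: lbd_Gfun.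
have cW n : ccont (W n).
  rewrite /W truncated_convolutionE//; apply: ccont_Kop; [exact: lbd_Gfun|exact: ccont_Gfun].
have cU : ccont U by apply: (@ccont_limit _ (fun n => W (n0 + n)%N) U d).
have lM : lbd (fun s => z * S 1 s) by apply: lbdZ; exact: lS.
have cS : ccont (S 1) by apply: ccont_conv1; exact: lV.
have cM : ccont (fun s => z * S 1 s) by apply: ccontM => //; exact: ccont_cst.
have lD : lbd (fun s => z * S 1 s + -1 * U s) by apply: lbdD => //; exact: lbdZ.
have cD : ccont (fun s => z * S 1 s + -1 * U s).
  by apply: ccontD => //; apply: ccontM => //; exact: ccont_cst.
have q0 k : 0 <= Re (q k) by apply: Re_phi_ge0; rewrite ReD Re_nat addr_ge0// ltW.
have Z s : 0 < s -> expo_iter q N (fun s => z * S 1 s + -1 * U s) s = 0.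
  move=> s0; apply: cmod_eq0.
  pose C := Cerr * Num.sqrt (2 * Pn 1).
  pose bound (j : nat) := (C * Num.sqrt ((j + n0).+1%:R^-1) + d (j + N.+1)%N) * expR s.
  have cb : bound j @[j --> \oo] --> (0 : R).
    rewrite -(mul0r (expR s)); apply: cvgMl; rewrite -[X in _ --> X](addr0 0); apply: cvgD.
      rewrite -(mulr0 C); apply: cvgMr; rewrite -(@sqrtr0 R).
      have h0 : (j + n0).+1%:R^-1 @[j --> \oo] --> (0 : R).
        by rewrite (cvg_shiftn n0 (fun j => j.+1%:R^-1 : R)); exact: cvg_harmonic.
      exact: (continuous_cvg _ (@sqrt_continuous R 0) h0).
    by rewrite (cvg_shiftn N.+1).
  have key j : cmod (expo_iter q N (fun s => z * S 1 s + -1 * U s) s) <= bound j.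
    (* The index [n] is read as [j' + N], with [j' > 0], for the bound on the smoothed error, and as
       [n0 + (j + N.+1)] for the convergence to [U]. *)
    pose j' := (j + n0).+1; pose n := (j' + N)%N.
    have nE : n = (n0 + (j + N.+1))%N by rewrite /n /j' addnS addSn; ring.
    have -> : (fun s => z * S 1 s + -1 * U s) = fun s => (z * S 1 s + -1 * W n s) + (W n s - U s).
      by apply/funext => r; ring.
    have lWU : lbd (fun s => W n s - U s).
      rewrite (_ : (fun s => _) = fun s => W n s + -1 * U s).
        by apply: lbdD => //; exact: lbdZ.
      by apply/funext => r; rewrite mulN1r.
    rewrite expo_iterD//; last by apply: lbdD => //; exact: lbdZ.
    rewrite (le_trans (cmodD _ _))// /bound mulrDl lerD//.
      rewrite S_sub_truncated.
      have := @expo_iter_Kop_err N j' N0 (ltn0Sn _) exc s (ltW s0).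
      by rewrite sqrtrV.
    apply: (@wb_expo_iter R N q (d (j + N.+1)%N) _ (d_ge0 _) q0 lWU _ s (ltW s0)).
    by rewrite /W nE; exact: dU.
  have cc : cst (cmod (expo_iter q N (fun s => z * S 1 s + -1 * U s) s)) j @[j --> \oo] --> (0 : R).
    apply: (@squeeze_cvgr _ _ _ _ (cst 0) bound) => //; last exact: cvg_cst.
    by apply: nearW => j; rewrite cmod_ge0 key.
  by have <- := cvg_lim (@norm_hausdorff _ R^o) cc; rewrite lim_cst.
have E := expo_iter_inj lD cD Z t0.
have UE : U t = z * S 1 t by move: E; rewrite mulN1r => /eqP; rewrite subr_eq0 => /eqP.
rewrite -UE -(cvg_shiftn n0).
apply: (@squeeze_cvgr _ _ _ _ (cst 0) (fun n => d n * expR t)).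
- apply: nearW => n; rewrite cmod_ge0/= addnC.
  exact: (dU n t (ltW t0)).
- exact: cvg_cst.
- by rewrite -(mul0r (expR t)); apply: cvgMl.
Qed.
End identification.

Theorem theorem2p12 (R : realType) (d : measure_display) (T : measurableType d)
    (P : probability T R) (phi : R[i] -> R[i]) (X : R -> T -> \bar R)
    (hphi : bernstein phi) (hX : killed_subordinator P phi X)
    (t : R) (ht : 0 < t) (z : R[i]) (hz : 0 < complex.Re z) :
  (fun n => truncated_convolution phi z n t : R[i]^o) @ \oo -->
  (cexpectation P (fun w => cpow (exp_functional X t w) z) : R[i]^o).
Proof.
have [[Y [e [hY he hind XE]]] hL] := hX.
have XE' s w : 0 <= s -> X s w = if (s%:E < e w)%E then (Y s w)%:E else +oo%E.
  by move=> s0; exact: XE.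
have hX' (w : R[i]) (s : R) : 0 <= Re w -> 0 <= s ->
    cexpectation P (fun x => cexpN w (if (s%:E < e x)%E then (Y s x)%:E else +oo%E)) = ce (phi w) s.
  by move=> w0 s0; rewrite /ce -(hL w s w0 s0); congr cexpectation; apply/funext => x; rewrite XE'.
rewrite (moment_functional hY he hind hz (ltW ht) XE').
apply: cmod_cvg.
have H := @truncated_convolution_cvg R phi z hphi hz (Vfun phi Y z)
  (fun n n0 => lint_Vfun phi hY hz n0)
  (fun n s n0 => Vfun_recursion hY he hind hX' hz s n0)
  (fun n s s0 => Vfun_estimate hY he hind hX' hz n s0) t ht.
exact: H.
Qed.
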